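(* Suppose that $J$ is positive-definite and $J^{-1}$ is a trace class operator. Then $$w^{[1]}_k(z)=-\frac{w_{k+1}(z)}{a_0\,w(z)}\qquad\text{for all }k\ge0,$$ and $$w_k(z)=\frac{w_k(0)\,\mathfrak{F}^{[k+1]}(z)}{\mathfrak{F}(z)}\qquad\text{for all }k\ge0 .$$ Both are equalities between meromorphic functions on $\mathbb{C}$.
   Context: $\mathbb{N}_0=\{0,1,2,\dots\}$; $(\boldsymbol e_n)_{n\ge0}$ is the standard basis of $\ell^2(\mathbb{N}_0)$. Let $(a_n)_{n\ge0}$ be positive numbers, $(b_n)_{n\ge0}$ real numbers, and $\mathcal{J}$ the infinite symmetric tridiagonal matrix with $\mathcal{J}_{n,n}=b_n$, $\mathcal{J}_{n,n+1}=\mathcal{J}_{n+1,n}=a_n$. The Jacobi operator $J$ is the closure in $\ell^2(\mathbb{N}_0)$ of the action of $\mathcal{J}$ on finitely supported sequences. It is assumed that $J$ is positive-definite and that $J^{-1}$ is a trace class operator on $\ell^2(\mathbb{N}_0)$; in particular $J$ is self-adjoint, $0$ is in its resolvent set, and its spectrum consists of simple eigenvalues $0<\zeta_1<\zeta_2<\cdots\to\infty$. The functions of the second kind are $w_k(z)=\langle\boldsymbol e_k,(J-zI)^{-1}\boldsymbol e_0\rangle$, $k\ge0$, and $w(z)=w_0(z)$ is Weyl's function; these are meromorphic on $\mathbb{C}$. The characteristic function of $J$ is the entire function $\mathfrak{F}(z)=\prod_{n=1}^\infty(1-z/\zeta_n)$. For $m\ge1$, $J^{[m]}$ is the Jacobi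 operator obtained from $J$ by removing the first $m$ rows and columns of the matrix; it is known to satisfy the same assumptions (positive-definite with trace class inverse). Objects attached to $J^{[m]}$ carry the superscript $[m]$: $w_k^{[m]}(z)=\langle \boldsymbol e_k,(J^{[m]}-zI)^{-1}\boldsymbol e_0\rangle$, and $\mathfrak{F}^{[m]}(z)=\prod_n(1-z/\zeta_n^{[m]})$, where $\zeta_n^{[m]}$ are the eigenvalues of $J^{[m]}$. *)

(* Defs.v *)
From Stdlib Require Import Reals ClassicalEpsilon.
From Coquelicot Require Export Coquelicot.

Local Open Scope C_scope.

(** * The Hilbert space l^2(N_0)

    Vectors are arbitrary complex sequences; membership in l^2 is the explicit
    predicate [ell2].  [Series] is total, so [norm2] and [inner] are meaningful
    only on [ell2] vectors. *)

Definition vec := nat -> C.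

Definition ell2 (u : vec) : Prop := ex_series (fun n => (Cmod (u n) ^ 2)%R).

Definition norm2 (u : vec) : R := sqrt (Series (fun n => (Cmod (u n) ^ 2)%R)).

(** Conjugate-linear in the first argument. *)
Definition inner (u v : vec) : C :=
  (Series (fun n => Re (Cconj (u n) * v n)),
   Series (fun n => Im (Cconj (u n) * v n))).

Definition vzero : vec := fun _ => 0.
Definition vadd (u v : vec) : vec := fun n => u n + v n.
Definition vscal (c : C) (u : vec) : vec := fun n => c * u n.
Definition vsub (u v : vec) : vec := fun n => u n - v n.

Definition basis (k : nat) : vec := fun n => if Nat.eqb n k then 1 else 0.

Definition l2_converges (us : nat -> vec) (u : vec) : Prop :=
  is_lim_seq (fun j => norm2 (vsub (us j) u)) 0%R.

Definition finitely_supported (u : vec) : Prop :=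
  exists N : nat, forall n : nat, (N <= n)%nat -> u n = 0.

(** * Operators

    A possibly unbounded operator is given by its graph: [A u v] reads
    "[u] is in the domain of [A] and [A u = v]".  An everywhere defined bounded
    operator is a function on [vec], whose values outside [ell2] are
    irrelevant. *)

Definition operator := vec -> vec -> Prop.

Definition bounded_operator (T : vec -> vec) : Prop :=
  (forall u, ell2 u -> ell2 (T u)) /\
  (forall u v, ell2 u -> ell2 v -> T (vadd u v) = vadd (T u) (T v)) /\
  (forall c u, ell2 u -> T (vscal c u) = vscal c (T u)) /\
  (exists M : R, forall u, ell2 u -> (norm2 (T u) <= M * norm2 u)%R).

Definition inverse_of (A : operator) (T : vec -> vec) : Prop :=
  bounded_operator T /\
  forall u v, ell2 v -> (A u v <-> u = T v).

(** [S = |T|], the nonnegative square root of [T^* T]; the last clause says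
    [<v, S^2 u> = <v, T^* T u>]. *)
Definition is_absolute_value (T S : vec -> vec) : Prop :=
  bounded_operator S /\
  (forall u, ell2 u ->
     Im (inner u (S u)) = 0%R /\ (0 <= Re (inner u (S u)))%R) /\
  (forall u v, ell2 u -> ell2 v -> inner v (S (S u)) = inner (T v) (T u)).

(** The trace norm [tr |T|], computed in the standard basis, is finite. *)
Definition trace_class (T : vec -> vec) : Prop :=
  bounded_operator T /\
  exists S, is_absolute_value T S /\
            ex_series (fun n => Re (inner (basis n) (S (basis n)))).

Definition positive_definite (A : operator) : Prop :=
  forall u v, A u v -> u <> vzero ->
    Im (inner u v) = 0%R /\ (0 < Re (inner u v))%R.

Definition inverse_is_trace_class (A : operator) : Prop :=
  exists T, inverse_of A T /\ trace_class T.

(** [A - z I] *)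
Definition op_shift (A : operator) (z : C) : operator :=
  fun u v => A u (vadd v (vscal z u)).

(** [(A - z I)^{-1}]; unspecified when [z] is not in the resolvent set. *)
Definition resolvent (A : operator) (z : C) : vec -> vec :=
  epsilon (inhabits (fun v => v)) (inverse_of (op_shift A z)).

Definition is_eigenvalue (A : operator) (l : C) : Prop :=
  exists u, u <> vzero /\ A u (vscal l u).

(** * Jacobi operators *)

(** Product of the tridiagonal matrix with diagonal [b] and off-diagonal [a]
    by the column [u]. *)
Definition jacobi_action (a b : nat -> R) (u : vec) : vec := fun n =>
  match n with
  | O => RtoC (b 0%nat) * u 0%nat + RtoC (a 0%nat) * u 1%nat
  | S m => RtoC (a m) * u m + RtoC (b (S m)) * u (S m)
           + RtoC (a (S m)) * u (S (S m))
  end.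

(** Closure in l^2 of [jacobi_action] on the finitely supported sequences. *)
Definition jacobi_operator (a b : nat -> R) : operator := fun u v =>
  ell2 u /\ ell2 v /\
  exists us : nat -> vec,
    (forall j, finitely_supported (us j)) /\
    l2_converges us u /\
    l2_converges (fun j => jacobi_action a b (us j)) v.

(** [J^[m]]: the first [m] rows and columns are removed. *)
Definition jacobi_operator_from (m : nat) (a b : nat -> R) : operator :=
  jacobi_operator (fun n => a (m + n)%nat) (fun n => b (m + n)%nat).

(** [w_k(z) = <e_k, (A - z I)^{-1} e_0>] *)
Definition second_kind (A : operator) (k : nat) (z : C) : C :=
  inner (basis k) (resolvent A z (basis 0)).

Definition weyl (A : operator) (z : C) : C := second_kind A 0 z.

(** * The characteristic function *)

(** [zeta] lists all the eigenvalues of [A] in increasing order, starting at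
    index [0] for the smallest one; there is at most one such sequence. *)
Definition is_eigenvalue_sequence (A : operator) (zeta : nat -> R) : Prop :=
  (forall n, (zeta n < zeta (S n))%R) /\
  (forall l : C, is_eigenvalue A l <-> exists n, l = RtoC (zeta n)).

Definition eigenvalue_sequence (A : operator) : nat -> R :=
  epsilon (inhabits (fun _ => 0%R)) (is_eigenvalue_sequence A).

Fixpoint Cprod (f : nat -> C) (N : nat) : C :=
  match N with
  | O => 1
  | S n => Cprod f n * f n
  end.

Definition Clim_seq (u : nat -> C) : C :=
  (real (Lim_seq (fun n => Re (u n))), real (Lim_seq (fun n => Im (u n)))).

Definition characteristic_function (A : operator) (z : C) : C :=
  Clim_seq (Cprod (fun n => 1 - z / RtoC (eigenvalue_sequence A n))).

(** * Meromorphic functions on C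

    A meromorphic function is represented by a total function, whose values at
    the poles are irrelevant. *)

Definition holomorphic_at (g : C -> C) (z0 : C) : Prop :=
  locally z0 (fun z : C => ex_derive g z).

Definition meromorphic (f : C -> C) : Prop :=
  forall z0 : C, exists (n : nat) (g : C -> C),
    holomorphic_at g z0 /\
    locally' z0 (fun z : C => f z = g z / Cpow (z - z0) n).

(** Equality of meromorphic functions: [f] and [g] agree off a set without
    accumulation points in C. *)
Definition meromorphic_eq (f g : C -> C) : Prop :=
  meromorphic f /\ meromorphic g /\
  forall z0 : C, locally' z0 (fun z : C => f z = g z).

(* Main.v *)
Require Import Defs.
From Stdlib Require Import Arith Reals Lra Lia.
From Stdlib Require Import Classical ClassicalEpsilon FunctionalExtensionality.
From Coquelicot Require Import Coquelicot.

(** At [z = 0] let [q n > 0] and [h n > 0] be, up to the sign [(-1)^n], the first kind solution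
    and the entries of [J^{-1} e_0]; positivity of [J] makes the signs alternate.  Then
    [<e_n, J^{-1} e_n> = q n h n], and its sum is finite because [J^{-1} <= |J^{-1}|].

    By interlacing, the reciprocal zeros of the finite determinants [D_n(z) = det (J_n - z)]
    increase with [n], and a growth estimate for the three-term recurrence at [z < 0] bounds their
    sums by twice the trace.  Hence [D_n(z) / D_n(0)] tends to a canonical product [Phi(z)] with
    simple zeros.  Expanding [D_n] along the first row, [psi_k = (-1)^k h_k Phi^[k+1](z)] satisfies
    [(J - z) psi = Phi(z) e_0] and is dominated by [h], so it lies in [l^2].  So the eigenvalues of
    [J] are the zeros of [Phi], whence [Phi] is the characteristic function; off them
    [w_k = psi_k / Phi], which is the second identity, and the first one follows from it since
    passing to [J^[1]] replaces [h_k] by [h_(k+1) / (a_0 h_0)]. *)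

Local Open Scope C_scope.

(** * Complex sequences and series *)

(** No spectral theorem enters: the eigenvalues, their simplicity and the resolvent are all obtained
    from the three-term recurrence. The resolvent and the list of eigenvalues are [epsilon] choices,
    so nothing is known about them until an object with the defining property is exhibited and, for
    the list, shown to be unique.

    The obstacle that shapes the proof is that the statement involves every [J^[m]]. Positivity and
    the trace class condition are therefore used once, to extract [green_data]: positive [h], a
    summable diagonal of the inverse, equality of the closure with the maximal operator. These
    properties pass to [J^[1]] by elementary means, without any further study of inverses of
    compressions. Among them, the vanishing in the limit of the ratio of the two solutions at
    [z = 0] makes the normalizations compatible: [D^[1]_n(0) / D_(n+1)(0)] tends to [h_0].

    The factor 2 in the bound on reciprocal zeros is a bound for [e - 1]; it arises by evaluating
    [D_n] at minus the reciprocal of the trace. *)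

Lemma C_eq (x y : C) : Re x = Re y -> Im x = Im y -> x = y.
Proof. destruct x, y; simpl; intros; subst; reflexivity. Qed.

Lemma im_le_Cmod (c : C) : (Rabs (Im c) <= Cmod c)%R.
Proof.
  eapply Rle_trans; [| apply Rmax_Cmod]. apply Rmax_r.
Qed.

Lemma Cmod_le_sum (c : C) : (Cmod c <= Rabs (Re c) + Rabs (Im c))%R.
Proof.
  apply Rsqr_incr_0_var.
  - unfold Rsqr. replace (Cmod c * Cmod c)%R with (Cmod c ^ 2)%R by ring.
    rewrite Cmod2_alt.
    pose proof (Rabs_pos (Re c)). pose proof (Rabs_pos (Im c)).
    rewrite <- (pow2_abs (Re c)), <- (pow2_abs (Im c)). nra.
  - pose proof (Rabs_pos (Re c)). pose proof (Rabs_pos (Im c)). lra.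
Qed.

Lemma Cmod_sym (x y : C) : Cmod (x - y) = Cmod (y - x).
Proof. rewrite <- Cmod_opp. f_equal. ring. Qed.

Lemma Cmod_minus_le (x y : C) : (Cmod (x - y) <= Cmod x + Cmod y)%R.
Proof. unfold Cminus. rewrite <- (Cmod_opp y). apply Cmod_triangle. Qed.

Lemma Cmod_triangle_inv (x y : C) : (Rabs (Cmod x - Cmod y) <= Cmod (x - y))%R.
Proof.
  apply Rabs_le. split.
  - assert (Cmod y <= Cmod x + Cmod (x - y))%R; [| lra].
    replace y with (x - (x - y)) at 1 by ring. apply Cmod_minus_le.
  - assert (Cmod x <= Cmod (x - y) + Cmod y)%R; [| lra].
    replace x with ((x - y) + y) at 1 by ring. apply Cmod_triangle.
Qed.

Lemma RtoC_neq_0 (x : R) : x <> 0%R -> RtoC x <> 0.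
Proof. intros H K. apply H. now apply RtoC_inj. Qed.

Lemma Cminus_eq_0 (x y : C) : x - y = 0 -> x = y.
Proof. intro H. replace x with ((x - y) + y) by ring. rewrite H. ring. Qed.

Lemma Cmult_neq_0_or (x y : C) : x * y = 0 -> x = 0 \/ y = 0.
Proof.
  intro H. destruct (excluded_middle_informative (x = 0)) as [|Hx]; [now left|].
  right. replace y with (/ x * (x * y)) by (field; auto). rewrite H. ring.
Qed.

Lemma ex_series_le_R (a b : nat -> R) :
  (forall n, 0 <= a n <= b n)%R -> ex_series b -> ex_series a.
Proof.
  intros H Hb. apply (ex_series_le (K := R_AbsRing) (V := R_CompleteNormedModule) a b); auto.
  intro n. change (norm (a n)) with (Rabs (a n)). rewrite Rabs_pos_eq; apply H.
Qed.

Lemma ex_series_Rscal (c : R) (a : nat -> R) :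
  ex_series a -> ex_series (fun n => (c * a n)%R).
Proof. exact (ex_series_scal (V := R_NormedModule) c a). Qed.

Lemma Series_nonneg (a : nat -> R) :
  (forall n, 0 <= a n)%R -> ex_series a -> (0 <= Series a)%R.
Proof.
  intros H Ha. replace 0%R with (Series (fun _ => 0%R * 0)%R).
  - apply Series_le; auto. intro n. rewrite Rmult_0_l. split; [lra | auto].
  - rewrite Series_scal_l. ring.
Qed.

Lemma Series_le_signed (a b : nat -> R) :
  (forall n, a n <= b n)%R -> ex_series a -> ex_series b -> (Series a <= Series b)%R.
Proof.
  intros H Ha Hb.
  assert (K : (0 <= Series (fun n => b n - a n))%R).
  { apply Series_nonneg; [intro n; specialize (H n); lra|].
    apply (ex_series_minus (V := R_NormedModule) b a); auto. }
  rewrite Series_minus in K by auto. lra.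
Qed.

Lemma Series_zero (a : nat -> R) : (forall n, a n = 0%R) -> Series a = 0%R.
Proof.
  intro H. rewrite (Series_ext a (fun n => 0 * 0)%R).
  - rewrite Series_scal_l. ring.
  - intro n. rewrite H. ring.
Qed.

Lemma sum_n_le_Series (a : nat -> R) (N : nat) :
  (forall n, 0 <= a n)%R -> ex_series a -> (sum_n a N <= Series a)%R.
Proof.
  intros H Ha.
  apply (is_lim_seq_incr_compare (sum_n a)).
  - apply Series_correct, Ha.
  - intro n. rewrite sum_Sn. change plus with Rplus. specialize (H (S n)). lra.
Qed.

Lemma term_le_sum_n (a : nat -> R) (n : nat) :
  (forall n, 0 <= a n)%R -> (a n <= sum_n a n)%R.
Proof.
  intro H.
  assert (Hs : forall m, (0 <= sum_n a m)%R).
  { induction m; [rewrite sum_O; auto|]. rewrite sum_Sn. change plus with Rplus.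
    specialize (H (S m)). lra. }
  destruct n; [rewrite sum_O; lra|].
  rewrite sum_Sn. change plus with Rplus. specialize (Hs n). lra.
Qed.

Lemma term_le_Series (a : nat -> R) (n : nat) :
  (forall n, 0 <= a n)%R -> ex_series a -> (a n <= Series a)%R.
Proof.
  intros H Ha. eapply Rle_trans; [apply term_le_sum_n, H | now apply sum_n_le_Series].
Qed.

Lemma ex_series_bounded (a : nat -> R) (B : R) :
  (forall n, 0 <= a n)%R -> (forall N, sum_n a N <= B)%R ->
  ex_series a /\ (Series a <= B)%R.
Proof.
  intros H HB.
  assert (Hinc : forall n, (sum_n a n <= sum_n a (S n))%R).
  { intro n. rewrite sum_Sn. change plus with Rplus. specialize (H (S n)). lra. }
  destruct (ex_finite_lim_seq_incr (sum_n a) B Hinc HB) as [l Hl].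
  split; [exists l; exact Hl|].
  rewrite (is_series_unique a l Hl).
  apply (is_lim_seq_le (sum_n a) (fun _ => B) l B); auto. apply is_lim_seq_const.
Qed.

(** Componentwise, so that [inner] unfolds to it by conversion. *)
Definition csum (u : nat -> C) : C :=
  (Series (fun n => Re (u n)), Series (fun n => Im (u n))).

Definition abs_summable (u : nat -> C) : Prop := ex_series (fun n => Cmod (u n)).

Lemma abs_summable_Re (u : nat -> C) :
  abs_summable u -> ex_series (fun n => Re (u n)).
Proof.
  intro H. apply ex_series_Rabs, ex_series_le_R with (2 := H).
  intro n. split; [apply Rabs_pos | apply re_le_Cmod].
Qed.

Lemma abs_summable_Im (u : nat -> C) :
  abs_summable u -> ex_series (fun n => Im (u n)).
Proof.
  intro H. apply ex_series_Rabs, ex_series_le_R with (2 := H).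
  intro n. split; [apply Rabs_pos | apply im_le_Cmod].
Qed.

Lemma abs_summable_le (u : nat -> C) (b : nat -> R) :
  (forall n, Cmod (u n) <= b n)%R -> ex_series b -> abs_summable u.
Proof.
  intros H Hb. apply ex_series_le_R with (2 := Hb).
  intro n. split; [apply Cmod_ge_0 | apply H].
Qed.

Lemma abs_summable_plus (u v : nat -> C) :
  abs_summable u -> abs_summable v -> abs_summable (fun n => u n + v n).
Proof.
  intros Hu Hv.
  apply abs_summable_le with (fun n => (Cmod (u n) + Cmod (v n))%R).
  - intro n. apply Cmod_triangle.
  - apply (ex_series_plus (V := R_NormedModule) _ _ Hu Hv).
Qed.

Lemma abs_summable_scal (c : C) (u : nat -> C) :
  abs_summable u -> abs_summable (fun n => c * u n).
Proof.
  intros Hu. apply abs_summable_le with (fun n => (Cmod c * Cmod (u n))%R).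
  - intro n. rewrite Cmod_mult. lra.
  - apply ex_series_Rscal, Hu.
Qed.

Lemma csum_ext (u v : nat -> C) : (forall n, u n = v n) -> csum u = csum v.
Proof. intro H. unfold csum. f_equal; apply Series_ext; intro n; now rewrite H. Qed.

Lemma csum_plus (u v : nat -> C) :
  abs_summable u -> abs_summable v ->
  csum (fun n => u n + v n) = csum u + csum v.
Proof.
  intros Hu Hv. unfold csum, Cplus; simpl. f_equal.
  - rewrite <- Series_plus by now apply abs_summable_Re. reflexivity.
  - rewrite <- Series_plus by now apply abs_summable_Im. reflexivity.
Qed.

Lemma csum_scal (c : C) (u : nat -> C) :
  abs_summable u -> csum (fun n => c * u n) = c * csum u.
Proof.
  intro Hu.
  pose proof (abs_summable_Re _ Hu). pose proof (abs_summable_Im _ Hu).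
  unfold csum, Cmult; simpl. f_equal.
  - rewrite <- !Series_scal_l, <- Series_minus;
      [reflexivity | |]; now apply ex_series_Rscal.
  - rewrite <- !Series_scal_l, <- Series_plus;
      [reflexivity | |]; now apply ex_series_Rscal.
Qed.

Lemma csum_zero (u : nat -> C) : (forall n, u n = 0) -> csum u = 0.
Proof.
  intro H. unfold csum. apply C_eq; simpl; apply Series_zero; intro n; now rewrite H.
Qed.

Lemma csum_minus (u v : nat -> C) :
  abs_summable u -> abs_summable v ->
  csum (fun n => u n - v n) = csum u - csum v.
Proof.
  intros Hu Hv. rewrite (csum_ext _ (fun n => u n + (- (1)) * v n)).
  - rewrite csum_plus, csum_scal; auto; [ring | now apply abs_summable_scal].
  - intro n. ring.
Qed.

(** With [S] the sum, [|S|^2] is the real part of the series of [conj(S) u_n], each term of which is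
    at most [|S| |u_n|]; then divide by [|S| > 0]. *)
Lemma Cmod_csum_le (u : nat -> C) :
  abs_summable u -> (Cmod (csum u) <= Series (fun n => Cmod (u n)))%R.
Proof.
  intro Hu.
  destruct (Rle_lt_or_eq_dec 0 (Cmod (csum u)) (Cmod_ge_0 _)) as [Hp | <-].
  2: { apply Series_nonneg; auto. intro n. apply Cmod_ge_0. }
  apply Rmult_le_reg_l with (1 := Hp).
  replace (Cmod (csum u) * Cmod (csum u))%R
    with (Re (csum (fun n => Cconj (csum u) * u n))).
  - rewrite <- Series_scal_l.
    change (Re (csum (fun n => Cconj (csum u) * u n)))
      with (Series (fun n => Re (Cconj (csum u) * u n))).
    apply Series_le_signed.
    + intro n. eapply Rle_trans; [apply Rle_abs|].
      eapply Rle_trans; [apply re_le_Cmod|]. rewrite Cmod_mult, Cmod_conj. lra.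
    + apply abs_summable_Re, abs_summable_scal, Hu.
    + apply ex_series_Rscal, Hu.
  - rewrite csum_scal by auto.
    replace (Cconj (csum u) * csum u) with (RtoC (Cmod (csum u) ^ 2)%R).
    + simpl. ring.
    + rewrite Cmod2_conj. ring.
Qed.

(** Takes the terms of index below [N], while [sum_n] includes its bound; hence the shift by one in
    the two lemmas below. *)
Fixpoint cpart (u : nat -> C) (N : nat) : C :=
  match N with O => 0 | S n => cpart u n + u n end.

Lemma cpart_Re (u : nat -> C) (N : nat) :
  Re (cpart u (S N)) = sum_n (fun n => Re (u n)) N.
Proof.
  induction N; [rewrite sum_O; unfold Re; simpl; ring|].
  rewrite sum_Sn, <- IHN. reflexivity.
Qed.

Lemma cpart_Im (u : nat -> C) (N : nat) :
  Im (cpart u (S N)) = sum_n (fun n => Im (u n)) N.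
Proof.
  induction N; [rewrite sum_O; unfold Im; simpl; ring|].
  rewrite sum_Sn, <- IHN. reflexivity.
Qed.

Lemma csum_cpart (u : nat -> C) (N : nat) (l : C) :
  (forall n, (N <= n)%nat -> cpart u n = l) -> csum u = l.
Proof.
  intro H. apply C_eq; simpl; apply is_series_unique;
    apply (is_lim_seq_ext_loc (fun _ => _)) with (2 := is_lim_seq_const _);
    exists N; intros n Hn; rewrite <- (H (S n)) by lia.
  - apply cpart_Re.
  - apply cpart_Im.
Qed.

Lemma csum_single (u : nat -> C) (k : nat) :
  (forall n, n <> k -> u n = 0) -> csum u = u k.
Proof.
  intro H. apply csum_cpart with (S k).
  assert (H0 : forall n, (n <= k)%nat -> cpart u n = 0).
  { induction n; intro Hn; simpl; auto. rewrite IHn, H by lia. ring. }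
  induction n; intro Hn; [lia|]. simpl.
  destruct (Nat.eq_dec n k) as [->|Hk].
  - rewrite H0 by lia. ring.
  - rewrite IHn, (H n) by lia. ring.
Qed.

Lemma abs_summable_finite (u : nat -> C) (N : nat) :
  (forall n, (N <= n)%nat -> u n = 0) -> abs_summable u.
Proof.
  intro H. unfold abs_summable. apply (ex_series_incr_n _ N).
  apply ex_series_le_R with (fun n => (0 * (1/2)^n)%R).
  - intro n. rewrite (H (N + n)%nat) by lia. rewrite Cmod_0. lra.
  - apply ex_series_Rscal, ex_series_geom.
    rewrite Rabs_pos_eq; lra.
Qed.

(** * Limits of complex sequences *)

Definition clim (u : nat -> C) (l : C) : Prop :=
  is_lim_seq (fun n => Cmod (u n - l)) 0%R.

Lemma clim_le (u : nat -> C) (l : C) (e : nat -> R) :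
  (forall n, Cmod (u n - l) <= e n)%R -> is_lim_seq e 0%R -> clim u l.
Proof.
  intros H He. apply is_lim_seq_le_le with (fun _ => 0%R) e; auto.
  - intro n. split; [apply Cmod_ge_0 | apply H].
  - apply is_lim_seq_const.
Qed.

Lemma clim_ext (u v : nat -> C) (l : C) :
  (forall n, u n = v n) -> clim u l -> clim v l.
Proof.
  intros H Hu. apply is_lim_seq_ext with (2 := Hu). intro n. now rewrite H.
Qed.

Lemma clim_const (c : C) : clim (fun _ => c) c.
Proof.
  apply clim_le with (fun _ => 0%R); [| apply is_lim_seq_const].
  intro n. replace (c - c) with (RtoC 0) by ring. rewrite Cmod_0. lra.
Qed.

Lemma clim_plus (u v : nat -> C) (l m : C) :
  clim u l -> clim v m -> clim (fun n => u n + v n) (l + m).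
Proof.
  intros Hu Hv.
  apply clim_le with (fun n => (Cmod (u n - l) + Cmod (v n - m))%R).
  - intro n. replace (u n + v n - (l + m)) with ((u n - l) + (v n - m)) by ring.
    apply Cmod_triangle.
  - replace 0%R with (0 + 0)%R by ring. now apply is_lim_seq_plus'.
Qed.

Lemma clim_Cmod (u : nat -> C) (l : C) :
  clim u l -> is_lim_seq (fun n => Cmod (u n)) (Cmod l).
Proof.
  intro H. apply is_lim_seq_le_le with
    (fun n => (Cmod l - Cmod (u n - l))%R) (fun n => (Cmod l + Cmod (u n - l))%R).
  - intro n. pose proof (Cmod_triangle_inv (u n) l) as K.
    apply Rabs_le_between in K. lra.
  - replace (Finite (Cmod l)) with (Finite (Cmod l - 0)%R) by (f_equal; ring).
    apply is_lim_seq_minus'; auto. apply is_lim_seq_const.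
  - replace (Finite (Cmod l)) with (Finite (Cmod l + 0)%R) by (f_equal; ring).
    apply is_lim_seq_plus'; auto. apply is_lim_seq_const.
Qed.

Lemma clim_mult (u v : nat -> C) (l m : C) :
  clim u l -> clim v m -> clim (fun n => u n * v n) (l * m).
Proof.
  intros Hu Hv.
  apply clim_le with (fun n => (Cmod (u n - l) * Cmod (v n) + Cmod l * Cmod (v n - m))%R).
  - intro n. replace (u n * v n - l * m) with ((u n - l) * v n + l * (v n - m)) by ring.
    eapply Rle_trans; [apply Cmod_triangle|]. rewrite !Cmod_mult. lra.
  - replace (Finite 0%R) with (Finite (0 * Cmod m + Cmod l * 0)%R) by (f_equal; ring).
    apply is_lim_seq_plus'.
    + apply is_lim_seq_mult'; auto. now apply clim_Cmod.
    + apply is_lim_seq_mult'; auto. apply is_lim_seq_const.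
Qed.

Lemma clim_scal (c : C) (u : nat -> C) (l : C) :
  clim u l -> clim (fun n => c * u n) (c * l).
Proof. intro H. apply clim_mult; auto. apply clim_const. Qed.

Lemma clim_opp (u : nat -> C) (l : C) : clim u l -> clim (fun n => - u n) (- l).
Proof.
  intro H. apply is_lim_seq_ext with (2 := H). intro n.
  rewrite <- Cmod_opp. f_equal. ring.
Qed.

Lemma clim_minus (u v : nat -> C) (l m : C) :
  clim u l -> clim v m -> clim (fun n => u n - v n) (l - m).
Proof. intros Hu Hv. apply clim_plus; auto. now apply clim_opp. Qed.

Lemma is_lim_seq_abs_minus (u : nat -> R) (l : R) :
  is_lim_seq u l -> is_lim_seq (fun n => Rabs (u n - l)) 0%R.
Proof.
  intro H. apply (proj1 (is_lim_seq_abs_0 _)).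
  replace (Finite 0%R) with (Finite (l - l)%R) by (f_equal; ring).
  apply is_lim_seq_minus'; auto. apply is_lim_seq_const.
Qed.

Lemma clim_RtoC (u : nat -> R) (l : R) :
  is_lim_seq u l -> clim (fun n => RtoC (u n)) (RtoC l).
Proof.
  intro H. apply clim_le with (fun n => Rabs (u n - l)).
  - intro n. rewrite <- RtoC_minus, Cmod_R. lra.
  - now apply is_lim_seq_abs_minus.
Qed.

Lemma clim_unique (u : nat -> C) (l m : C) : clim u l -> clim u m -> l = m.
Proof.
  intros Hl Hm. apply Cminus_eq_0, Cmod_eq_0.
  assert (K : clim (fun n => u n - u n) (m - l)) by now apply clim_minus.
  assert (K' : is_lim_seq (fun _ => Cmod (l - m)) 0%R).
  { apply is_lim_seq_ext with (2 := K). intro n. f_equal. ring. }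
  apply is_lim_seq_unique in K'. rewrite Lim_seq_const in K'. now injection K'.
Qed.

Lemma clim_incr_n (u : nat -> C) (l : C) (N : nat) :
  clim (fun n => u (n + N)%nat) l <-> clim u l.
Proof.
  unfold clim. symmetry. apply (is_lim_seq_incr_n (fun n => Cmod (u n - l)) N).
Qed.

Lemma clim_Re (u : nat -> C) (l : C) : clim u l -> is_lim_seq (fun n => Re (u n)) (Re l).
Proof.
  intro H. apply is_lim_seq_le_le with
    (fun n => (Re l - Cmod (u n - l))%R) (fun n => (Re l + Cmod (u n - l))%R).
  - intro n. pose proof (re_le_Cmod (u n - l)) as K.
    apply Rabs_le_between in K. destruct (u n), l; simpl in *. lra.
  - replace (Finite (Re l)) with (Finite (Re l - 0)%R) by (f_equal; ring).
    apply is_lim_seq_minus'; auto. apply is_lim_seq_const.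
  - replace (Finite (Re l)) with (Finite (Re l + 0)%R) by (f_equal; ring).
    apply is_lim_seq_plus'; auto. apply is_lim_seq_const.
Qed.

Lemma clim_Im (u : nat -> C) (l : C) : clim u l -> is_lim_seq (fun n => Im (u n)) (Im l).
Proof.
  intro H. apply is_lim_seq_le_le with
    (fun n => (Im l - Cmod (u n - l))%R) (fun n => (Im l + Cmod (u n - l))%R).
  - intro n. pose proof (im_le_Cmod (u n - l)) as K.
    apply Rabs_le_between in K. destruct (u n), l; simpl in *. lra.
  - replace (Finite (Im l)) with (Finite (Im l - 0)%R) by (f_equal; ring).
    apply is_lim_seq_minus'; auto. apply is_lim_seq_const.
  - replace (Finite (Im l)) with (Finite (Im l + 0)%R) by (f_equal; ring).
    apply is_lim_seq_plus'; auto. apply is_lim_seq_const.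
Qed.

Lemma clim_of_Re_Im (u : nat -> C) (x y : R) :
  is_lim_seq (fun n => Re (u n)) x -> is_lim_seq (fun n => Im (u n)) y -> clim u (x, y).
Proof.
  intros Hx Hy.
  apply clim_le with (fun n => (Rabs (Re (u n) - x) + Rabs (Im (u n) - y))%R).
  - intro n. eapply Rle_trans; [apply Cmod_le_sum|].
    destruct (u n); simpl. unfold Rminus. lra.
  - replace (Finite 0%R) with (Finite (0 + 0)%R) by (f_equal; ring).
    apply is_lim_seq_plus'; now apply is_lim_seq_abs_minus.
Qed.

Lemma clim_Clim_seq (u : nat -> C) (l : C) : clim u l -> Clim_seq u = l.
Proof.
  intro H. unfold Clim_seq.
  rewrite (is_lim_seq_unique _ _ (clim_Re _ _ H)), (is_lim_seq_unique _ _ (clim_Im _ _ H)).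
  now destruct l.
Qed.

Lemma clim_csum (u : nat -> C) : abs_summable u -> clim (cpart u) (csum u).
Proof.
  intro H. apply (clim_incr_n (cpart u) (csum u) 1).
  apply clim_of_Re_Im; (eapply is_lim_seq_ext; [| apply Series_correct]).
  - intro n. rewrite Nat.add_1_r. symmetry. apply cpart_Re.
  - now apply abs_summable_Re.
  - intro n. rewrite Nat.add_1_r. symmetry. apply cpart_Im.
  - now apply abs_summable_Im.
Qed.

(** Telescoping. This is how the canonical products and their derivatives are shown to converge. *)
Lemma clim_of_summable_steps (u : nat -> C) :
  abs_summable (fun n => u (S n) - u n) -> exists l, clim u l.
Proof.
  intro H. exists (u 0%nat + csum (fun n => u (S n) - u n)).
  apply clim_ext with (fun n => u 0%nat + cpart (fun n => u (S n) - u n) n).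
  - induction n; simpl; [ring|]. rewrite Cplus_assoc, IHn. ring.
  - apply clim_plus; [apply clim_const | now apply clim_csum].
Qed.

Lemma clim_Cmod_le (u : nat -> C) (l : C) (B : R) :
  clim u l -> (forall n, Cmod (u n) <= B)%R -> (Cmod l <= B)%R.
Proof.
  intros H HB.
  apply (is_lim_seq_le (fun n => Cmod (u n)) (fun _ => B) (Cmod l) B); auto.
  - now apply clim_Cmod.
  - apply is_lim_seq_const.
Qed.

(** * The space l^2 *)

Lemma ell2_le (u : vec) (b : nat -> R) (B : R) :
  (forall n, Cmod (u n) <= B * b n)%R -> ex_series (fun n => (b n ^ 2)%R) -> ell2 u.
Proof.
  intros H Hb. apply ex_series_le_R with (fun n => (B ^ 2 * b n ^ 2)%R).
  - intro n. split; [apply pow2_ge_0|].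
    replace (B ^ 2 * b n ^ 2)%R with ((B * b n) ^ 2)%R by ring.
    apply pow_incr. split; [apply Cmod_ge_0 | apply H].
  - now apply ex_series_Rscal.
Qed.

Lemma ell2_le_ell2 (u v : vec) (B : R) :
  (forall n, Cmod (u n) <= B * Cmod (v n))%R -> ell2 v -> ell2 u.
Proof. intros H Hv. now apply ell2_le with (fun n => Cmod (v n)) B. Qed.

Lemma ell2_finitely_supported (u : vec) : finitely_supported u -> ell2 u.
Proof.
  intros [N HN].
  assert (K : abs_summable (fun n => u n * u n)).
  { apply abs_summable_finite with N. intros n Hn. rewrite HN by auto. ring. }
  unfold ell2. apply ex_series_ext with (2 := K). intro n. rewrite Cmod_mult. simpl. ring.
Qed.

Lemma ell2_basis (k : nat) : ell2 (basis k).
Proof.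
  apply ell2_finitely_supported. exists (S k). intros n Hn. unfold basis.
  destruct (Nat.eqb_spec n k); [lia | auto].
Qed.

Lemma ell2_vadd (u v : vec) : ell2 u -> ell2 v -> ell2 (vadd u v).
Proof.
  intros Hu Hv.
  apply ex_series_le_R with (fun n => (2 * Cmod (u n) ^ 2 + 2 * Cmod (v n) ^ 2)%R).
  - intro n. split; [apply pow2_ge_0|]. unfold vadd.
    apply Rle_trans with ((Cmod (u n) + Cmod (v n)) ^ 2)%R.
    + apply pow_incr. split; [apply Cmod_ge_0 | apply Cmod_triangle].
    + pose proof (pow2_ge_0 (Cmod (u n) - Cmod (v n))). lra.
  - apply (ex_series_plus (V := R_NormedModule)); now apply ex_series_Rscal.
Qed.

Lemma ell2_vscal (c : C) (u : vec) : ell2 u -> ell2 (vscal c u).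
Proof.
  apply ell2_le_ell2 with (Cmod c). intro n. unfold vscal. rewrite Cmod_mult. lra.
Qed.

Lemma vsub_as_vadd (u v : vec) : vsub u v = vadd u (vscal (- (1)) v).
Proof. apply functional_extensionality. intro n. unfold vsub, vadd, vscal. ring. Qed.

Lemma ell2_vsub (u v : vec) : ell2 u -> ell2 v -> ell2 (vsub u v).
Proof. intros. rewrite vsub_as_vadd. apply ell2_vadd; auto. now apply ell2_vscal. Qed.

Lemma ell2_vzero : ell2 vzero.
Proof. apply ell2_finitely_supported. now exists O. Qed.

Definition vconj (u : vec) : vec := fun n => Cconj (u n).

Lemma ell2_vconj (u : vec) : ell2 u -> ell2 (vconj u).
Proof. apply ell2_le_ell2 with 1%R. intro n. unfold vconj. rewrite Cmod_conj. lra. Qed.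

Lemma abs_summable_mult (u v : vec) :
  ell2 u -> ell2 v -> abs_summable (fun n => u n * v n).
Proof.
  intros Hu Hv.
  apply abs_summable_le with (fun n => (Cmod (u n) ^ 2 + Cmod (v n) ^ 2)%R).
  - intro n. rewrite Cmod_mult.
    pose proof (Cmod_ge_0 (u n)). pose proof (Cmod_ge_0 (v n)). nra.
  - now apply (ex_series_plus (V := R_NormedModule)).
Qed.

Lemma Series_norm_nonneg (u : vec) : ell2 u -> (0 <= Series (fun n => (Cmod (u n) ^ 2)%R))%R.
Proof. intro H. apply Series_nonneg; auto. intro n. apply pow2_ge_0. Qed.

Lemma norm2_sq (u : vec) : ell2 u -> (norm2 u ^ 2)%R = Series (fun n => (Cmod (u n) ^ 2)%R).
Proof. intro H. unfold norm2. rewrite <- Rsqr_pow2, Rsqr_sqrt; auto. now apply Series_norm_nonneg. Qed.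

Lemma norm2_ge_0 (u : vec) : (0 <= norm2 u)%R.
Proof. apply sqrt_pos. Qed.

Lemma Cmod_le_norm2 (u : vec) (n : nat) : ell2 u -> (Cmod (u n) <= norm2 u)%R.
Proof.
  intro H. apply Rsqr_incr_0_var; [| apply norm2_ge_0].
  rewrite !Rsqr_pow2, norm2_sq by auto.
  apply (term_le_Series (fun n => (Cmod (u n) ^ 2)%R)); auto. intro. apply pow2_ge_0.
Qed.

Lemma norm2_eq_0 (u : vec) : ell2 u -> norm2 u = 0%R -> u = vzero.
Proof.
  intros H H0. apply functional_extensionality. intro n.
  apply Cmod_eq_0, Rle_antisym; [| apply Cmod_ge_0].
  rewrite <- H0. now apply Cmod_le_norm2.
Qed.

(** The minimum of the quadratic is at [X / A]. For [A = 0] the function is affine, and a nonzero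
    slope would make it equal to -1 at the chosen point. *)
Lemma quadratic_discriminant (A X B : R) :
  (0 <= A)%R -> (forall t, 0 <= A * t ^ 2 - 2 * X * t + B)%R -> (X ^ 2 <= A * B)%R.
Proof.
  intros HA H. destruct (Req_dec A 0) as [->|HA0].
  - destruct (Req_dec X 0) as [->|HX]; [lra|].
    specialize (H ((B + 1) / (2 * X))%R).
    replace (0 * ((B + 1) / (2 * X)) ^ 2 - 2 * X * ((B + 1) / (2 * X)) + B)%R
      with (-1)%R in H by (field; auto). lra.
  - specialize (H (X / A)%R).
    replace (A * (X / A) ^ 2 - 2 * X * (X / A) + B)%R with ((A * B - X ^ 2) / A)%R in H
      by (field; auto).
    assert (0 <= A * ((A * B - X ^ 2) / A))%R by (apply Rmult_le_pos; lra).
    replace (A * ((A * B - X ^ 2) / A))%R with (A * B - X ^ 2)%R in H0 by (field; auto).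
    lra.
Qed.

(** No conjugation, so that Green's formula for a real matrix pairs two solutions at the same
    complex [z]. *)
Definition bil (u v : vec) : C := csum (fun n => u n * v n).

Lemma inner_bil (u v : vec) : inner u v = bil (vconj u) v.
Proof. reflexivity. Qed.

Lemma Cmod_bil_le (u v : vec) :
  ell2 u -> ell2 v -> (Cmod (bil u v) <= norm2 u * norm2 v)%R.
Proof.
  intros Hu Hv.
  pose proof (abs_summable_mult u v Hu Hv) as Huv.
  eapply Rle_trans; [apply Cmod_csum_le, Huv|].
  apply Rsqr_incr_0_var; [| apply Rmult_le_pos; apply norm2_ge_0].
  rewrite !Rsqr_pow2.
  replace ((norm2 u * norm2 v) ^ 2)%R with (norm2 u ^ 2 * norm2 v ^ 2)%R by ring.
  rewrite !norm2_sq by auto.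
  apply quadratic_discriminant; [now apply Series_norm_nonneg|].
  intro t.
  assert (E : ex_series (fun n => (t ^ 2 * Cmod (u n) ^ 2)%R)) by now apply ex_series_Rscal.
  assert (E' : ex_series (fun n => (2 * t * Cmod (u n * v n))%R)) by now apply ex_series_Rscal.
  replace (Series (fun n => Cmod (u n) ^ 2) * t ^ 2 -
     2 * Series (fun n => Cmod (u n * v n)) * t + Series (fun n => Cmod (v n) ^ 2))%R
    with (Series (fun n => (t ^ 2 * Cmod (u n) ^ 2 - 2 * t * Cmod (u n * v n)
       + Cmod (v n) ^ 2)%R)).
  - apply Series_nonneg.
    + intro n. rewrite Cmod_mult.
      replace (t ^ 2 * Cmod (u n) ^ 2 - 2 * t * (Cmod (u n) * Cmod (v n)) + Cmod (v n) ^ 2)%R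
        with ((t * Cmod (u n) - Cmod (v n)) ^ 2)%R by ring. apply pow2_ge_0.
    + apply (ex_series_plus (V := R_NormedModule)); auto.
      now apply (ex_series_minus (V := R_NormedModule)).
  - rewrite Series_plus, Series_minus, !Series_scal_l; auto.
    + ring.
    + now apply (ex_series_minus (V := R_NormedModule)).
Qed.

Lemma bil_sym (u v : vec) : bil u v = bil v u.
Proof. apply csum_ext. intro n. ring. Qed.

Lemma bil_vadd_r (u v w : vec) : ell2 u -> ell2 v -> ell2 w ->
  bil u (vadd v w) = bil u v + bil u w.
Proof.
  intros. unfold bil. rewrite <- csum_plus by now apply abs_summable_mult.
  apply csum_ext. intro n. unfold vadd. ring.
Qed.

Lemma bil_vscal_r (c : C) (u v : vec) : ell2 u -> ell2 v -> bil u (vscal c v) = c * bil u v.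
Proof.
  intros. unfold bil. rewrite <- csum_scal by now apply abs_summable_mult.
  apply csum_ext. intro n. unfold vscal. ring.
Qed.

Lemma bil_vsub_r (u v w : vec) : ell2 u -> ell2 v -> ell2 w ->
  bil u (vsub v w) = bil u v - bil u w.
Proof.
  intros. rewrite vsub_as_vadd, bil_vadd_r, bil_vscal_r; auto.
  - ring.
  - now apply ell2_vscal.
Qed.

Lemma bil_basis_l (k : nat) (u : vec) : bil (basis k) u = u k.
Proof.
  unfold bil. rewrite (csum_single _ k); unfold basis.
  - rewrite Nat.eqb_refl. ring.
  - intros n Hn. apply Nat.eqb_neq in Hn. rewrite Hn. ring.
Qed.

Lemma vconj_basis (k : nat) : vconj (basis k) = basis k.
Proof.
  apply functional_extensionality. intro n. unfold vconj, basis.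
  destruct (Nat.eqb n k); apply C_eq; simpl; lra.
Qed.

Lemma inner_basis_l (k : nat) (u : vec) : inner (basis k) u = u k.
Proof. rewrite inner_bil, vconj_basis. apply bil_basis_l. Qed.

Lemma inner_basis_r (k : nat) (u : vec) : inner u (basis k) = Cconj (u k).
Proof. rewrite inner_bil, bil_sym, bil_basis_l. reflexivity. Qed.

Lemma inner_conj (u v : vec) : ell2 u -> ell2 v -> inner u v = Cconj (inner v u).
Proof.
  intros Hu Hv. rewrite !inner_bil. unfold bil, vconj. apply C_eq.
  - rewrite re_conj. simpl. apply Series_ext. intro n. simpl. ring.
  - rewrite im_conj. simpl. rewrite <- Series_opp. apply Series_ext. intro n. simpl. ring.
Qed.

Lemma inner_self (u : vec) : ell2 u -> inner u u = RtoC (norm2 u ^ 2)%R.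
Proof.
  intro Hu. rewrite norm2_sq by auto. rewrite inner_bil. unfold bil, vconj.
  rewrite (csum_ext _ (fun n => RtoC (Cmod (u n) ^ 2)%R)).
  - apply C_eq; [reflexivity | now apply Series_zero].
  - intro n. rewrite Cmod2_conj. ring.
Qed.

Lemma bil_vconj_eq_0 (u : vec) : ell2 u -> bil u (vconj u) = 0 -> u = vzero.
Proof.
  intros Hu H. apply norm2_eq_0; auto.
  rewrite bil_sym, <- inner_bil, inner_self in H by auto.
  apply RtoC_inj in H. pose proof (norm2_ge_0 u). nra.
Qed.

Lemma l2_converges_coord (us : nat -> vec) (u : vec) (n : nat) :
  (forall j, ell2 (us j)) -> ell2 u -> l2_converges us u -> clim (fun j => us j n) (u n).
Proof.
  intros Hus Hu H. apply clim_le with (2 := H). intro j.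
  apply (Cmod_le_norm2 (vsub (us j) u)). now apply ell2_vsub.
Qed.

Lemma l2_converges_bil (f u : vec) (us : nat -> vec) :
  ell2 f -> (forall j, ell2 (us j)) -> ell2 u -> l2_converges us u ->
  clim (fun j => bil f (us j)) (bil f u).
Proof.
  intros Hf Hus Hu H. apply clim_le with (fun j => (norm2 f * norm2 (vsub (us j) u))%R).
  - intro j. rewrite <- bil_vsub_r by auto. apply Cmod_bil_le; auto. now apply ell2_vsub.
  - replace (Finite 0%R) with (Finite (norm2 f * 0)%R) by (f_equal; ring).
    apply is_lim_seq_mult'; auto. apply is_lim_seq_const.
Qed.

Lemma norm2_le (u v : vec) (B : R) : ell2 v -> (0 <= B)%R ->
  (forall n, Cmod (u n) <= B * Cmod (v n))%R -> (norm2 u <= B * norm2 v)%R.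
Proof.
  intros Hv HB H. apply Rsqr_incr_0_var.
  2: { apply Rmult_le_pos; auto. apply norm2_ge_0. }
  assert (Hu : ell2 u) by now apply ell2_le_ell2 with (2 := Hv) (B := B).
  rewrite !Rsqr_pow2, Rpow_mult_distr, !norm2_sq by auto.
  rewrite <- Series_scal_l. apply Series_le.
  - intro n. split; [apply pow2_ge_0|]. rewrite <- Rpow_mult_distr. apply pow_incr.
    split; [apply Cmod_ge_0 | apply H].
  - now apply ex_series_Rscal.
Qed.

(** * Comparison of a positive operator with its absolute value *)

Local Open Scope R_scope.

(** A real inner product is enough to compare quadratic forms, and a bounded operator with real
    quadratic form is symmetric for it. *)
Definition rin (u v : vec) : R := Re (inner u v).

Lemma rin_sym (u v : vec) : ell2 u -> ell2 v -> rin u v = rin v u.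
Proof. intros. unfold rin. now rewrite inner_conj, re_conj. Qed.

Lemma rin_add_r (u v w : vec) : ell2 u -> ell2 v -> ell2 w ->
  rin u (vadd v w) = rin u v + rin u w.
Proof.
  intros. unfold rin. rewrite !inner_bil, bil_vadd_r; auto using ell2_vconj.
Qed.

Lemma rin_scal_r (t : R) (u v : vec) : ell2 u -> ell2 v ->
  rin u (vscal (RtoC t) v) = t * rin u v.
Proof.
  intros. unfold rin. rewrite !inner_bil, bil_vscal_r by auto using ell2_vconj.
  simpl. unfold Re. ring.
Qed.

Lemma rin_add_l (u v w : vec) : ell2 u -> ell2 v -> ell2 w ->
  rin (vadd v w) u = rin v u + rin w u.
Proof.
  intros. rewrite rin_sym, rin_add_r, (rin_sym u v), (rin_sym u w); auto using ell2_vadd.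
Qed.

Lemma rin_scal_l (t : R) (u v : vec) : ell2 u -> ell2 v ->
  rin (vscal (RtoC t) v) u = t * rin v u.
Proof.
  intros. rewrite rin_sym, rin_scal_r, (rin_sym u v); auto using ell2_vscal.
Qed.

Lemma rin_self (u : vec) : ell2 u -> rin u u = norm2 u ^ 2.
Proof. intros. unfold rin. now rewrite inner_self. Qed.

Lemma bounded_operator_rin (T : vec -> vec) :
  bounded_operator T -> exists K, 0 <= K /\ forall u, ell2 u -> rin (T u) (T u) <= K * rin u u.
Proof.
  intros (H1 & _ & _ & M & HM). exists (M ^ 2). split; [apply pow2_ge_0|].
  intros u Hu. rewrite !rin_self by auto.
  rewrite <- Rpow_mult_distr. apply pow_incr. split; [apply norm2_ge_0 | auto].
Qed.

Definition rsymmetric (L : vec -> vec) : Prop :=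
  forall u v, ell2 u -> ell2 v -> rin u (L v) = rin (L u) v.

(* Polarization at [u + i v]. *)
Lemma rsymmetric_of_real (L : vec -> vec) :
  bounded_operator L -> (forall u, ell2 u -> Im (inner u (L u)) = 0) -> rsymmetric L.
Proof.
  intros (H1 & H2 & H3 & _) H u v Hu Hv.
  pose proof (H (vadd u (vscal Ci v))) as K.
  rewrite H2, H3 in K by auto using ell2_vscal.
  rewrite (rin_sym (L u)) by auto. unfold rin.
  assert (E : inner (vadd u (vscal Ci v)) (vadd (L u) (vscal Ci (L v))) =
    (inner u (L u) + Ci * inner u (L v) - Ci * inner v (L u) + inner v (L v))%C).
  { rewrite !inner_bil, !bil_vadd_r, !bil_vscal_r
      by auto using ell2_vconj, ell2_vadd, ell2_vscal.
    assert (Ec : forall w, ell2 w -> bil (vconj (vadd u (vscal Ci v))) w =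
      (bil (vconj u) w - Ci * bil (vconj v) w)%C).
    { intros w Hw. rewrite !(bil_sym _ w).
      rewrite <- bil_vscal_r, <- bil_vsub_r by auto using ell2_vconj, ell2_vscal.
      f_equal. apply functional_extensionality. intro n.
      unfold vconj, vadd, vscal, vsub. rewrite Cplus_conj, Cmult_conj.
      replace (Cconj Ci) with (- Ci)%C by (apply C_eq; simpl; ring). ring. }
    rewrite !Ec by auto.
    replace (Ci * (bil (vconj u) (L v) - Ci * bil (vconj v) (L v)))%C
      with (Ci * bil (vconj u) (L v) + bil (vconj v) (L v))%C; [ring|].
    apply C_eq; simpl; ring. }
  rewrite E in K.
  assert (Hu0 := H u Hu). assert (Hv0 := H v Hv).
  destruct (inner u (L u)), (inner u (L v)), (inner v (L u)), (inner v (L v)).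
  simpl in *. specialize (K (ell2_vadd _ _ Hu (ell2_vscal _ _ Hv))). lra.
Qed.

(** Nonnegativity of the form at [t u - v] for all real [t]. Applied below with [L = A - m], it
    turns a small value of the quadratic form into a small vector. *)
Lemma rin_cauchy_schwarz (L : vec -> vec) (u v : vec) :
  bounded_operator L -> rsymmetric L -> (forall w, ell2 w -> 0 <= rin w (L w)) ->
  ell2 u -> ell2 v -> rin u (L v) ^ 2 <= rin u (L u) * rin v (L v).
Proof.
  intros (H1 & H2 & H3 & _) Hs Hp Hu Hv.
  apply quadratic_discriminant; auto.
  intro t. specialize (Hp (vadd (vscal (RtoC t) u) (vscal (RtoC (-1)) v))).
  rewrite H2, !H3, !rin_add_l, !rin_add_r, !rin_scal_l, !rin_scal_r in Hp
    by auto using ell2_vadd, ell2_vscal.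
  rewrite (Hs v u), (rin_sym (L v) u) in Hp by auto.
  specialize (Hp (ell2_vadd _ _ (ell2_vscal _ _ Hu) (ell2_vscal _ _ Hv))).
  apply Rle_trans with (1 := Hp). right. ring.
Qed.

Lemma rin_cauchy_schwarz_id (u v : vec) :
  ell2 u -> ell2 v -> rin u v ^ 2 <= rin u u * rin v v.
Proof.
  intros Hu Hv. apply (rin_cauchy_schwarz (fun w => w)); auto.
  - repeat split; auto. exists 1. intros. lra.
  - intros ? ? _ _. reflexivity.
  - intros w Hw. rewrite rin_self by auto. apply pow2_ge_0.
Qed.

Definition oplus (S T : vec -> vec) : vec -> vec := fun u => vadd (S u) (T u).
Definition oscal (t : R) (S : vec -> vec) : vec -> vec := fun u => vscal (RtoC t) (S u).

Lemma norm2_vscal (c : C) (u : vec) : ell2 u -> norm2 (vscal c u) <= Cmod c * norm2 u.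
Proof.
  intro Hu. apply norm2_le; auto; [apply Cmod_ge_0|].
  intro n. unfold vscal. rewrite Cmod_mult. lra.
Qed.

Lemma norm2_vadd (u v : vec) : ell2 u -> ell2 v -> norm2 (vadd u v) <= norm2 u + norm2 v.
Proof.
  intros Hu Hv.
  pose proof (norm2_ge_0 u). pose proof (norm2_ge_0 v).
  apply Rsqr_incr_0_var; [| lra].
  rewrite !Rsqr_pow2, <- rin_self, rin_add_l, !rin_add_r, (rin_sym v u), !rin_self
    by auto using ell2_vadd.
  assert (rin u v <= norm2 u * norm2 v).
  { unfold rin. eapply Rle_trans; [apply Rle_abs|].
    eapply Rle_trans; [apply re_le_Cmod|].
    rewrite inner_bil. eapply Rle_trans; [apply Cmod_bil_le; auto using ell2_vconj|].
    apply Rmult_le_compat_r; [apply norm2_ge_0|].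
    rewrite <- (Rmult_1_l (norm2 u)). apply norm2_le; auto; [lra|].
    intro n. unfold vconj. rewrite Cmod_conj. lra. }
  nra.
Qed.

Lemma bounded_oplus (S T : vec -> vec) :
  bounded_operator S -> bounded_operator T -> bounded_operator (oplus S T).
Proof.
  intros (S1 & S2 & S3 & MS & S4) (T1 & T2 & T3 & MT & T4).
  unfold oplus. repeat split.
  - intros. auto using ell2_vadd.
  - intros. rewrite S2, T2 by auto. apply functional_extensionality. intro n.
    unfold vadd. ring.
  - intros. rewrite S3, T3 by auto. apply functional_extensionality. intro n.
    unfold vadd, vscal. ring.
  - exists (MS + MT). intros u Hu. eapply Rle_trans; [apply norm2_vadd; auto|].
    specialize (S4 u Hu). specialize (T4 u Hu). lra.
Qed.

Lemma bounded_oscal (t : R) (S : vec -> vec) :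
  bounded_operator S -> bounded_operator (oscal t S).
Proof.
  intros (S1 & S2 & S3 & MS & S4).
  unfold oscal. repeat split.
  - intros. auto using ell2_vscal.
  - intros. rewrite S2 by auto. apply functional_extensionality. intro n.
    unfold vadd, vscal. ring.
  - intros. rewrite S3 by auto. apply functional_extensionality. intro n.
    unfold vscal. ring.
  - exists (Rabs t * MS). intros u Hu. eapply Rle_trans; [apply norm2_vscal; auto|].
    rewrite Cmod_R. specialize (S4 u Hu). pose proof (Rabs_pos t). nra.
Qed.

Lemma bounded_id : bounded_operator (fun u => u).
Proof. repeat split; auto. exists 1. intros. lra. Qed.

Lemma rsymmetric_oplus (S T : vec -> vec) :
  bounded_operator S -> bounded_operator T ->
  rsymmetric S -> rsymmetric T -> rsymmetric (oplus S T).
Proof.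
  intros (S1 & _) (T1 & _) HS HT u v Hu Hv. unfold oplus.
  rewrite rin_add_r, rin_add_l, HS, HT; auto.
Qed.

Lemma rsymmetric_oscal (t : R) (S : vec -> vec) :
  bounded_operator S -> rsymmetric S -> rsymmetric (oscal t S).
Proof.
  intros (S1 & _) HS u v Hu Hv. unfold oscal. rewrite rin_scal_r, rin_scal_l, HS; auto.
Qed.

(* If the bottom [m] of the quadratic form of [A = S - T] were negative, then for an approximate
   minimizer [x] the vector [A x - m x] would be small, whereas
   [0 = |S x|^2 - |T x|^2 = <(S + T) x, A x>] is close to [m <x, (S + T) x>] and
   [<x, (S + T) x> >= - <x, A x>], which is close to [- m |x|^2]. *)
Lemma positive_le_of_sq_le (S T : vec -> vec) :
  bounded_operator S -> bounded_operator T -> rsymmetric S -> rsymmetric T ->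
  (forall u, ell2 u -> 0 <= rin u (S u)) -> (forall u, ell2 u -> 0 <= rin u (T u)) ->
  (forall u, ell2 u -> rin (S u) (S u) = rin (T u) (T u)) ->
  forall u, ell2 u -> rin u (T u) <= rin u (S u).
Proof.
  intros bS bT sS sT pS pT HST x0 Hx0.
  set (A := oplus S (oscal (-1) T)).
  assert (bA : bounded_operator A) by (apply bounded_oplus; auto using bounded_oscal).
  assert (sA : rsymmetric A) by (apply rsymmetric_oplus; auto using rsymmetric_oscal, bounded_oscal).
  assert (S1 : forall u, ell2 u -> ell2 (S u)) by apply bS.
  assert (T1 : forall u, ell2 u -> ell2 (T u)) by apply bT.
  assert (A1 : forall u, ell2 u -> ell2 (A u)) by apply bA.
  assert (HA : forall u v, ell2 u -> ell2 v -> rin u (A v) = rin u (S v) - rin u (T v)).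
  { intros u v Hu Hv. unfold A, oplus, oscal.
    rewrite rin_add_r, rin_scal_r; auto using ell2_vscal. ring. }
  apply Rnot_lt_le. intro Hneg.
  assert (Hsq : forall u, ell2 u -> 0 <= rin u u).
  { intros u Hu. rewrite rin_self by auto. apply pow2_ge_0. }
  set (E := fun c => forall u, ell2 u -> c * rin u u <= rin u (A u)).
  destruct (bounded_operator_rin T bT) as (KT & HKT & KTb).
  destruct (completeness E) as [m [Hub Hlub]].
  - exists 0. intros c Hc. specialize (Hc x0 Hx0). rewrite HA in Hc by auto.
    specialize (Hsq x0 Hx0). nra.
  (* The form of [S] is nonnegative, and [KT] bounds [|T u|^2 / |u|^2], so [<u, T u> <= sqrt KT
     |u|^2 <= (KT + 1) |u|^2]. *)
  - exists (- (KT + 1)). intros u Hu. rewrite HA by auto.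
    assert (rin u (T u) <= (KT + 1) * rin u u).
    { pose proof (rin_cauchy_schwarz_id u (T u) Hu (T1 u Hu)).
      specialize (KTb u Hu). specialize (Hsq u Hu).
      apply Rsqr_incr_0_var; [|nra]. unfold Rsqr. nra. }
    specialize (pS u Hu). lra.
  - assert (mE : E m).
    { intros u Hu. destruct (Hsq u Hu) as [Hp | Hz].
      - apply Rmult_le_reg_r with (/ rin u u); [now apply Rinv_0_lt_compat|].
        rewrite Rmult_assoc, Rinv_r, Rmult_1_r by lra.
        apply Hlub. intros c Hc. apply Rmult_le_reg_r with (rin u u); auto.
        rewrite Rmult_assoc, Rinv_l, Rmult_1_r by lra. now apply Hc.
      - rewrite <- Hz, Rmult_0_r.
        rewrite rin_self in Hz by auto.
        assert (u = vzero) by (apply norm2_eq_0; auto; pose proof (norm2_ge_0 u); nra).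
        subst u. replace (rin vzero (A vzero)) with 0; [lra|].
        unfold rin. rewrite inner_bil. unfold bil. rewrite csum_zero; [reflexivity|].
        intro n. unfold vconj, vzero. apply C_eq; simpl; ring. }
    assert (Hm : m < 0).
    { specialize (mE x0 Hx0). rewrite HA in mE by auto. specialize (Hsq x0 Hx0). nra. }
    set (B := oplus A (oscal (- m) (fun u => u))).
    assert (bB : bounded_operator B) by (apply bounded_oplus; auto using bounded_oscal, bounded_id).
    assert (B1 : forall u, ell2 u -> ell2 (B u)) by apply bB.
    assert (sB : rsymmetric B).
    { apply rsymmetric_oplus; auto using bounded_oscal, bounded_id.
      apply rsymmetric_oscal; [apply bounded_id|]. intros ? ? _ _. reflexivity. }
    assert (HB : forall u v, ell2 u -> ell2 v -> rin u (B v) = rin u (A v) - m * rin u v).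
    { intros u v Hu Hv. unfold B, oplus, oscal.
      rewrite rin_add_r, rin_scal_r; auto using ell2_vscal. ring. }
    assert (pB : forall u, ell2 u -> 0 <= rin u (B u)).
    { intros u Hu. rewrite HB by auto. specialize (mE u Hu). lra. }
    destruct (bounded_operator_rin B bB) as (KB & HKB & KBb).
    destruct (bounded_operator_rin (oplus S T)) as (K & HK & Kb);
      [now apply bounded_oplus|].
    assert (Key : forall e, 0 < e -> e <= - m / 2 -> m ^ 4 / 4 <= K * (KB + 1) * e).
    { intros e He Hem.
      assert (Hx : exists x, ell2 x /\ rin x (A x) < (m + e) * rin x x).
      { apply NNPP. intro Hn.
        assert (Em : E (m + e)).
        { intros u Hu. apply Rnot_lt_le. intro. apply Hn. now exists u. }
        specialize (Hub _ Em). lra. }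
      destruct Hx as (x & Hx & HxA).
      set (N := rin x x) in *.
      assert (HN : 0 < N).
      { destruct (Hsq x Hx) as [|Hz]; auto. fold N in Hz. specialize (mE x Hx).
        fold N in mE. rewrite <- Hz in *. lra. }
      assert (HBx : rin x (B x) <= e * N) by (rewrite HB by auto; fold N; lra).
      set (y := B x) in *.
      assert (Hy : ell2 y) by (apply B1; auto).
      (* Cauchy-Schwarz for the form of [B] at [y = B x] and [x]: [|y|^4 <= <y, B y> <x, B x>], and
         the last factor is at most [e N]. *)
      assert (HyB : rin y y <= (KB + 1) * (e * N)).
      { assert (K1 : rin y y ^ 2 <= rin y (B y) * rin x (B x)).
        { apply (rin_cauchy_schwarz B y x); auto. }
        fold y in K1.
        assert (K2 : rin y (B y) <= (KB + 1) * rin y y).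
        { pose proof (rin_cauchy_schwarz_id y (B y) Hy (B1 y Hy)).
          specialize (KBb y Hy). pose proof (Hsq y Hy).
          apply Rsqr_incr_0_var; [|nra]. unfold Rsqr. nra. }
        pose proof (Hsq y Hy) as K3. pose proof (pB x Hx) as K4. fold y in K4.
        destruct K3 as [K3|K3]; [|rewrite <- K3; apply Rmult_le_pos; nra].
        apply Rmult_le_reg_l with (1 := K3).
        assert (rin y (B y) * rin x y <= (KB + 1) * rin y y * (e * N)).
        { apply Rmult_le_compat; auto. }
        nra. }
      set (s := oplus S T x) in *.
      assert (Hs : ell2 s) by (apply ell2_vadd; auto).
      assert (Hs0 : rin s (A x) = 0).
      { rewrite HA by auto. unfold s, oplus. rewrite !rin_add_l by auto.
        rewrite (rin_sym (S x) (T x)), (HST x) by auto. ring. }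
      assert (Hsx : - (m + e) * N <= rin s x).
      { rewrite rin_sym by auto. unfold s, oplus. rewrite rin_add_r by auto.
        rewrite HA in HxA by auto. specialize (pS x Hx). specialize (pT x Hx). lra. }
      assert (Hsy : rin s y = - m * rin s x).
      { unfold y. rewrite HB by auto. lra. }
      pose proof (rin_cauchy_schwarz_id s y Hs Hy) as CS.
      assert (Hss : rin s s <= K * N) by (apply Kb; auto).
      assert (L0 : - m / 2 * N <= rin s x).
      { eapply Rle_trans; [| apply Hsx]. apply Rmult_le_compat_r; lra. }
      assert (L1 : m ^ 2 / 2 * N <= rin s y).
      { rewrite Hsy. replace (m ^ 2 / 2 * N) with (- m * (- m / 2 * N)) by field.
        apply Rmult_le_compat_l; lra. }
      assert (L2 : (m ^ 2 / 2 * N) ^ 2 <= (K * N) * ((KB + 1) * (e * N))).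
      { apply Rle_trans with (rin s y ^ 2).
        - apply pow_incr. split; auto. apply Rmult_le_pos; [|lra].
          pose proof (pow2_ge_0 m). lra.
        - eapply Rle_trans; [apply CS|]. apply Rmult_le_compat; auto. }
      apply Rmult_le_reg_r with (N ^ 2); [now apply pow_lt|].
      replace (m ^ 4 / 4 * N ^ 2) with ((m ^ 2 / 2 * N) ^ 2) by field.
      eapply Rle_trans; [apply L2|]. right. ring. }
    set (P := K * (KB + 1)) in *.
    assert (HP : 0 <= P) by (apply Rmult_le_pos; lra).
    assert (Hm4 : 0 < m ^ 4).
    { replace (m ^ 4) with ((m ^ 2) ^ 2) by ring. apply pow_lt. nra. }
    (* The second bound gives [(P + 1) e <= m^4 / 8], against [m^4 / 4 <= P e]. *)
    set (e := Rmin (- m / 2) (m ^ 4 / (8 * (P + 1)))).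
    assert (He : 0 < e).
    { unfold e. apply Rmin_pos; [lra|]. apply Rdiv_lt_0_compat; lra. }
    specialize (Key e He (Rmin_l _ _)).
    assert (He2 : e <= m ^ 4 / (8 * (P + 1))) by apply Rmin_r.
    assert ((P + 1) * e <= m ^ 4 / 8).
    { replace (m ^ 4 / 8) with ((P + 1) * (m ^ 4 / (8 * (P + 1)))) by (field; lra).
      apply Rmult_le_compat_l; lra. }
    lra.
Qed.

Local Open Scope C_scope.

(** * The maximal domain of a Jacobi operator *)

Lemma jacobi_action_finitely_supported (a b : nat -> R) (u : vec) :
  finitely_supported u -> finitely_supported (jacobi_action a b u).
Proof.
  intros [N HN]. exists (S N). intros [|n] Hn; [lia|].
  simpl. rewrite !HN by lia. ring.
Qed.

Lemma jacobi_action_clim (a b : nat -> R) (us : nat -> vec) (u : vec) :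
  (forall n, clim (fun j => us j n) (u n)) ->
  forall n, clim (fun j => jacobi_action a b (us j) n) (jacobi_action a b u n).
Proof.
  intros H [|n]; simpl; repeat apply clim_plus; apply clim_scal, H.
Qed.

(** Convergence in l^2 implies convergence of each coordinate, and a row of the matrix involves at
    most three of them. *)
Lemma jacobi_operator_action (a b : nat -> R) (u v : vec) :
  jacobi_operator a b u v -> v = jacobi_action a b u.
Proof.
  intros (Hu & Hv & us & Hf & Hlu & Hlv). apply functional_extensionality. intro n.
  apply clim_unique with (fun j => jacobi_action a b (us j) n).
  - apply (l2_converges_coord (fun j => jacobi_action a b (us j)) v n); auto.
    intro j. apply ell2_finitely_supported, jacobi_action_finitely_supported, Hf.
  - apply jacobi_action_clim. intro k. apply l2_converges_coord; auto.
    intro j. apply ell2_finitely_supported, Hf.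
Qed.

(** Discrete Lagrange identity: the sum telescopes to a boundary term, the Wronskian at [N]. *)
Lemma jacobi_green (a b : nat -> R) (f w : vec) (N : nat) :
  cpart (fun n => f n * jacobi_action a b w n - jacobi_action a b f n * w n) (S N) =
  RtoC (a N) * (f N * w (S N) - f (S N) * w N).
Proof.
  induction N.
  - simpl. ring.
  - change (cpart ?u (S (S N))) with (cpart u (S N) + u (S N)).
    cbv beta. rewrite IHN. simpl. ring.
Qed.

(** For finitely supported approximants of [u] the boundary term of Green's formula vanishes, and
    both sides pass to the limit. Here [f] ranges over the maximal domain. *)
Lemma jacobi_operator_symmetric (a b : nat -> R) (f u v : vec) :
  ell2 f -> ell2 (jacobi_action a b f) -> jacobi_operator a b u v ->
  bil f v = bil (jacobi_action a b f) u.
Proof.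
  intros Hf Hjf (Hu & Hv & us & Hfs & Hlu & Hlv).
  assert (Hus : forall j, ell2 (us j)) by (intro; now apply ell2_finitely_supported).
  assert (Hjs : forall j, ell2 (jacobi_action a b (us j))).
  { intro. now apply ell2_finitely_supported, jacobi_action_finitely_supported. }
  apply clim_unique with (fun j => bil f (jacobi_action a b (us j))).
  { apply (l2_converges_bil f v (fun j => jacobi_action a b (us j))); auto. }
  apply clim_ext with (fun j => bil (jacobi_action a b f) (us j)).
  2: apply l2_converges_bil; auto.
  intro j. symmetry. apply Cminus_eq_0. unfold bil.
  rewrite <- csum_minus by now apply abs_summable_mult.
  destruct (Hfs j) as [N HN].
  apply csum_cpart with (S N). intros [|n] Hn; [lia|].
  rewrite jacobi_green, !HN by lia. ring.
Qed.

(** The closure has the largest possible domain, in other words it is self-adjoint: the limit point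
    case. *)
Definition maximal (a b : nat -> R) : Prop :=
  forall u, ell2 u -> ell2 (jacobi_action a b u) ->
    jacobi_operator a b u (jacobi_action a b u).

Lemma jacobi_action_vsub (a b : nat -> R) (u v : vec) :
  jacobi_action a b (vsub u v) = vsub (jacobi_action a b u) (jacobi_action a b v).
Proof.
  apply functional_extensionality. intros [|n]; unfold vsub; simpl; ring.
Qed.

Lemma vsub_eq_vzero (u v : vec) : vsub u v = vzero -> u = v.
Proof.
  intro H. apply functional_extensionality. intro n. apply Cminus_eq_0.
  change (vsub u v n = vzero n). now rewrite H.
Qed.

Lemma vsub_diag (u : vec) : vsub u u = vzero.
Proof. apply functional_extensionality. intro n. unfold vsub, vzero. ring. Qed.

Lemma bil_vzero_l (u : vec) : bil vzero u = 0.
Proof. apply csum_zero. intro n. unfold vzero. ring. Qed.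

(** Let [v] be the image of [u] under the matrix. The matrix annihilates [u - T v], which is
    therefore orthogonal to the range of [J]; that range is all of l^2, so [u = T v]. *)
Lemma maximal_of_inverse (a b : nat -> R) (T : vec -> vec) :
  inverse_of (jacobi_operator a b) T -> maximal a b.
Proof.
  intros [bT HT] u Hu Hju.
  assert (T1 : forall v, ell2 v -> ell2 (T v)) by apply bT.
  set (v := jacobi_action a b u) in *.
  assert (JT : jacobi_operator a b (T v) v) by now apply HT.
  replace u with (T v); auto.
  symmetry. apply vsub_eq_vzero. apply bil_vconj_eq_0; [now auto using ell2_vsub|].
  assert (E : jacobi_action a b (vsub u (T v)) = vzero).
  { rewrite jacobi_action_vsub, <- (jacobi_operator_action _ _ _ _ JT). apply vsub_diag. }
  set (w := vconj (vsub u (T v))).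
  assert (Hw : ell2 w) by (apply ell2_vconj; auto using ell2_vsub).
  rewrite (jacobi_operator_symmetric a b _ (T w) w); auto using ell2_vsub.
  - rewrite E. apply bil_vzero_l.
  - rewrite E. apply ell2_vzero.
  - now apply HT.
Qed.

(** * Solutions of the three-term recurrence *)

(* [det (J_n - z)] for the upper left [n]-by-[n] block [J_n] *)
Fixpoint jacobi_det (a b : nat -> R) (z : C) (n : nat) : C :=
  match n with
  | O => 1
  | S m => (RtoC (b m) - z) * jacobi_det a b z m
           - match m with O => 0 | S l => RtoC (a l ^ 2) * jacobi_det a b z l end
  end.

Fixpoint jacobi_rdet (a b : nat -> R) (x : R) (n : nat) : R :=
  match n with
  | O => 1
  | S m => (b m - x) * jacobi_rdet a b x m
           - match m with O => 0 | S l => a l ^ 2 * jacobi_rdet a b x l end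
  end%R.

Fixpoint aprod (a : nat -> R) (n : nat) : R :=
  match n with O => 1 | S m => aprod a m * a m end%R.

Lemma two_step_ind (P : nat -> Prop) :
  P O -> P 1%nat -> (forall n, P n -> P (S n) -> P (S (S n))) -> forall n, P n.
Proof.
  intros H0 H1 H n. assert (P n /\ P (S n)) as [K _]; auto.
  induction n; intuition.
Qed.

Lemma jacobi_det_R (a b : nat -> R) (x : R) (n : nat) :
  jacobi_det a b (RtoC x) n = RtoC (jacobi_rdet a b x n).
Proof.
  induction n as [| |n IH1 IH2] using two_step_ind.
  - reflexivity.
  - simpl. rewrite !RtoC_minus, RtoC_mult, RtoC_minus. reflexivity.
  - change (jacobi_det a b (RtoC x) (S (S n))) with
      ((RtoC (b (S n)) - RtoC x) * jacobi_det a b (RtoC x) (S n)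
       - RtoC (a n ^ 2) * jacobi_det a b (RtoC x) n).
    rewrite IH1, IH2.
    change (jacobi_rdet a b x (S (S n))) with
      ((b (S n) - x) * jacobi_rdet a b x (S n) - a n ^ 2 * jacobi_rdet a b x n)%R.
    rewrite RtoC_minus, !RtoC_mult, RtoC_minus. reflexivity.
Qed.

Lemma aprod_pos (a : nat -> R) (n : nat) : (forall n, 0 < a n)%R -> (0 < aprod a n)%R.
Proof. intro H. induction n; simpl; [lra | now apply Rmult_lt_0_compat]. Qed.

Definition sgn (n : nat) : R := ((-1) ^ n)%R.

Lemma sgn_S (n : nat) : sgn (S n) = (- sgn n)%R.
Proof. unfold sgn. simpl. ring. Qed.

Lemma sgn_sq (n : nat) : (sgn n * sgn n = 1)%R.
Proof. induction n; [unfold sgn; simpl; ring | rewrite sgn_S; lra]. Qed.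

Lemma Rabs_sgn (n : nat) : Rabs (sgn n) = 1%R.
Proof. apply pow_1_abs. Qed.

(** These are [det (z - J_n) / (a_0 ... a_(n-1))], the orthonormal polynomials of the first kind. *)
Definition first_kind (a b : nat -> R) (z : C) : vec :=
  fun n => RtoC (sgn n / aprod a n) * jacobi_det a b z n.

Lemma jacobi_action_first_kind (a b : nat -> R) (z : C) : (forall n, 0 < a n)%R ->
  jacobi_action a b (first_kind a b z) = vscal z (first_kind a b z).
Proof.
  intro Ha. apply functional_extensionality.
  assert (Hne : forall n, RtoC (a n) <> 0).
  { intro n. apply RtoC_neq_0. specialize (Ha n). lra. }
  assert (Hpe : forall n, RtoC (aprod a n) <> 0).
  { intro n. apply RtoC_neq_0. pose proof (aprod_pos a n Ha). lra. }
  assert (Hd : forall n, aprod a n <> 0%R).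
  { intro n. pose proof (aprod_pos a n Ha). lra. }
  intros [|n]; unfold vscal, first_kind.
  - change (jacobi_action a b ?u 0%nat) with
      (RtoC (b 0%nat) * u 0%nat + RtoC (a 0%nat) * u 1%nat).
    cbv beta. rewrite !RtoC_div by apply Hd. rewrite sgn_S.
    change (sgn 0) with 1%R. simpl jacobi_det. simpl aprod.
    rewrite RtoC_opp, RtoC_mult. field. apply Hne.
  - change (jacobi_action a b ?u (S n)) with
      (RtoC (a n) * u n + RtoC (b (S n)) * u (S n) + RtoC (a (S n)) * u (S (S n))).
    cbv beta. rewrite !RtoC_div by apply Hd. rewrite !sgn_S.
    change (jacobi_det a b z (S (S n))) with
      ((RtoC (b (S n)) - z) * jacobi_det a b z (S n)
       - RtoC (a n ^ 2) * jacobi_det a b z n).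
    simpl aprod. rewrite !RtoC_opp, !RtoC_mult, RtoC_pow. field. auto.
Qed.

Lemma first_kind_0 (a b : nat -> R) (z : C) : first_kind a b z 0%nat = 1.
Proof. unfold first_kind, sgn. simpl. apply C_eq; simpl; field. Qed.

Ltac split_leb :=
  repeat match goal with
    |- context [Nat.leb ?x ?y] => destruct (Nat.leb_spec x y); try lia end.

(** The Green kernel before division by the Wronskian: the solution regular at index 0 on one side
    of the diagonal, the decaying one on the other. *)
Definition green_kernel (p psi : vec) (k : nat) : vec :=
  fun n => if Nat.leb n k then p n * psi k else p k * psi n.

(** In Green's formula for [p] and [psi] only the source term accumulates, and the source [W e_0]
    sits at index 0, where [p] is 1. *)
Lemma wronskian_const (a b : nat -> R) (z W : C) (p psi : vec) :
  (forall n, jacobi_action a b p n = z * p n) -> p 0%nat = 1 ->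
  (forall n, jacobi_action a b psi n = z * psi n + W * basis 0 n) ->
  forall n, RtoC (a n) * (p n * psi (S n) - p (S n) * psi n) = W.
Proof.
  intros Hp Hp0 Hpsi n.
  rewrite <- jacobi_green with (b := b). induction n.
  - change (cpart ?u 1) with (0 + u 0%nat). cbv beta. rewrite Hp, Hpsi, Hp0. unfold basis. simpl. ring.
  - change (cpart ?u (S (S n))) with (cpart u (S n) + u (S n)). cbv beta.
    rewrite IHn, Hp, Hpsi. unfold basis. simpl. ring.
Qed.

(** Off row [k] the column is locally a multiple of [p] or of [psi], so it solves the homogeneous
    equation; in row [k] the change of branch contributes the Wronskian. *)
Lemma jacobi_action_green_kernel (a b : nat -> R) (z W : C) (p psi : vec) (k : nat) :
  (forall n, jacobi_action a b p n = z * p n) -> p 0%nat = 1 ->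
  (forall n, jacobi_action a b psi n = z * psi n + W * basis 0 n) ->
  forall n, jacobi_action a b (green_kernel p psi k) n =
    z * green_kernel p psi k n + W * basis k n.
Proof.
  intros Hp Hp0 Hpsi n.
  pose proof (wronskian_const a b z W p psi Hp Hp0 Hpsi) as HW.
  destruct (lt_eq_lt_dec n k) as [[Hn|Hn]|Hn].
  - replace (basis k n) with (RtoC 0).
    2: { unfold basis. destruct (Nat.eqb_spec n k); [lia | auto]. }
    assert (E : jacobi_action a b (green_kernel p psi k) n = psi k * jacobi_action a b p n).
    { destruct n; simpl jacobi_action; unfold green_kernel;
      split_leb; ring. }
    rewrite E, Hp. unfold green_kernel. destruct (Nat.leb_spec n k); [ring | lia].
  - subst n. replace (basis k k) with (RtoC 1).
    2: { unfold basis. now rewrite Nat.eqb_refl. }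
    assert (E : jacobi_action a b (green_kernel p psi k) k =
      psi k * jacobi_action a b p k + RtoC (a k) * (p k * psi (S k) - p (S k) * psi k)).
    { destruct k; simpl jacobi_action; unfold green_kernel;
      split_leb; ring. }
    rewrite E, Hp, HW. unfold green_kernel. rewrite Nat.leb_refl. ring.
  - replace (basis k n) with (RtoC 0).
    2: { unfold basis. destruct (Nat.eqb_spec n k); [lia | auto]. }
    assert (E : jacobi_action a b (green_kernel p psi k) n = p k * jacobi_action a b psi n).
    { destruct n; [lia|]. simpl jacobi_action; unfold green_kernel.
      destruct (Nat.leb_spec n k).
      - replace k with n by lia.
        split_leb; ring.
      - split_leb; ring. }
    rewrite E, Hpsi. unfold green_kernel, basis.
    destruct (Nat.leb_spec n k); [lia|]. destruct (Nat.eqb_spec n 0); [lia|]. ring.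
Qed.

(* Diagonal of the inverse: [<e_n, J^{-1} e_n>], when [h_n = (-1)^n <e_n, J^{-1} e_0>] *)
Definition green_diag (a b h : nat -> R) (n : nat) : R :=
  (jacobi_rdet a b 0 n / aprod a n * h n)%R.

(** The decaying solution over the first kind solution at [z = 0], both with signs removed. It
    decreases with [n], and the limit 0 says that [h] is the subordinate solution. *)
Definition green_ratio (a b h : nat -> R) (n : nat) : R :=
  (aprod a n * h n / jacobi_rdet a b 0 n)%R.

(* [h] is the decaying solution at [z = 0] with alternating signs removed; the last clause but
   one excludes the limit circle case. *)
Record green_data (a b h : nat -> R) : Prop := {
  gd_a : forall n, (0 < a n)%R;
  gd_h : forall n, (0 < h n)%R;
  gd_h_0 : (b 0%nat * h 0%nat = 1 + a 0%nat * h 1%nat)%R;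
  gd_h_S : forall n, (b (S n) * h (S n) = a n * h n + a (S n) * h (S (S n)))%R;
  gd_trace : ex_series (green_diag a b h);
  gd_ratio : is_lim_seq (green_ratio a b h) 0%R;
  gd_maximal : maximal a b }.

Definition alternating (h : nat -> R) : vec := fun n => RtoC (sgn n * h n).

(** Constancy of the Wronskian at [z = 0], with signs and denominators cleared. *)
Lemma rdet_wronskian (a b h : nat -> R) :
  (b 0%nat * h 0%nat = 1 + a 0%nat * h 1%nat)%R ->
  (forall n, (b (S n) * h (S n) = a n * h n + a (S n) * h (S (S n)))%R) ->
  forall n, (jacobi_rdet a b 0 (S n) * (aprod a n * h n)
    - jacobi_rdet a b 0 n * (aprod a (S n) * h (S n)) = aprod a n ^ 2)%R.
Proof.
  intros H0 HS. induction n.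
  - simpl. lra.
  - change (jacobi_rdet a b 0 (S (S n))) with
      ((b (S n) - 0) * jacobi_rdet a b 0 (S n) - a n ^ 2 * jacobi_rdet a b 0 n)%R.
    change (aprod a (S (S n))) with (aprod a (S n) * a (S n))%R.
    replace (aprod a (S n) ^ 2)%R with (a n ^ 2 * aprod a n ^ 2)%R by (simpl; ring).
    rewrite <- IHn.
    replace (aprod a (S n)) with (aprod a n * a n)%R by reflexivity.
    replace (((b (S n) - 0) * jacobi_rdet a b 0 (S n) - a n ^ 2 * jacobi_rdet a b 0 n)
      * (aprod a n * a n * h (S n)) -
      jacobi_rdet a b 0 (S n) * (aprod a n * a n * a (S n) * h (S (S n))))%R with
     (aprod a n * a n * jacobi_rdet a b 0 (S n) * (b (S n) * h (S n) - a (S n) * h (S (S n)))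
       - a n ^ 2 * jacobi_rdet a b 0 n * (aprod a n * a n * h (S n)))%R by ring.
    rewrite HS. ring.
Qed.

(** In the Wronskian identity the coefficients of both determinants and the right-hand side are
    positive, so positivity passes from one determinant to the next. *)
Lemma rdet_pos (a b h : nat -> R) : (forall n, 0 < a n)%R -> (forall n, 0 < h n)%R ->
  (b 0%nat * h 0%nat = 1 + a 0%nat * h 1%nat)%R ->
  (forall n, (b (S n) * h (S n) = a n * h n + a (S n) * h (S (S n)))%R) ->
  forall n, (0 < jacobi_rdet a b 0 n)%R.
Proof.
  intros Ha Hh H0 HS. induction n; [simpl; lra|].
  pose proof (rdet_wronskian a b h H0 HS n) as K.
  pose proof (aprod_pos a n Ha). pose proof (aprod_pos a (S n) Ha).
  assert (0 < aprod a n * h n)%R by now apply Rmult_lt_0_compat.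
  assert (0 < jacobi_rdet a b 0 n * (aprod a (S n) * h (S n)))%R
    by (repeat apply Rmult_lt_0_compat; auto).
  apply Rmult_lt_reg_r with (aprod a n * h n)%R; auto.
  rewrite Rmult_0_l. pose proof (pow2_ge_0 (aprod a n)). lra.
Qed.

Lemma inner_single (u v : vec) (k : nat) :
  (forall n, n <> k -> u n = 0 \/ v n = 0) -> inner u v = Cconj (u k) * v k.
Proof.
  intro H. rewrite inner_bil. unfold bil, vconj.
  apply (csum_single (fun n => Cconj (u n) * v n) k).
  intros n Hn. destruct (H n Hn) as [E|E]; rewrite E; apply C_eq; simpl; ring.
Qed.

(* Positivity of [J] on the truncation of [J^{-1} e_0] to indices [> n] forces consecutive
   entries to have opposite signs. *)
Lemma inverse_column_alternates (a b : nat -> R) (g : vec) :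
  (forall n, 0 < a n)%R -> positive_definite (jacobi_operator a b) -> maximal a b ->
  jacobi_operator a b g (basis 0) ->
  exists h, (forall n, 0 < h n)%R /\ g = alternating h.
Proof.
  intros Ha Hpos Hmax Hg.
  assert (Hjg : jacobi_action a b g = basis 0) by (symmetry; now apply jacobi_operator_action).
  assert (Hg2 : ell2 g) by apply Hg.
  assert (Hn0 : (forall n, Im (g n) = 0 /\ 0 < sgn n * Re (g n))%R).
  { induction n.
    - destruct (Hpos g (basis 0) Hg) as [K1 K2].
      + intro E. assert (K : basis 0 0%nat = 0).
        { rewrite <- Hjg, E. simpl. unfold vzero. ring. }
        unfold basis in K. simpl in K. apply RtoC_inj in K. lra.
      + rewrite inner_basis_r in K1, K2. rewrite im_conj in K1. rewrite re_conj in K2.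
        unfold sgn. simpl. split; lra.
    - destruct IHn as [I1 I2].
      set (t := (fun k => if Nat.leb k n then 0 else g k) : vec).
      assert (Ht2 : ell2 t).
      { apply ell2_le_ell2 with g 1%R; auto. intro k. unfold t.
        destruct (Nat.leb k n); rewrite ?Cmod_0; pose proof (Cmod_ge_0 (g k)); lra. }
      assert (Hjt : forall k, k <> n -> k <> S n -> jacobi_action a b t k = 0).
      { intros k Hk1 Hk2. destruct (Nat.lt_ge_cases k n) as [Hk|Hk].
        - destruct k; simpl jacobi_action; unfold t; split_leb; ring.
        - transitivity (jacobi_action a b g k).
          + destruct k; [lia|]. simpl jacobi_action; unfold t; split_leb; ring.
          + rewrite Hjg. unfold basis. destruct (Nat.eqb_spec k 0); [lia | auto]. }
      assert (HjS : jacobi_action a b t (S n) = - (RtoC (a n) * g n)).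
      { apply Cminus_eq_0. transitivity (jacobi_action a b g (S n)).
        - simpl jacobi_action; unfold t; split_leb; ring.
        - rewrite Hjg. reflexivity. }
      assert (Hjt2 : ell2 (jacobi_action a b t)).
      { apply ell2_finitely_supported. exists (S (S n)). intros k Hk. apply Hjt; lia. }
      assert (Ht0 : t <> vzero).
      { intro E. rewrite E in HjS.
        replace (jacobi_action a b vzero (S n)) with (RtoC 0) in HjS
          by (simpl; unfold vzero; ring).
        apply (f_equal Re) in HjS. simpl in HjS. unfold Re in I2.
        specialize (Ha n). assert (a n * fst (g n) = 0)%R by lra.
        apply Rmult_integral in H. destruct H as [H|H]; [lra|]. rewrite H in I2. lra. }
      destruct (Hpos t _ (Hmax t Ht2 Hjt2) Ht0) as [K1 K2].
      (* [t] vanishes up to [n] and [J t] vanishes outside [{n, n+1}], so [<t, J t>] is the single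
         term [- a_n g_n] times the conjugate of [g_(n+1)]. *)
      rewrite (inner_single _ _ (S n)), HjS in K1, K2.
      2, 3: intros k Hk; destruct (Nat.eq_dec k n) as [->|Hkn];
        [left; unfold t; now rewrite Nat.leb_refl | right; now apply Hjt].
      replace (t (S n)) with (g (S n)) in K1, K2 by (unfold t; split_leb; reflexivity).
      specialize (Ha n).
      destruct (g n) as [x y], (g (S n)) as [x' y']. simpl in *. subst y.
      rewrite sgn_S.
      assert (Hx : x <> 0%R) by (intro; subst; lra).
      assert (E1 : (y' * (a n * x) = 0)%R) by lra.
      split.
      + apply Rmult_integral in E1. destruct E1 as [E1|E1]; auto.
        apply Rmult_integral in E1. destruct E1; lra.
      + assert (E2 : (a n * x * x' < 0)%R) by lra.
        assert (E3 : (x * x' < 0)%R).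
        { apply Rmult_lt_reg_l with (a n); auto. rewrite Rmult_0_r. lra. }
        assert (E4 : (0 < sgn n * x * (- sgn n * x'))%R).
        { replace (sgn n * x * (- sgn n * x'))%R with (sgn n * sgn n * - (x * x'))%R by ring.
          rewrite sgn_sq. lra. }
        apply Rmult_lt_reg_l with (sgn n * x)%R; auto. rewrite Rmult_0_r. exact E4. }
  exists (fun n => sgn n * Re (g n))%R. split.
  - intro n. apply Hn0.
  - apply functional_extensionality. intro n. unfold alternating.
    rewrite <- Rmult_assoc, sgn_sq, Rmult_1_l. apply C_eq; [reflexivity | apply Hn0].
Qed.

Lemma alternating_recurrence (a b h : nat -> R) :
  jacobi_action a b (alternating h) = basis 0 ->
  (b 0%nat * h 0%nat = 1 + a 0%nat * h 1%nat)%R /\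
  (forall n, (b (S n) * h (S n) = a n * h n + a (S n) * h (S (S n)))%R).
Proof.
  intro H. split.
  - apply (f_equal (fun u => Re (u 0%nat))) in H. unfold alternating, basis in H. simpl in H.
    rewrite sgn_S in H. unfold sgn in H. simpl in H. lra.
  - intro n. apply (f_equal (fun u => Re (u (S n)))) in H.
    unfold alternating, basis in H. simpl in H. rewrite !sgn_S in H.
    assert (E : (sgn n * (a n * h n + a (S n) * h (S (S n)) - b (S n) * h (S n)) = 0)%R) by lra.
    apply Rmult_integral in E. destruct E as [E|E]; [| lra].
    pose proof (sgn_sq n) as K. rewrite E in K. lra.
Qed.

(** The Wronskian identity divided by the product of two consecutive determinants. *)
Lemma green_ratio_decr (a b h : nat -> R) : (forall n, 0 < a n)%R -> (forall n, 0 < h n)%R ->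
  (b 0%nat * h 0%nat = 1 + a 0%nat * h 1%nat)%R ->
  (forall n, (b (S n) * h (S n) = a n * h n + a (S n) * h (S (S n)))%R) ->
  forall n, (green_ratio a b h n - green_ratio a b h (S n) =
     aprod a n ^ 2 / (jacobi_rdet a b 0 n * jacobi_rdet a b 0 (S n)))%R.
Proof.
  intros Ha Hh H0 HS n. unfold green_ratio.
  rewrite <- (rdet_wronskian a b h H0 HS n).
  pose proof (rdet_pos a b h Ha Hh H0 HS n). pose proof (rdet_pos a b h Ha Hh H0 HS (S n)).
  field. lra.
Qed.

Lemma green_ratio_pos (a b h : nat -> R) : (forall n, 0 < a n)%R -> (forall n, 0 < h n)%R ->
  (b 0%nat * h 0%nat = 1 + a 0%nat * h 1%nat)%R ->
  (forall n, (b (S n) * h (S n) = a n * h n + a (S n) * h (S (S n)))%R) ->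
  forall n, (0 < green_ratio a b h n)%R.
Proof.
  intros Ha Hh H0 HS n. unfold green_ratio.
  apply Rdiv_lt_0_compat; [apply Rmult_lt_0_compat; auto; now apply aprod_pos|].
  now apply (rdet_pos a b h).
Qed.

Lemma trace_class_diag (T : vec -> vec) :
  (forall u, ell2 u -> Im (inner u (T u)) = 0%R /\ (0 <= Re (inner u (T u)))%R) ->
  trace_class T -> ex_series (fun n => Re (inner (basis n) (T (basis n)))).
Proof.
  intros HT (bT & S & (bS & HS & HST) & Htr).
  assert (S1 : forall u, ell2 u -> ell2 (S u)) by apply bS.
  assert (sS : rsymmetric S).
  { apply rsymmetric_of_real; auto. intros. now apply HS. }
  apply ex_series_le_R with (2 := Htr). intro n. split; [apply HT, ell2_basis|].
  apply (positive_le_of_sq_le S T); auto using ell2_basis.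
  - apply rsymmetric_of_real; auto. intros. now apply HT.
  - intros. now apply HS.
  - intros. now apply HT.
  (* Symmetry of [S] gives [<S u, S u> = <u, S (S u)>], which is [<T u, T u>] by definition of the
     absolute value. *)
  - intros u Hu. rewrite <- sS by auto. unfold rin. now rewrite HST.
Qed.

Lemma green_data_of_trace_class (a b : nat -> R) :
  (forall n, 0 < a n)%R -> positive_definite (jacobi_operator a b) ->
  inverse_is_trace_class (jacobi_operator a b) -> exists h, green_data a b h.
Proof.
  intros Ha Hpos (T & HT & Htr).
  pose proof (maximal_of_inverse a b T HT) as Hmax.
  destruct HT as [bT HT].
  assert (T1 : forall u, ell2 u -> ell2 (T u)) by apply bT.
  assert (JT : forall v, ell2 v -> jacobi_operator a b (T v) v).
  { intros v Hv. now apply HT. }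
  destruct (inverse_column_alternates a b (T (basis 0)) Ha Hpos Hmax) as (h & Hh & Eh).
  { apply JT, ell2_basis. }
  assert (Hjh : jacobi_action a b (alternating h) = basis 0).
  { rewrite <- Eh. symmetry. apply jacobi_operator_action, JT, ell2_basis. }
  assert (Hh2 : ell2 (alternating h)) by (rewrite <- Eh; apply T1, ell2_basis).
  destruct (alternating_recurrence a b h Hjh) as [H0 HS].
  exists h.
  pose proof (rdet_pos a b h Ha Hh H0 HS) as Hd.
  pose proof (fun n => aprod_pos a n Ha) as HA.
  set (p := first_kind a b 0).
  assert (Hp : forall n, p n = RtoC (sgn n * (jacobi_rdet a b 0 n / aprod a n))%R).
  { intro n. unfold p, first_kind. rewrite (jacobi_det_R a b 0), <- RtoC_mult. f_equal.
    field. specialize (HA n). lra. }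
  assert (Hjp : forall n, jacobi_action a b p n = 0 * p n).
  { intro n. unfold p at 1. rewrite jacobi_action_first_kind by auto. reflexivity. }
  constructor; auto.
  (* The kernel column solves the equation with source [e_k]. It is in l^2 because it differs from a
     multiple of [alternating h] in finitely many entries; uniqueness of the inverse then identifies
     it. *)
  - assert (Ek : forall k, T (basis k) = green_kernel p (alternating h) k).
    { intro k. set (K := green_kernel p (alternating h) k).
      assert (HjK : jacobi_action a b K = basis k).
      { apply functional_extensionality. intro n. unfold K.
        rewrite (jacobi_action_green_kernel a b 0 1); auto.
        - ring.
        - apply first_kind_0.
        - intro m. rewrite Hjh. ring. }
      assert (HK2 : ell2 K).
      { replace K with (vadd (vscal (p k) (alternating h)) (vsub K (vscal (p k) (alternating h)))).
        - apply ell2_vadd; [now apply ell2_vscal|].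
          apply ell2_finitely_supported. exists (S k). intros n Hn.
          unfold vsub, vscal, K, green_kernel. split_leb. ring.
        - apply functional_extensionality. intro n. unfold vadd, vsub. ring. }
      symmetry. apply HT; [apply ell2_basis|]. rewrite <- HjK.
      apply Hmax; auto. rewrite HjK. apply ell2_basis. }
    apply ex_series_ext with (fun n => Re (inner (basis n) (T (basis n)))).
    + intro n. rewrite inner_basis_l, Ek. unfold green_kernel. rewrite Nat.leb_refl, Hp.
      unfold alternating. rewrite <- RtoC_mult. simpl. unfold green_diag.
      replace (sgn n * (jacobi_rdet a b 0 n / aprod a n) * (sgn n * h n))%R with
        (sgn n * sgn n * (jacobi_rdet a b 0 n / aprod a n * h n))%R by ring.
      rewrite sgn_sq. ring.
    + apply trace_class_diag; auto. intros u Hu.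
      destruct (classic (T u = vzero)) as [E|E].
      * rewrite E. replace (inner u vzero) with (RtoC 0); [simpl; lra|].
        rewrite inner_bil, bil_sym, bil_vzero_l. reflexivity.
      * destruct (Hpos (T u) u (JT u Hu) E) as [K1 K2].
        rewrite inner_conj in K1, K2 by auto. rewrite im_conj in K1. rewrite re_conj in K2.
        lra.
  - pose proof (green_ratio_decr a b h Ha Hh H0 HS) as Hdec.
    pose proof (green_ratio_pos a b h Ha Hh H0 HS) as Hgp.
    assert (Hdecr : forall n, (green_ratio a b h (S n) <= green_ratio a b h n)%R).
    { intro n. specialize (Hdec n).
      assert (0 <= aprod a n ^ 2 / (jacobi_rdet a b 0 n * jacobi_rdet a b 0 (S n)))%R; [|lra].
      apply Rdiv_le_0_compat; [apply pow2_ge_0 | now apply Rmult_lt_0_compat]. }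
    destruct (ex_finite_lim_seq_decr (green_ratio a b h) 0%R Hdecr) as [L HL].
    { intro n. left. apply Hgp. }
    replace (Finite 0%R) with (Finite L); auto. f_equal.
    (* If [L > 0] then [|p_n| <= h_n / L], so [p] would be a nonzero l^2 vector with [J p = 0],
       which positivity excludes. *)
    destruct (Req_dec L 0) as [|HL0]; auto. exfalso.
    assert (HLle : forall n, (L <= green_ratio a b h n)%R).
    { intro n. now apply (is_lim_seq_decr_compare (green_ratio a b h)). }
    assert (HLp : (0 < L)%R).
    { assert (0 <= L)%R; [|lra].
      apply (is_lim_seq_le (fun _ => 0%R) (green_ratio a b h) 0%R L); auto.
      - intro n. left. apply Hgp.
      - apply is_lim_seq_const. }
    assert (Hp2 : ell2 p).
    { apply ell2_le_ell2 with (alternating h) (/ L)%R; auto. intro n.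
      rewrite Hp. unfold alternating. rewrite !Cmod_R, !Rabs_mult, Rabs_sgn, !Rmult_1_l.
      specialize (Hd n). specialize (HA n). specialize (Hh n). specialize (HLle n).
      unfold green_ratio in HLle.
      rewrite !Rabs_pos_eq; [| lra | left; now apply Rdiv_lt_0_compat].
      apply Rmult_le_reg_l with L; auto. rewrite <- Rmult_assoc, Rinv_r, Rmult_1_l by lra.
      apply Rmult_le_reg_r with (aprod a n / jacobi_rdet a b 0 n)%R;
        [now apply Rdiv_lt_0_compat|].
      replace (L * (jacobi_rdet a b 0 n / aprod a n) * (aprod a n / jacobi_rdet a b 0 n))%R
        with L by (field; lra).
      eapply Rle_trans; [apply HLle|]. right. field. lra. }
    assert (Ejp : jacobi_action a b p = vzero).
    { apply functional_extensionality. intro n. rewrite Hjp. unfold vzero. ring. }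
    destruct (Hpos p vzero) as [_ K].
    + rewrite <- Ejp. apply Hmax; auto. rewrite Ejp. apply ell2_vzero.
    + intro E. pose proof (first_kind_0 a b 0) as E0. fold p in E0. rewrite E in E0.
      unfold vzero in E0. apply RtoC_inj in E0. lra.
    + rewrite inner_bil, bil_sym, bil_vzero_l in K. simpl in K. lra.
Qed.

(** * Removing the first row and column *)

Definition shift {T : Type} (u : nat -> T) : nat -> T := fun n => u (S n).

(** Once row and column 0 are removed, the term [a_0 g_0] in row 1 of [J g = e_0] becomes the
    source; dividing by [a_0 h_0] normalizes it to 1. *)
Definition shift_h (a h : nat -> R) : nat -> R := fun n => (h (S n) / (a 0%nat * h 0%nat))%R.

Lemma norm2_shift (u : vec) : ell2 u -> ell2 (shift u : vec) /\ (norm2 (shift u) <= norm2 u)%R.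
Proof.
  intro H. assert (Hs : ell2 (shift u : vec)).
  { apply (proj1 (ex_series_incr_1 (fun n => (Cmod (u n) ^ 2)%R))). exact H. }
  split; auto. unfold norm2. apply sqrt_le_1_alt.
  rewrite (Series_incr_1 (fun n => (Cmod (u n) ^ 2)%R)) by auto.
  unfold shift. pose proof (pow2_ge_0 (Cmod (u 0%nat))). lra.
Qed.

Lemma jacobi_action_shift (a b : nat -> R) (w : vec) :
  jacobi_action (shift a) (shift b) (shift w) =
  vsub (shift (jacobi_action a b w)) (vscal (RtoC (a 0%nat) * w 0%nat) (basis 0)).
Proof.
  apply functional_extensionality. intros [|n]; unfold vsub, vscal, shift, basis; simpl; ring.
Qed.

(** Extend [u] by 0 at index 0 and shift the approximants obtained for [J]. Removing column 0
    changes their images by [a_0 us_j(0) e_0], which tends to 0 because the extension vanishes at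
    index 0. *)
Lemma maximal_shift (a b : nat -> R) : maximal a b -> maximal (shift a) (shift b).
Proof.
  intros Hmax u Hu Hju.
  set (e := (fun n => match n with O => RtoC 0 | S m => u m end) : vec).
  assert (Hshe : shift e = u) by reflexivity.
  assert (He : ell2 e).
  { apply (proj2 (ex_series_incr_1 (fun n => (Cmod (e n) ^ 2)%R))). exact Hu. }
  assert (Hsje : shift (jacobi_action a b e) = jacobi_action (shift a) (shift b) u).
  { rewrite <- Hshe, jacobi_action_shift. apply functional_extensionality. intro n.
    unfold vsub, vscal. simpl (e 0%nat). ring. }
  assert (Hje : ell2 (jacobi_action a b e)).
  { apply (proj2 (ex_series_incr_1 (fun n => (Cmod (jacobi_action a b e n) ^ 2)%R))).
    rewrite <- Hsje in Hju. exact Hju. }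
  destruct (Hmax e He Hje) as (_ & _ & us & Hfs & Hl & Hlj).
  assert (Hus : forall j, ell2 (us j)) by (intro; now apply ell2_finitely_supported).
  assert (Hjs : forall j, ell2 (jacobi_action a b (us j))).
  { intro. now apply ell2_finitely_supported, jacobi_action_finitely_supported. }
  split; [exact Hu|]. split; [exact Hju|].
  exists (fun j => shift (us j)). split; [|split].
  - intro j. destruct (Hfs j) as [N HN]. exists N. intros n Hn. apply HN. lia.
  - apply is_lim_seq_le_le with (fun _ => 0%R) (fun j => norm2 (vsub (us j) e)); auto.
    + intro j. split; [apply norm2_ge_0|].
      apply (norm2_shift (vsub (us j) e)). now apply ell2_vsub.
    + apply is_lim_seq_const.
  - apply is_lim_seq_le_le with (fun _ => 0%R)
      (fun j => norm2 (vsub (jacobi_action a b (us j)) (jacobi_action a b e))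
        + Cmod (- (RtoC (a 0%nat) * us j 0%nat)) * norm2 (basis 0))%R.
    + intro j. split; [apply norm2_ge_0|].
      assert (Hd : ell2 (vsub (jacobi_action a b (us j)) (jacobi_action a b e)))
        by now apply ell2_vsub.
      destruct (norm2_shift _ Hd) as [D1 D2].
      replace (vsub (jacobi_action (shift a) (shift b) (shift (us j)))
        (jacobi_action (shift a) (shift b) u)) with
        (vadd (shift (vsub (jacobi_action a b (us j)) (jacobi_action a b e)))
          (vscal (- (RtoC (a 0%nat) * us j 0%nat)) (basis 0))).
      * eapply Rle_trans; [apply norm2_vadd; auto using ell2_vscal, ell2_basis|].
        apply Rplus_le_compat; auto. apply norm2_vscal, ell2_basis.
      * rewrite <- Hsje, jacobi_action_shift. apply functional_extensionality. intro n.
        unfold vadd, vsub, vscal, shift. ring.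
    + apply is_lim_seq_const.
    + replace (Finite 0%R) with
        (Finite (0 + Cmod (- (RtoC (a 0%nat) * e 0%nat)) * norm2 (basis 0))%R).
      * apply is_lim_seq_plus'; auto. apply is_lim_seq_mult'; [|apply is_lim_seq_const].
        apply clim_Cmod. apply clim_opp. apply clim_scal. now apply l2_converges_coord.
      * f_equal. simpl (e 0%nat). rewrite Cmult_0_r, Cmod_opp, Cmod_0. ring.
Qed.

Lemma aprod_shift (a : nat -> R) (n : nat) : (aprod a (S n) = a 0%nat * aprod (shift a) n)%R.
Proof.
  induction n; [simpl; ring|].
  change (aprod a (S (S n))) with (aprod a (S n) * a (S n))%R. rewrite IHn.
  simpl (aprod (shift a) (S n)). unfold shift. ring.
Qed.

(** Both sides satisfy the same recurrence. After division by the determinant of order [n + 1], this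
    says that [<e_0, J_(n+1)^(-1) e_0>] is [h_0] minus the Green ratio, the form at [z = 0] of
    Markov's theorem. *)
Lemma rdet_shift (a b h : nat -> R) :
  (b 0%nat * h 0%nat = 1 + a 0%nat * h 1%nat)%R ->
  (forall n, (b (S n) * h (S n) = a n * h n + a (S n) * h (S (S n)))%R) ->
  forall n, (jacobi_rdet (shift a) (shift b) 0 n =
    h 0%nat * jacobi_rdet a b 0 (S n) - aprod a (S n) * h (S n))%R.
Proof.
  intros H0 HS. induction n as [| |n IH1 IH2] using two_step_ind.
  - simpl. lra.
  - assert (E1 := f_equal (Rmult (b 1%nat)) H0).
    assert (E2 := f_equal (Rmult (a 0%nat)) (HS 0%nat)).
    simpl. unfold shift. lra.
  - change (jacobi_rdet (shift a) (shift b) 0 (S (S n))) with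
      ((b (S (S n)) - 0) * jacobi_rdet (shift a) (shift b) 0 (S n)
       - a (S n) ^ 2 * jacobi_rdet (shift a) (shift b) 0 n)%R.
    rewrite IH1, IH2.
    change (jacobi_rdet a b 0 (S (S (S n)))) with
      ((b (S (S n)) - 0) * jacobi_rdet a b 0 (S (S n)) - a (S n) ^ 2 * jacobi_rdet a b 0 (S n))%R.
    change (aprod a (S (S (S n)))) with (aprod a (S n) * a (S n) * a (S (S n)))%R.
    change (aprod a (S (S n))) with (aprod a (S n) * a (S n))%R.
    pose proof (HS (S n)) as K.
    replace (aprod a (S n) * a (S n) * a (S (S n)) * h (S (S (S n))))%R with
      (aprod a (S n) * a (S n) * (b (S (S n)) * h (S (S n)) - a (S n) * h (S n)))%R
      by (rewrite K; ring).
    ring.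
Qed.

Lemma green_data_rdet_pos (a b h : nat -> R) : green_data a b h ->
  forall n, (0 < jacobi_rdet a b 0 n)%R.
Proof. intros [Ha Hh H0 HS _ _ _]. now apply (rdet_pos a b h). Qed.

Lemma green_diag_pos (a b h : nat -> R) : green_data a b h ->
  forall n, (0 < green_diag a b h n)%R.
Proof.
  intros G n. unfold green_diag. apply Rmult_lt_0_compat; [|apply G].
  apply Rdiv_lt_0_compat; [now apply (green_data_rdet_pos a b h) | apply aprod_pos, G].
Qed.

Lemma shift_h_pos (a b h : nat -> R) : green_data a b h -> forall n, (0 < shift_h a h n)%R.
Proof.
  intros [Ha Hh _ _ _ _ _] n. unfold shift_h. apply Rdiv_lt_0_compat; auto.
  now apply Rmult_lt_0_compat.
Qed.

Lemma shift_h_recurrence (a b h : nat -> R) : green_data a b h ->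
  (shift b 0%nat * shift_h a h 0%nat = 1 + shift a 0%nat * shift_h a h 1%nat)%R /\
  (forall n, shift b (S n) * shift_h a h (S n)
     = shift a n * shift_h a h n + shift a (S n) * shift_h a h (S (S n)))%R.
Proof.
  intros [Ha Hh _ HS _ _ _].
  assert (Hne : (a 0%nat <> 0 /\ h 0%nat <> 0)%R).
  { specialize (Ha 0%nat). specialize (Hh 0%nat). lra. }
  unfold shift, shift_h. split.
  - replace (b 1%nat * (h 1%nat / (a 0%nat * h 0%nat)))%R with
      (b 1%nat * h 1%nat / (a 0%nat * h 0%nat))%R by (field; tauto).
    rewrite HS. field. tauto.
  - intro n.
    replace (b (S (S n)) * (h (S (S n)) / (a 0%nat * h 0%nat)))%R with
      (b (S (S n)) * h (S (S n)) / (a 0%nat * h 0%nat))%R by (field; tauto).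
    rewrite HS. field. tauto.
Qed.

Lemma rdet_shift_pos (a b h : nat -> R) : green_data a b h ->
  forall n, (0 < jacobi_rdet (shift a) (shift b) 0 n)%R.
Proof.
  intro G. destruct (shift_h_recurrence a b h G).
  apply (rdet_pos _ _ (shift_h a h)); auto.
  - intro n. apply G.
  - now apply (shift_h_pos a b).
Qed.

(** Schur complement: the diagonal of the inverse of [J^[1]] is that of [J^{-1}] minus the
    nonnegative [h_(n+1)^2 / h_0]. *)
Lemma green_diag_shift_le (a b h : nat -> R) : green_data a b h ->
  forall n, (0 < green_diag (shift a) (shift b) (shift_h a h) n <= green_diag a b h (S n))%R.
Proof.
  intros G n. split.
  - unfold green_diag. apply Rmult_lt_0_compat; [|now apply (shift_h_pos a b)].
    apply Rdiv_lt_0_compat; [now apply (rdet_shift_pos a b h)|].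
    apply aprod_pos. intro. apply G.
  - unfold green_diag, shift_h. destruct G as [Ha Hh H0 HS _ _ _].
    rewrite (rdet_shift a b h) by auto.
    assert (HA : (0 < aprod (shift a) n)%R) by (apply aprod_pos; intro; apply Ha).
    pose proof (Ha 0%nat). pose proof (Hh 0%nat). pose proof (Hh (S n)).
    rewrite aprod_shift.
    assert (E : (0 <= h (S n) ^ 2 / h 0%nat)%R).
    { apply Rdiv_le_0_compat; auto. apply pow2_ge_0. }
    replace ((h 0%nat * jacobi_rdet a b 0 (S n) - a 0%nat * aprod (shift a) n * h (S n)) /
      aprod (shift a) n * (h (S n) / (a 0%nat * h 0%nat)))%R with
     (jacobi_rdet a b 0 (S n) / (a 0%nat * aprod (shift a) n) * h (S n)
      - h (S n) ^ 2 / h 0%nat)%R by (field; lra).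
    lra.
Qed.

Lemma green_data_shift (a b h : nat -> R) :
  green_data a b h -> green_data (shift a) (shift b) (shift_h a h).
Proof.
  intro G. destruct (shift_h_recurrence a b h G) as [K0 KS].
  constructor; auto.
  - intro n. apply G.
  - now apply (shift_h_pos a b).
  - apply ex_series_le_R with (fun n => green_diag a b h (S n)).
    + intro n. pose proof (green_diag_shift_le a b h G n). lra.
    + apply (proj1 (ex_series_incr_1 (green_diag a b h))), G.
  - pose proof (rdet_shift_pos a b h G) as Hdp.
    pose proof (green_data_rdet_pos a b h G) as Hd.
    destruct G as [Ha Hh H0 HS _ Hr _].
    (* By [rdet_shift] the new ratio is a Moebius function of the old one that vanishes at 0. *)
    apply is_lim_seq_ext with (fun n => green_ratio a b h (S n) /
      (a 0%nat ^ 2 * h 0%nat * (h 0%nat - green_ratio a b h (S n))))%R.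
    + intro n. specialize (Hdp n). rewrite (rdet_shift a b h) in Hdp by auto.
      assert (HA : (0 < aprod (shift a) n)%R) by (apply aprod_pos; intro; apply Ha).
      pose proof (Ha 0%nat). pose proof (Hh 0%nat). pose proof (Hh (S n)). specialize (Hd (S n)).
      unfold green_ratio, shift_h. rewrite (rdet_shift a b h) by auto.
      rewrite aprod_shift in *. field.
      repeat split; lra.
    + pose proof (Ha 0%nat). pose proof (Hh 0%nat).
      apply (is_lim_seq_incr_1 (green_ratio a b h)) in Hr.
      replace (Finite 0%R) with
       (Finite (0 / (a 0%nat ^ 2 * h 0%nat * (h 0%nat - 0)))%R).
      * apply is_lim_seq_div'; auto.
        -- apply is_lim_seq_mult'; [apply is_lim_seq_const|].
           apply is_lim_seq_minus'; auto. apply is_lim_seq_const.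
        -- apply Rgt_not_eq, Rlt_gt. rewrite Rminus_0_r.
           apply Rmult_lt_0_compat; auto. apply Rmult_lt_0_compat; auto. now apply pow_lt.
      * f_equal. field. lra.
  - apply maximal_shift, G.
Qed.

(** * Interlacing of zeros *)

(* [f] is a polynomial of degree at most [n] in which [(-z)^n] has coefficient [l] *)
Fixpoint poly_lead (n : nat) (l : C) (f : C -> C) : Prop :=
  match n with
  | O => forall z, f z = l
  | S m => exists c g, poly_lead m l g /\ forall z, f z = c - z * g z
  end.

Lemma poly_lead_ext (n : nat) (l : C) (f g : C -> C) :
  (forall z, f z = g z) -> poly_lead n l f -> poly_lead n l g.
Proof.
  intro H. destruct n; simpl.
  - intros K z. now rewrite <- H.
  - intros (c & k & K1 & K2). exists c, k. split; auto. intro z. now rewrite <- H.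
Qed.

Lemma poly_lead_plus (n : nat) : forall (l m : C) (f g : C -> C),
  poly_lead n l f -> poly_lead n m g -> poly_lead n (l + m) (fun z => f z + g z).
Proof.
  induction n; simpl; intros l m f g Hf Hg.
  - intro z. now rewrite Hf, Hg.
  - destruct Hf as (c & f' & F1 & F2), Hg as (d & g' & G1 & G2).
    exists (c + d), (fun z => f' z + g' z). split; auto.
    intro z. rewrite F2, G2. ring.
Qed.

Lemma poly_lead_scal (n : nat) : forall (c l : C) (f : C -> C),
  poly_lead n l f -> poly_lead n (c * l) (fun z => c * f z).
Proof.
  induction n; simpl; intros c l f Hf.
  - intro z. now rewrite Hf.
  - destruct Hf as (d & f' & F1 & F2).
    exists (c * d), (fun z => c * f' z). split; auto.
    intro z. rewrite F2. ring.
Qed.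

Lemma poly_lead_raise (n : nat) : forall (l : C) (f : C -> C),
  poly_lead n l f -> poly_lead (S n) 0 f.
Proof.
  induction n; intros l f Hf.
  - exists l, (fun _ => 0). split; [intro; reflexivity|]. intro z. rewrite Hf. ring.
  - destruct Hf as (d & f' & F1 & F2). exists d, f'. split; auto. now apply (IHn l).
Qed.

Lemma poly_lead_linear (n : nat) (c l : C) (f : C -> C) :
  poly_lead n l f -> poly_lead (S n) l (fun z => (c - z) * f z).
Proof.
  intro Hf.
  apply poly_lead_ext with (fun z => c * f z + (0 - z * f z)); [intro; ring|].
  replace l with (c * 0 + l) by ring.
  apply poly_lead_plus.
  - apply poly_lead_scal. now apply (poly_lead_raise n l).
  - exists 0, f. auto.
Qed.

(** Division by [r - z], by induction on the Horner form. *)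
Lemma poly_lead_factor (r : C) (n : nat) : forall (l : C) (f : C -> C),
  poly_lead (S n) l f -> exists g, poly_lead n l g /\ forall z, f z = f r + (r - z) * g z.
Proof.
  induction n; intros l f (c & h & H1 & H2).
  - exists h. split; auto. intro z. rewrite !H2, !H1. ring.
  - destruct (IHn l h H1) as (k & K1 & K2).
    exists (fun z => h r - z * k z). split; [exists (h r), k; auto|].
    intro z. rewrite !H2, (K2 z). ring.
Qed.

(** * Real roots and the signs between them *)

Fixpoint rprod (r : nat -> R) (n : nat) (x : R) : R :=
  match n with O => 1 | S m => rprod r m x * (r m - x) end%R.

Definition root_prod (r : nat -> R) (n : nat) (z : C) : C :=
  Cprod (fun j => RtoC (r j) - z) n.

Lemma root_prod_R (r : nat -> R) (n : nat) (x : R) :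
  root_prod r n (RtoC x) = RtoC (rprod r n x).
Proof.
  unfold root_prod. induction n; simpl; auto. now rewrite IHn, RtoC_mult, RtoC_minus.
Qed.

Lemma rprod_eq_0 (r : nat -> R) (n : nat) (x : R) :
  rprod r n x = 0%R <-> exists j, (j < n)%nat /\ x = r j.
Proof.
  induction n; simpl.
  - split; [lra | intros (j & Hj & _); lia].
  - split.
    + intro H. apply Rmult_integral in H. destruct H as [H|H].
      * apply IHn in H. destruct H as (j & Hj & E). exists j. split; auto.
      * exists n. split; auto. lra.
    + intros (j & Hj & E). destruct (Nat.eq_dec j n) as [->|Hn].
      * rewrite E. ring.
      * replace (rprod r n x) with 0%R; [ring|]. symmetry. apply IHn.
        exists j. split; auto. lia.
Qed.

Lemma rprod_continuity (r : nat -> R) (n : nat) : continuity (rprod r n).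
Proof.
  induction n.
  - apply continuity_const. intros x y. reflexivity.
  - apply (continuity_mult (rprod r n) (fun x => r n - x)%R); auto.
    apply continuity_minus; [apply continuity_const; intros ? ?; reflexivity|].
    apply derivable_continuous, derivable_id.
Qed.

(** Each root below [x] contributes one change of sign; [k] counts these roots, and the minimum
    covers the case [k > n]. *)
Lemma rprod_sign (r : nat -> R) (n k : nat) (x : R) :
  (forall i, (i < n)%nat -> (i < k)%nat -> r i < x)%R ->
  (forall i, (i < n)%nat -> (k <= i)%nat -> x < r i)%R ->
  (0 < sgn (Nat.min k n) * rprod r n x)%R.
Proof.
  intros H1 H2. induction n.
  - rewrite Nat.min_0_r. unfold sgn. simpl. lra.
  - assert (K : (0 < sgn (Nat.min k n) * rprod r n x)%R) by (apply IHn; auto).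
    simpl rprod. destruct (Nat.lt_ge_cases n k) as [Hk|Hk].
    + rewrite Nat.min_r in K by lia. rewrite Nat.min_r, sgn_S by lia.
      specialize (H1 n ltac:(lia) Hk).
      replace (- sgn n * (rprod r n x * (r n - x)))%R
        with (sgn n * rprod r n x * (x - r n))%R by ring.
      apply Rmult_lt_0_compat; lra.
    + rewrite Nat.min_l in K by lia. rewrite Nat.min_l by lia.
      specialize (H2 n ltac:(lia) Hk). rewrite <- Rmult_assoc.
      apply Rmult_lt_0_compat; lra.
Qed.

Lemma poly_lead_factor_roots (m : nat) (l : C) (f : C -> C) (t : nat -> R) (k : nat) :
  poly_lead (k + m) l f ->
  (forall i j, (i < j)%nat -> (j < k)%nat -> t i <> t j) ->
  (forall j, (j < k)%nat -> f (RtoC (t j)) = 0) ->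
  exists g, poly_lead m l g /\ forall z, f z = root_prod t k z * g z.
Proof.
  intros Hf.
  assert (K : forall q, (q <= k)%nat -> (forall i j, (i < j)%nat -> (j < k)%nat -> t i <> t j) ->
    (forall j, (j < k)%nat -> f (RtoC (t j)) = 0) ->
    exists g, poly_lead (k + m - q) l g /\ forall z, f z = root_prod t q z * g z).
  { induction q; intros Hq Hd Ht.
    - exists f. rewrite Nat.sub_0_r. split; auto. intro z. unfold root_prod. simpl. ring.
    - destruct IHq as (g & G1 & G2); auto; [lia|].
      replace (k + m - q)%nat with (S (k + m - S q)) in G1 by lia.
      destruct (poly_lead_factor (RtoC (t q)) _ _ _ G1) as (g' & G1' & G2').
      exists g'. split; auto. intro z. rewrite G2, G2'.
      replace (g (RtoC (t q))) with (RtoC 0).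
      + unfold root_prod. simpl. ring.
      + pose proof (Ht q Hq) as E. rewrite G2, root_prod_R in E.
        apply Cmult_neq_0_or in E. destruct E as [E|E]; auto.
        apply RtoC_inj, rprod_eq_0 in E. destruct E as (j & Hj & E).
        exfalso. now apply (Hd j q). }
  intros Hd Ht. destruct (K k (le_n k) Hd Ht) as (g & G1 & G2).
  exists g. split; auto. now replace (k + m - k)%nat with m in G1 by lia.
Qed.

Lemma root_prod_poly_lead (r : nat -> R) (n : nat) : poly_lead n 1 (root_prod r n).
Proof.
  induction n.
  - intro z. reflexivity.
  - apply poly_lead_ext with (fun z => (RtoC (r n) - z) * root_prod r n z).
    + intro z. unfold root_prod. simpl. ring.
    + now apply poly_lead_linear.
Qed.

Definition is_roots (n : nat) (f : C -> C) (r : nat -> R) : Prop :=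
  (forall j, (j < n)%nat -> 0 < r j)%R /\
  (forall j, (S j < n)%nat -> r j < r (S j))%R /\
  (forall z, f z = root_prod r n z).

Definition interlace (n : nat) (r s : nat -> R) : Prop :=
  forall j, (j < n)%nat -> (s j < r j < s (S j))%R.

Lemma increasing_le (r : nat -> R) (n i j : nat) :
  (forall j, (S j < n)%nat -> r j < r (S j))%R -> (i <= j)%nat -> (j < n)%nat -> (r i <= r j)%R.
Proof.
  intros H Hij. induction Hij as [|j Hij IH]; intro Hj; [lra|].
  specialize (H j Hj). specialize (IH ltac:(lia)). lra.
Qed.

Lemma increasing_lt (r : nat -> R) (n i j : nat) :
  (forall j, (S j < n)%nat -> r j < r (S j))%R -> (i < j)%nat -> (j < n)%nat -> (r i < r j)%R.
Proof.
  intros H Hij Hj. eapply Rlt_le_trans; [apply H; lia|]. apply (increasing_le r n); auto.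
Qed.

Lemma IVT_sign (f : R -> R) (x y : R) (k : nat) : continuity f -> (x < y)%R ->
  (0 < sgn k * f x)%R -> (0 < sgn (S k) * f y)%R -> exists t, (x < t < y)%R /\ f t = 0%R.
Proof.
  intros Hf Hxy Hx Hy. rewrite sgn_S in Hy.
  destruct (IVT_cor f x y Hf) as (t & [T1 T2] & T3); [lra| |].
  - pose proof (sgn_sq k).
    assert (0 < (sgn k * f x) * (- sgn k * f y))%R by now apply Rmult_lt_0_compat.
    replace (sgn k * f x * (- sgn k * f y))%R with (- (sgn k * sgn k * (f x * f y)))%R in H0
      by ring.
    rewrite H in H0. lra.
  - exists t. split; auto.
    assert (t <> x) by (intros ->; rewrite T3 in Hx; lra).
    assert (t <> y) by (intros ->; rewrite T3 in Hy; lra). lra.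
Qed.

(** At a root of [f1] the recurrence leaves [- ga f0], whose sign alternates along these roots
    because [f0] has exactly one root between neighbours. Together with [f2 0 > 0] this locates
    [n + 1] roots by the intermediate value theorem; the last root comes from the leading
    coefficient. The same step serves the recurrence in the last row and the one in the first
    row. *)
Lemma interlace_step (n : nat) (f0 f1 f2 : C -> C) (r s : nat -> R) (be ga c : R) :
  is_roots n f0 r -> is_roots (S n) f1 s -> interlace n r s -> (0 < ga)%R ->
  (forall z, f2 z = (RtoC be - z) * f1 z - RtoC ga * f0 z) ->
  f2 0 = RtoC c -> (0 < c)%R ->
  exists t, is_roots (S (S n)) f2 t /\ interlace (S n) s t.
Proof.
  intros (R1 & R2 & R3) (S1 & S2 & S3) Hint Hga Hf2 Hc0 Hc.
  set (F := fun x => ((be - x) * rprod s (S n) x - ga * rprod r n x)%R).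
  assert (HF : forall x, f2 (RtoC x) = RtoC (F x)).
  { intro x. rewrite Hf2, S3, R3, !root_prod_R. unfold F.
    now rewrite RtoC_minus, !RtoC_mult, RtoC_minus. }
  assert (HFc : continuity F).
  { apply (continuity_minus (fun x => (be - x) * rprod s (S n) x)%R (fun x => ga * rprod r n x)%R).
    - apply (continuity_mult (fun x => be - x)%R); [|apply rprod_continuity].
      apply (continuity_minus (fun _ => be) (fun x => x)).
      + apply continuity_const. intros ? ?. reflexivity.
      + apply derivable_continuous, derivable_id.
    - apply (continuity_mult (fun _ => ga)); [|apply rprod_continuity].
      apply continuity_const. intros ? ?. reflexivity. }
  (* Left endpoints of the intervals that contain the roots: 0, then the roots of [f1], so that
     [s j] is [x (S j)]. *)
  set (x := fun j => match j with O => 0%R | S i => s i end).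
  assert (Hx : forall j, (j <= n)%nat -> (x j < s j)%R).
  { intros [|j] Hj; simpl; [apply S1; lia | apply S2; lia]. }
  assert (Hxs : forall j, (j <= S n)%nat -> (0 < sgn j * F (x j))%R).
  { intros [|i] Hi.
    - unfold sgn. simpl. rewrite (HF 0%R) in Hc0.
      apply RtoC_inj in Hc0. rewrite Hc0. lra.
    - simpl x. unfold F. rewrite (proj2 (rprod_eq_0 s (S n) (s i))) by (exists i; split; auto; lia).
      rewrite sgn_S.
      replace (- sgn i * ((be - s i) * 0 - ga * rprod r n (s i)))%R with
        (ga * (sgn i * rprod r n (s i)))%R by ring.
      apply Rmult_lt_0_compat; auto. replace i with (Nat.min i n) at 1 by lia.
      apply rprod_sign.
      + intros q Hq Hqi. eapply Rlt_le_trans; [apply Hint; auto|].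
        apply (increasing_le s (S n)); auto; lia.
      + intros q Hq Hqi. eapply Rle_lt_trans; [|apply Hint; auto].
        apply (increasing_le s (S n)); auto; lia. }
  assert (Ht : forall j, exists t, (j <= n)%nat -> (x j < t < s j)%R /\ F t = 0%R).
  { intro j. destruct (le_lt_dec j n) as [Hj|Hj]; [|exists 0%R; lia].
    destruct (IVT_sign F (x j) (s j) j) as (t & T1 & T2); auto.
    - apply (Hxs (S j)). lia.
    - exists t. auto. }
  set (t := fun j => proj1_sig (constructive_indefinite_description _ (Ht j))).
  assert (Ht' : forall j, (j <= n)%nat -> (x j < t j < s j)%R /\ F (t j) = 0%R).
  { intro j. unfold t. destruct (constructive_indefinite_description _ (Ht j)). auto. }
  clearbody t. clear Ht.
  assert (Htinc : forall i j, (i < j)%nat -> (j <= n)%nat -> (t i < t j)%R).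
  { intros i j Hij Hj. destruct (Ht' i ltac:(lia)) as [[_ K1] _].
    destruct (Ht' j Hj) as [[K2 _] _]. destruct j; [lia|]. simpl in K2.
    assert (s i <= s j)%R by (apply (increasing_le s (S n)); auto; lia). lra. }
  destruct (poly_lead_factor_roots 1 1 f2 t (S n)) as (g & (d & k & K1 & K2) & G2).
  { rewrite Nat.add_1_r.
    apply poly_lead_ext with (fun z => (RtoC be - z) * root_prod s (S n) z
      + RtoC (- ga) * root_prod r n z).
    - intro z. rewrite Hf2, S3, R3, RtoC_opp. ring.
    - replace (RtoC 1) with (RtoC 1 + RtoC (- ga) * 0) at 1 by ring.
      apply poly_lead_plus; [apply poly_lead_linear, root_prod_poly_lead|].
      apply poly_lead_scal. apply (poly_lead_raise (S n) 0), (poly_lead_raise n 1).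
      apply root_prod_poly_lead. }
  { intros i j Hij Hj. apply Rlt_not_eq, Htinc; lia. }
  { intros j Hj. rewrite HF. now destruct (Ht' j ltac:(lia)) as [_ ->]. }
  assert (P0 : (0 < rprod t (S n) 0)%R).
  { pose proof (rprod_sign t (S n) 0 0%R) as K. simpl Nat.min in K. unfold sgn in K.
    simpl pow in K. rewrite Rmult_1_l in K. apply K; [intros; lia|].
    intros i Hi _. destruct (Ht' i ltac:(lia)) as [[K3 _] _].
    eapply Rle_lt_trans; [|apply K3]. destruct i; simpl; [lra|]. left. apply S1. lia. }
  (* After [n + 1] roots are split off, the leading coefficient leaves the factor [l - z]. The value
     [c] at 0 determines [l], and the sign of [F] at [s n] places it beyond [s n]. *)
  set (l := (c / rprod t (S n) 0)%R).
  assert (Hd : d = RtoC l).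
  { specialize (G2 0). rewrite Hc0, (root_prod_R t (S n) 0), K2 in G2.
    unfold l. rewrite RtoC_div by lra. rewrite G2. field. apply RtoC_neq_0. lra. }
  assert (Hl : (s n < l)%R).
  { pose proof (Hxs (S n) (le_n _)) as K. simpl x in K.
    assert (E : F (s n) = (rprod t (S n) (s n) * (l - s n))%R).
    { apply RtoC_inj. rewrite <- HF, G2, root_prod_R, K2, K1, Hd.
      rewrite RtoC_mult, RtoC_minus. ring. }
    rewrite E in K.
    assert (K' : (0 < sgn (Nat.min (S n) (S n)) * rprod t (S n) (s n))%R).
    { apply rprod_sign; [|intros; lia]. intros i Hi _.
      destruct (Ht' i ltac:(lia)) as [[_ K3] _]. eapply Rlt_le_trans; [apply K3|].
      apply (increasing_le s (S n)); auto; lia. }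
    rewrite Nat.min_id in K'. rewrite <- Rmult_assoc in K.
    assert (0 < l - s n)%R; [|lra].
    apply Rmult_lt_reg_l with (sgn (S n) * rprod t (S n) (s n))%R; auto.
    now rewrite Rmult_0_r. }
  set (t' := fun j => if Nat.leb j n then t j else l).
  assert (Hint' : interlace (S n) s t').
  { intros j Hj. unfold t'. destruct (Nat.leb_spec j n); [|lia].
    destruct (Ht' j ltac:(lia)) as [[_ K3] _]. split; auto.
    destruct (Nat.leb_spec (S j) n).
    - destruct (Ht' (S j) ltac:(lia)) as [[K4 _] _]. exact K4.
    - now replace j with n by lia. }
  exists t'. split; auto. split; [|split].
  - intros j Hj. unfold t'. destruct (Nat.leb_spec j n).
    + destruct (Ht' j ltac:(lia)) as [[K3 _] _]. eapply Rle_lt_trans; [|apply K3].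
      destruct j; simpl; [lra|]. left. apply S1. lia.
    + specialize (S1 n ltac:(lia)). lra.
  - intros j Hj. destruct (Hint' j ltac:(lia)). lra.
  - intro z. rewrite G2, K2, K1, Hd. unfold root_prod.
    change (Cprod ?u (S (S n))) with (Cprod u (S n) * u (S n)). cbv beta.
    replace (t' (S n)) with l.
    2: { unfold t'. destruct (Nat.leb_spec (S n) n); [lia | auto]. }
    replace (Cprod (fun j => RtoC (t' j) - z) (S n)) with (Cprod (fun j => RtoC (t j) - z) (S n)).
    + ring.
    + assert (E : forall q, (q <= S n)%nat -> Cprod (fun j => RtoC (t j) - z) q =
        Cprod (fun j => RtoC (t' j) - z) q).
      { induction q; intro Hq; [reflexivity|]. cbn [Cprod]. rewrite IHq by lia.
        unfold t'. destruct (Nat.leb_spec q n); [auto | lia]. }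
      now apply E.
Qed.

(** Strong induction: once the earlier entries agree, each list's next entry occurs in the other at
    no earlier place, so neither can be smaller. The predicate [P] lets one argument serve initial
    segments and infinite sequences. *)
Lemma increasing_enumeration_unique (P : nat -> Prop) (r s : nat -> R) :
  (forall i j, P i -> P j -> (i < j)%nat -> (r i < r j)%R) ->
  (forall i j, P i -> P j -> (i < j)%nat -> (s i < s j)%R) ->
  (forall i, P i -> exists j, P j /\ r i = s j) ->
  (forall i, P i -> exists j, P j /\ s i = r j) ->
  forall i, P i -> r i = s i.
Proof.
  intros Hr Hs Hrs Hsr i. induction i as [i IH] using lt_wf_ind. intro Pi.
  assert (K : forall r s : nat -> R,
    (forall i j, P i -> P j -> (i < j)%nat -> (r i < r j)%R) ->
    (forall i j, P i -> P j -> (i < j)%nat -> (s i < s j)%R) ->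
    (forall i, P i -> exists j, P j /\ r i = s j) ->
    (forall j, (j < i)%nat -> P j -> r j = s j) -> (s i <= r i)%R).
  { clear - Pi. intros r s Hr Hs Hrs IH. destruct (Hrs i Pi) as (j & Pj & E).
    destruct (lt_eq_lt_dec j i) as [[Hj|Hj]|Hj].
    - specialize (Hr j i Pj Pi Hj). rewrite (IH j Hj Pj) in Hr. lra.
    - subst. lra.
    - specialize (Hs i j Pi Pj Hj). lra. }
  apply Rle_antisym.
  - apply K; auto. intros j Hj Pj. symmetry. now apply IH.
  - apply K; auto.
Qed.

Lemma is_roots_unique (n : nat) (f : C -> C) (r s : nat -> R) :
  is_roots n f r -> is_roots n f s -> forall j, (j < n)%nat -> r j = s j.
Proof.
  intros (_ & R2 & R3) (_ & S2 & S3).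
  assert (E : forall x, rprod r n x = rprod s n x).
  { intro x. apply RtoC_inj. now rewrite <- !root_prod_R, <- R3, <- S3. }
  apply increasing_enumeration_unique.
  - intros i j _ Hj Hij. now apply (increasing_lt r n).
  - intros i j _ Hj Hij. now apply (increasing_lt s n).
  - intros i Hi. apply (rprod_eq_0 s n). rewrite <- E. apply rprod_eq_0. now exists i.
  - intros i Hi. apply (rprod_eq_0 r n). rewrite E. apply rprod_eq_0. now exists i.
Qed.

Lemma jacobi_det_SS (a b : nat -> R) (z : C) (n : nat) :
  jacobi_det a b z (S (S n)) =
  (RtoC (b (S n)) - z) * jacobi_det a b z (S n) - RtoC (a n ^ 2) * jacobi_det a b z n.
Proof. reflexivity. Qed.

Lemma jacobi_det_top (a b : nat -> R) (z : C) (n : nat) :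
  jacobi_det a b z (S (S n)) =
  (RtoC (b 0%nat) - z) * jacobi_det (shift a) (shift b) z (S n)
  - RtoC (a 0%nat ^ 2) * jacobi_det (shift (shift a)) (shift (shift b)) z n.
Proof.
  induction n as [| |n IH1 IH2] using two_step_ind.
  - simpl. unfold shift. ring.
  - simpl. unfold shift. ring.
  - rewrite jacobi_det_SS, IH1, IH2, !(jacobi_det_SS (shift a)).
    rewrite (jacobi_det_SS (shift (shift a))). unfold shift. ring.
Qed.

Lemma is_roots_0 (f : C -> C) (r : nat -> R) : (forall z, f z = 1) -> is_roots 0 f r.
Proof. intro H. split; [intros; lia|]. split; [intros; lia | exact H]. Qed.

Lemma is_roots_1 (f : C -> C) (c : R) :
  (0 < c)%R -> (forall z, f z = RtoC c - z) -> is_roots 1 f (fun _ => c).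
Proof.
  intros Hc H. split; [auto|]. split; [intros; lia|]. intro z. rewrite H.
  unfold root_prod. simpl. ring.
Qed.

Lemma green_data_b_0_pos (a b h : nat -> R) : green_data a b h -> (0 < b 0%nat)%R.
Proof. intro G. pose proof (green_data_rdet_pos a b h G 1) as K. simpl in K. lra. Qed.

Lemma interlace_bottom (a b h : nat -> R) (n : nat) : green_data a b h ->
  exists r s, is_roots n (fun z => jacobi_det a b z n) r /\
    is_roots (S n) (fun z => jacobi_det a b z (S n)) s /\ interlace n r s.
Proof.
  intro G. induction n.
  - exists (fun _ => 0%R), (fun _ => b 0%nat). split; [now apply is_roots_0|]. split.
    + apply is_roots_1; [now apply (green_data_b_0_pos a b h)|]. intro z. simpl. ring.
    + intros j Hj. lia.
  - destruct IHn as (r & s & Hr & Hs & Hrs).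
    destruct (interlace_step n _ _ (fun z => jacobi_det a b z (S (S n))) r s (b (S n)) (a n ^ 2)%R
      (jacobi_rdet a b 0 (S (S n))) Hr Hs Hrs) as (t & Ht & Hst).
    + apply pow_lt, G.
    + intro z. apply jacobi_det_SS.
    + apply (jacobi_det_R a b 0%R).
    + now apply (green_data_rdet_pos a b h).
    + now exists s, t.
Qed.

(** Expansion along the first row involves [J^[1]] and [J^[2]], so the induction hypothesis is used
    for shifted data; hence the quantification over [a], [b], [h]. *)
Lemma interlace_top (n : nat) : forall a b h : nat -> R, green_data a b h ->
  exists r s, is_roots n (fun z => jacobi_det (shift a) (shift b) z n) r /\
    is_roots (S n) (fun z => jacobi_det a b z (S n)) s /\ interlace n r s.
Proof.
  induction n; intros a b h G.
  - exists (fun _ => 0%R), (fun _ => b 0%nat). split; [now apply is_roots_0|]. split.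
    + apply is_roots_1; [now apply (green_data_b_0_pos a b h)|]. intro z. simpl. ring.
    + intros j Hj. lia.
  - destruct (IHn _ _ _ (green_data_shift a b h G)) as (r & s & Hr & Hs & Hrs).
    destruct (interlace_step n _ _ (fun z => jacobi_det a b z (S (S n))) r s (b 0%nat)
      (a 0%nat ^ 2)%R (jacobi_rdet a b 0 (S (S n))) Hr Hs Hrs) as (t & Ht & Hst).
    + apply pow_lt, G.
    + intro z. apply jacobi_det_top.
    + apply (jacobi_det_R a b 0%R).
    + now apply (green_data_rdet_pos a b h).
    + now exists s, t.
Qed.

(** * Reciprocal roots of the truncations *)

Definition jacobi_roots (a b : nat -> R) (n : nat) : nat -> R :=
  epsilon (inhabits (fun _ => 0%R)) (is_roots n (fun z => jacobi_det a b z n)).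

Lemma jacobi_roots_spec (a b h : nat -> R) (n : nat) : green_data a b h ->
  is_roots n (fun z => jacobi_det a b z n) (jacobi_roots a b n).
Proof.
  intro G. unfold jacobi_roots. apply epsilon_spec.
  destruct (interlace_bottom a b h n G) as (r & _ & Hr & _). now exists r.
Qed.

(** Padding by 0 places the missing roots at infinity: their factors are 1, and the lists for all
    orders [n] can be compared entry by entry. *)
Definition inv_roots (a b : nat -> R) (n j : nat) : R :=
  if Nat.ltb j n then (/ jacobi_roots a b n j)%R else 0%R.

Lemma inv_roots_interlace (f g : C -> C) (n : nat) (r s r' s' : nat -> R) :
  is_roots n f r -> is_roots (S n) g s -> interlace n r s ->
  is_roots n f r' -> is_roots (S n) g s' -> interlace n r' s'.
Proof.
  intros Hr Hs H Hr' Hs' j Hj.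
  rewrite (is_roots_unique n f r' r Hr' Hr), (is_roots_unique (S n) g s' s Hs' Hs j),
    (is_roots_unique (S n) g s' s Hs' Hs (S j)) by lia. auto.
Qed.

Lemma inv_roots_nonneg (a b h : nat -> R) (n j : nat) : green_data a b h ->
  (0 <= inv_roots a b n j)%R.
Proof.
  intro G. unfold inv_roots. destruct (Nat.ltb_spec j n); [|lra].
  left. apply Rinv_0_lt_compat, (jacobi_roots_spec a b h n G). auto.
Qed.

Lemma inv_roots_bottom (a b h : nat -> R) (n j : nat) : green_data a b h ->
  (inv_roots a b n j <= inv_roots a b (S n) j)%R.
Proof.
  intro G. destruct (interlace_bottom a b h n G) as (r & s & Hr & Hs & Hi).
  pose proof (jacobi_roots_spec a b h n G) as Hr'.
  pose proof (jacobi_roots_spec a b h (S n) G) as Hs'.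
  pose proof (inv_roots_interlace _ _ n r s _ _ Hr Hs Hi Hr' Hs') as Hi'.
  destruct (Nat.lt_ge_cases j n) as [Hj|Hj].
  - unfold inv_roots. destruct (Nat.ltb_spec j n), (Nat.ltb_spec j (S n)); try lia.
    apply Rinv_le_contravar; [apply Hs'; lia|]. left. now apply Hi'.
  - unfold inv_roots at 1. destruct (Nat.ltb_spec j n); [lia|].
    now apply (inv_roots_nonneg a b h).
Qed.

Lemma inv_roots_top (a b h : nat -> R) (n j : nat) : green_data a b h ->
  (inv_roots a b (S n) (S j) <= inv_roots (shift a) (shift b) n j <= inv_roots a b (S n) j)%R.
Proof.
  intro G. destruct (interlace_top n a b h G) as (r & s & Hr & Hs & Hi).
  pose proof (jacobi_roots_spec _ _ _ n (green_data_shift a b h G)) as Hr'.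
  pose proof (jacobi_roots_spec a b h (S n) G) as Hs'.
  pose proof (inv_roots_interlace _ _ n r s _ _ Hr Hs Hi Hr' Hs') as Hi'.
  destruct (Nat.lt_ge_cases j n) as [Hj|Hj].
  - unfold inv_roots.
    destruct (Nat.ltb_spec j n), (Nat.ltb_spec j (S n)), (Nat.ltb_spec (S j) (S n)); try lia.
    split; (apply Rinv_le_contravar; [|left; now apply Hi']).
    + now apply Hr'.
    + apply Hs'. lia.
  - replace (inv_roots a b (S n) (S j)) with 0%R.
    2: { unfold inv_roots. destruct (Nat.ltb_spec (S j) (S n)); [lia|auto]. }
    replace (inv_roots (shift a) (shift b) n j) with 0%R.
    2: { unfold inv_roots. destruct (Nat.ltb_spec j n); [lia|auto]. }
    split; [lra|]. now apply (inv_roots_nonneg a b h).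
Qed.

Lemma jacobi_det_inv_roots (a b h : nat -> R) (n M : nat) (z : C) : green_data a b h ->
  (n <= M)%nat ->
  jacobi_det a b z n =
  RtoC (jacobi_rdet a b 0 n) * Cprod (fun j => 1 - z * RtoC (inv_roots a b n j)) M.
Proof.
  intros G HM. destruct (jacobi_roots_spec a b h n G) as (R1 & _ & R3).
  rewrite <- (jacobi_det_R a b 0%R), !R3. unfold root_prod.
  assert (E : forall q, (q <= n)%nat ->
    Cprod (fun j => RtoC (jacobi_roots a b n j) - z) q =
    Cprod (fun j => RtoC (jacobi_roots a b n j) - 0) q *
    Cprod (fun j => 1 - z * RtoC (inv_roots a b n j)) q).
  { induction q; intro Hq; cbn [Cprod]; [ring|]. rewrite IHq by lia.
    unfold inv_roots. destruct (Nat.ltb_spec q n); [|lia].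
    specialize (R1 q ltac:(lia)). rewrite RtoC_inv by lra.
    field. apply RtoC_neq_0. lra. }
  rewrite E by auto. f_equal. induction HM as [|M HM IH]; auto.
  cbn [Cprod]. rewrite IH. unfold inv_roots at 3. destruct (Nat.ltb_spec M n); [lia|]. ring.
Qed.

(** * Canonical products *)

(** Takes the terms of index below [n], in step with [Cprod]. *)
Fixpoint rsum (x : nat -> R) (n : nat) : R :=
  match n with O => 0 | S m => rsum x m + x m end%R.

Lemma rsum_S (x : nat -> R) (n : nat) : rsum x (S n) = sum_n x n.
Proof.
  induction n; [rewrite sum_O; simpl; ring|].
  rewrite sum_Sn, <- IHn. reflexivity.
Qed.

Lemma rsum_nonneg (x : nat -> R) (n : nat) : (forall j, 0 <= x j)%R -> (0 <= rsum x n)%R.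
Proof. intro H. induction n; simpl; [lra|]. specialize (H n). lra. Qed.

Lemma rsum_le_Series (x : nat -> R) (n : nat) :
  (forall j, 0 <= x j)%R -> ex_series x -> (rsum x n <= Series x)%R.
Proof.
  intros H Hx. destruct n; [now apply Series_nonneg|].
  rewrite rsum_S. now apply sum_n_le_Series.
Qed.

Lemma is_lim_seq_rsum (x : nat -> R) : ex_series x -> is_lim_seq (rsum x) (Series x).
Proof.
  intro Hx. apply is_lim_seq_incr_1.
  apply is_lim_seq_ext with (sum_n x); [intro; now rewrite rsum_S|].
  now apply Series_correct.
Qed.

Lemma ex_series_rsum_bounded (x : nat -> R) (B : R) :
  (forall j, 0 <= x j)%R -> (forall n, rsum x n <= B)%R -> ex_series x /\ (Series x <= B)%R.
Proof.
  intros H HB. apply ex_series_bounded; auto. intro n. rewrite <- rsum_S. apply HB.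
Qed.

(** Parametrized by reciprocal zeros, so that summability of [x] controls convergence and a zero
    entry means an absent factor. *)
Definition lin_prod (x : nat -> R) (z : C) (n : nat) : C :=
  Cprod (fun j => 1 - z * RtoC (x j)) n.

Definition inf_prod (x : nat -> R) (z : C) : C := Clim_seq (lin_prod x z).

Lemma exp_ge (t : R) : (1 + t <= exp t)%R.
Proof. destruct (Req_dec t 0) as [->|H]; [rewrite exp_0; lra|]. left. now apply exp_ineq1. Qed.

Lemma exp_mono (s t : R) : (s <= t)%R -> (exp s <= exp t)%R.
Proof. intros [H| ->]; [left; now apply exp_increasing | lra]. Qed.

Lemma Cmod_factor_le (z : C) (t : R) : (0 <= t)%R ->
  (Cmod (1 - z * RtoC t) <= exp (Cmod z * t))%R.
Proof.
  intro Ht. eapply Rle_trans; [|apply exp_ge].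
  eapply Rle_trans; [apply Cmod_minus_le|].
  rewrite Cmod_1, Cmod_mult, Cmod_R, Rabs_pos_eq by auto. lra.
Qed.

Lemma lin_prod_Cmod_le (x : nat -> R) (z : C) (n : nat) :
  (forall j, 0 <= x j)%R -> (Cmod (lin_prod x z n) <= exp (Cmod z * rsum x n))%R.
Proof.
  intro H. unfold lin_prod. induction n; cbn [Cprod rsum].
  - rewrite Cmod_1, Rmult_0_r, exp_0. lra.
  - rewrite Cmod_mult, Rmult_plus_distr_l, exp_plus.
    apply Rmult_le_compat; auto using Cmod_ge_0, Cmod_factor_le.
Qed.

(** The factors are exchanged one at a time. The common majorant [w] makes the constant independent
    of the two sequences compared. *)
Lemma lin_prod_diff_le (x y w : nat -> R) (z : C) (n : nat) :
  (forall j, 0 <= x j <= w j)%R -> (forall j, 0 <= y j <= w j)%R ->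
  (Cmod (lin_prod x z n - lin_prod y z n) <=
    Cmod z * rsum (fun j => Rabs (x j - y j)) n * exp (Cmod z * rsum w n))%R.
Proof.
  intros Hx Hy. unfold lin_prod. induction n; cbn [Cprod rsum].
  - replace (1 - 1) with (RtoC 0) by ring. rewrite Cmod_0. lra.
  - set (P := Cprod (fun j => 1 - z * RtoC (x j)) n) in *.
    set (Q := Cprod (fun j => 1 - z * RtoC (y j)) n) in *.
    replace (P * (1 - z * RtoC (x n)) - Q * (1 - z * RtoC (y n))) with
      ((P - Q) * (1 - z * RtoC (x n)) - Q * (z * RtoC (x n - y n))) by (rewrite RtoC_minus; ring).
    eapply Rle_trans; [apply Cmod_minus_le|]. rewrite !Cmod_mult, Cmod_R.
    rewrite (Rmult_plus_distr_l (Cmod z) (rsum w n)), exp_plus.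
    set (D := rsum (fun j => Rabs (x j - y j)) n) in *.
    assert (HQ : (Cmod Q <= exp (Cmod z * rsum w n))%R).
    { eapply Rle_trans; [apply (lin_prod_Cmod_le y z n); intro; apply Hy|].
      apply exp_mono, Rmult_le_compat_l; [apply Cmod_ge_0|].
      clear - Hy. induction n; simpl; [lra|]. specialize (Hy n). lra. }
    assert (Hw : (1 <= exp (Cmod z * w n))%R).
    { eapply Rle_trans; [|apply exp_ge]. pose proof (Cmod_ge_0 z).
      assert (0 <= Cmod z * w n)%R by (apply Rmult_le_pos; auto; specialize (Hx n); lra). lra. }
    assert (HX : (Cmod (1 - z * RtoC (x n)) <= exp (Cmod z * w n))%R).
    { eapply Rle_trans; [apply Cmod_factor_le, Hx|].
      apply exp_mono, Rmult_le_compat_l; [apply Cmod_ge_0 | apply Hx]. }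
    set (e := exp (Cmod z * rsum w n)) in *. set (e' := exp (Cmod z * w n)) in *.
    assert (He : (0 < e)%R) by apply exp_pos.
    assert (T1 : (Cmod (P - Q) * Cmod (1 - z * RtoC (x n)) <= Cmod z * D * e * e')%R).
    { apply Rmult_le_compat; auto using Cmod_ge_0. }
    assert (T2 : (Cmod Q * (Cmod z * Rabs (x n - y n)) <= e * (Cmod z * Rabs (x n - y n)))%R).
    { apply Rmult_le_compat_r; auto. apply Rmult_le_pos; [apply Cmod_ge_0 | apply Rabs_pos]. }
    assert (T3 : (e * (Cmod z * Rabs (x n - y n)) <= e * (Cmod z * Rabs (x n - y n)) * e')%R).
    { rewrite <- (Rmult_1_r (e * (Cmod z * Rabs (x n - y n)))) at 1.
      apply Rmult_le_compat_l; auto. apply Rmult_le_pos; [lra|].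
      apply Rmult_le_pos; [apply Cmod_ge_0 | apply Rabs_pos]. }
    lra.
Qed.

Lemma lin_prod_zero (z : C) (n : nat) : lin_prod (fun _ => 0%R) z n = 1.
Proof. unfold lin_prod. induction n; cbn [Cprod]; [auto|]. rewrite IHn. ring. Qed.

Lemma rsum_ext (x y : nat -> R) (n : nat) : (forall j, x j = y j) -> rsum x n = rsum y n.
Proof. intro H. induction n; simpl; auto. now rewrite IHn, H. Qed.

Lemma lin_prod_minus_1_le (x : nat -> R) (z : C) (n : nat) : (forall j, 0 <= x j)%R ->
  (Cmod (lin_prod x z n - 1) <= Cmod z * rsum x n * exp (Cmod z * rsum x n))%R.
Proof.
  intro H. rewrite <- (lin_prod_zero z n).
  rewrite (rsum_ext x (fun j => Rabs (x j - 0)) n) at 1.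
  - apply (lin_prod_diff_le x (fun _ => 0%R) x); intro j; specialize (H j); lra.
  - intro j. rewrite Rminus_0_r, Rabs_pos_eq; auto.
Qed.

Definition summable (x : nat -> R) : Prop := (forall j, 0 <= x j)%R /\ ex_series x.

Lemma lin_prod_bounded (x : nat -> R) (z : C) (n : nat) : summable x ->
  (Cmod (lin_prod x z n) <= exp (Cmod z * Series x))%R.
Proof.
  intros [H Hx]. eapply Rle_trans; [now apply lin_prod_Cmod_le|].
  apply exp_mono, Rmult_le_compat_l; [apply Cmod_ge_0 | now apply rsum_le_Series].
Qed.

Lemma inf_prod_clim (x : nat -> R) (z : C) : summable x -> clim (lin_prod x z) (inf_prod x z).
Proof.
  intro H. destruct (clim_of_summable_steps (lin_prod x z)) as [l Hl].
  - apply abs_summable_le with (fun n => (Cmod z * exp (Cmod z * Series x) * x n)%R).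
    + intro n. unfold lin_prod at 1. cbn [Cprod]. fold (lin_prod x z n).
      replace (lin_prod x z n * (1 - z * RtoC (x n)) - lin_prod x z n) with
        (- (z * lin_prod x z n * RtoC (x n))) by ring.
      rewrite Cmod_opp, !Cmod_mult, Cmod_R, Rabs_pos_eq by apply H.
      apply Rmult_le_compat_r; [apply H|].
      apply Rmult_le_compat_l; [apply Cmod_ge_0 | now apply lin_prod_bounded].
    + apply ex_series_Rscal, H.
  - unfold inf_prod. now rewrite (clim_Clim_seq _ _ Hl).
Qed.

Lemma inf_prod_bounded (x : nat -> R) (z : C) : summable x ->
  (Cmod (inf_prod x z) <= exp (Cmod z * Series x))%R.
Proof.
  intro H. apply (clim_Cmod_le (lin_prod x z)); [now apply inf_prod_clim|].
  intro n. now apply lin_prod_bounded.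
Qed.

Lemma inf_prod_minus_1_le (x : nat -> R) (z : C) : summable x ->
  (Cmod (inf_prod x z - 1) <= Cmod z * Series x * exp (Cmod z * Series x))%R.
Proof.
  intros [H Hx]. apply (clim_Cmod_le (fun n => lin_prod x z n - 1)).
  - apply clim_minus; [now apply inf_prod_clim | apply clim_const].
  - intro n. eapply Rle_trans; [now apply lin_prod_minus_1_le|].
    pose proof (rsum_le_Series x n H Hx). pose proof (rsum_nonneg x n H).
    pose proof (Cmod_ge_0 z).
    apply Rmult_le_compat; [now apply Rmult_le_pos | left; apply exp_pos | |].
    + now apply Rmult_le_compat_l.
    + apply exp_mono. now apply Rmult_le_compat_l.
Qed.

Lemma lin_prod_split (x : nat -> R) (z : C) (m n : nat) :
  lin_prod x z (n + m) = lin_prod x z m * lin_prod (fun j => x (m + j)%nat) z n.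
Proof.
  unfold lin_prod. induction n; cbn [Cprod Nat.add]; [ring|].
  rewrite IHn. rewrite (Nat.add_comm m n). ring.
Qed.

Lemma summable_tail (x : nat -> R) (m : nat) : summable x -> summable (fun j => x (m + j)%nat).
Proof.
  intros [H Hx]. split; auto. now apply (ex_series_incr_n x m).
Qed.

Lemma Series_tail_small (x : nat -> R) (e : R) : summable x -> (0 < e)%R ->
  exists m, forall n, (m <= n)%nat -> (Series (fun j => x (n + j)%nat) < e)%R.
Proof.
  intros [H Hx] He.
  pose proof (is_lim_seq_rsum x Hx) as K. apply is_lim_seq_spec in K.
  destruct (K (mkposreal e He)) as [m Hm]. exists (S m). intros n Hn.
  specialize (Hm n ltac:(lia)). simpl in Hm. apply Rabs_lt_between in Hm.
  destruct n as [|n]; [lia|].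
  assert (E : Series x = (sum_f_R0 x n + Series (fun j => x (S n + j)%nat))%R)
    by (apply (Series_incr_n x (S n)); [lia | exact Hx]).
  rewrite rsum_S, sum_n_Reals in Hm. lra.
Qed.

Lemma inf_prod_split (x : nat -> R) (z : C) (m : nat) : summable x ->
  inf_prod x z = lin_prod x z m * inf_prod (fun j => x (m + j)%nat) z.
Proof.
  intro H. apply clim_unique with (fun n => lin_prod x z (n + m)).
  - apply (clim_incr_n (lin_prod x z)). now apply inf_prod_clim.
  - apply clim_ext with (fun n => lin_prod x z m * lin_prod (fun j => x (m + j)%nat) z n).
    + intro n. now rewrite lin_prod_split.
    + apply clim_scal, inf_prod_clim. now apply summable_tail.
Qed.

Lemma lin_prod_eq_0 (x : nat -> R) (z : C) (n : nat) :
  lin_prod x z n = 0 <-> exists j, (j < n)%nat /\ 1 - z * RtoC (x j) = 0.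
Proof.
  unfold lin_prod. induction n; cbn [Cprod].
  - split; [intro H; apply RtoC_inj in H; lra | intros (j & Hj & _); lia].
  - split.
    + intro H. apply Cmult_neq_0_or in H. destruct H as [H|H].
      * apply IHn in H. destruct H as (j & Hj & E). exists j. split; auto.
      * exists n. auto.
    + intros (j & Hj & E). destruct (Nat.eq_dec j n) as [->|Hn].
      * rewrite E. ring.
      * rewrite (proj2 IHn); [ring|]. exists j. split; auto. lia.
Qed.

(** The threshold depends on [z] and [e] alone, so one choice works for all tails of a product and
    for the products attached to all [J^[m]]. *)
Lemma inf_prod_near_1 (z : C) (e : R) : (0 < e)%R ->
  exists s, (0 < s)%R /\ forall y, summable y -> (Series y < s)%R ->
    (Cmod (inf_prod y z - 1) < e)%R.
Proof.
  intros He. set (c := (Cmod z * exp (Cmod z) + 1)%R).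
  pose proof (Cmod_ge_0 z). pose proof (exp_pos (Cmod z)).
  assert (Hc : (0 < c)%R) by (unfold c; nra).
  exists (Rmin 1 (e / c)). split.
  - apply Rmin_pos; [lra | now apply Rdiv_lt_0_compat].
  - intros y Hy Hs. eapply Rle_lt_trans; [now apply inf_prod_minus_1_le|].
    pose proof (Rmin_l 1 (e / c)). pose proof (Rmin_r 1 (e / c)).
    assert (Hy0 : (0 <= Series y)%R) by (apply Series_nonneg; apply Hy).
    assert (E1 : (exp (Cmod z * Series y) <= exp (Cmod z))%R).
    { apply exp_mono. rewrite <- (Rmult_1_r (Cmod z)) at 2. apply Rmult_le_compat_l; lra. }
    apply Rle_lt_trans with (Series y * c)%R.
    + unfold c. rewrite Rmult_comm.
      replace (exp (Cmod z * Series y) * (Cmod z * Series y))%R with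
        (Series y * (Cmod z * exp (Cmod z * Series y)))%R by ring.
      apply Rmult_le_compat_l; auto.
      assert (Cmod z * exp (Cmod z * Series y) <= Cmod z * exp (Cmod z))%R
        by now apply Rmult_le_compat_l. lra.
    + apply Rmult_lt_reg_r with (/ c)%R; [now apply Rinv_0_lt_compat|].
      rewrite Rmult_assoc, Rinv_r, Rmult_1_r by lra. unfold Rdiv in *. lra.
Qed.

(** Split off a finite head whose tail is at distance less than 1 from 1, hence nonzero; a zero of
    the product is then a zero of the head. *)
Lemma inf_prod_eq_0 (x : nat -> R) (z : C) : summable x ->
  inf_prod x z = 0 <-> exists j, 1 - z * RtoC (x j) = 0.
Proof.
  intro H. split.
  - intro H0.
    destruct (inf_prod_near_1 z 1) as (s & Hs & Hy); [lra|].
    destruct (Series_tail_small x s H Hs) as [m Hm].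
    rewrite (inf_prod_split x z m) in H0 by auto.
    apply Cmult_neq_0_or in H0. destruct H0 as [H0|H0].
    + apply lin_prod_eq_0 in H0. destruct H0 as (j & _ & E). now exists j.
    + specialize (Hy _ (summable_tail x m H) (Hm m (le_n m))).
      rewrite H0 in Hy. replace (0 - 1) with (- (1)) in Hy by ring.
      rewrite Cmod_m1 in Hy. lra.
  - intros (j & E). rewrite (inf_prod_split x z (S j)) by auto.
    rewrite (proj2 (lin_prod_eq_0 x z (S j))); [ring|]. exists j. auto.
Qed.

(** A zero entry deletes its factor without renumbering the others. *)
Definition omit (j : nat) (x : nat -> R) : nat -> R := fun i => if Nat.eqb i j then 0%R else x i.

Lemma summable_omit (j : nat) (x : nat -> R) : summable x -> summable (omit j x).
Proof.
  intros [H Hx].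
  assert (K : forall i, (0 <= omit j x i <= x i)%R).
  { intro i. unfold omit. specialize (H i). destruct (Nat.eqb i j); lra. }
  split; [intro; apply K|]. now apply ex_series_le_R with x.
Qed.

Lemma inf_prod_omit (x : nat -> R) (z : C) (j : nat) : summable x ->
  inf_prod x z = (1 - z * RtoC (x j)) * inf_prod (omit j x) z.
Proof.
  intro H. apply clim_unique with (fun n => lin_prod x z (n + S j)).
  - apply (clim_incr_n (lin_prod x z)). now apply inf_prod_clim.
  - apply clim_ext with (fun n => (1 - z * RtoC (x j)) * lin_prod (omit j x) z (n + S j)).
    + intro n. unfold lin_prod. induction n.
      * cbn [Nat.add Cprod]. unfold omit at 2. rewrite Nat.eqb_refl.
        assert (E : forall q, (q <= j)%nat -> Cprod (fun i => 1 - z * RtoC (omit j x i)) q =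
          Cprod (fun i => 1 - z * RtoC (x i)) q).
        { induction q; intro Hq; cbn [Cprod]; auto. rewrite IHq by lia.
          unfold omit. destruct (Nat.eqb_spec q j); [lia | auto]. }
        rewrite E by auto. ring.
      * cbn [Nat.add Cprod]. rewrite <- IHn. unfold omit at 2.
        destruct (Nat.eqb_spec (n + S j) j); [lia|]. ring.
    + apply clim_scal. apply (clim_incr_n (lin_prod (omit j x) z)).
      apply inf_prod_clim. now apply summable_omit.
Qed.

(** * Holomorphy of canonical products *)

Fixpoint lin_prod_deriv (x : nat -> R) (z : C) (n : nat) : C :=
  match n with
  | O => 0
  | S m => lin_prod_deriv x z m * (1 - z * RtoC (x m)) - RtoC (x m) * lin_prod x z m
  end.

Lemma lin_prod_S (x : nat -> R) (z : C) (n : nat) :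
  lin_prod x z (S n) = lin_prod x z n * (1 - z * RtoC (x n)).
Proof. reflexivity. Qed.

Lemma Cmod_RtoC_nonneg (t : R) : (0 <= t)%R -> Cmod (RtoC t) = t.
Proof. intro H. now rewrite Cmod_R, Rabs_pos_eq. Qed.

Lemma lin_prod_increment_le (x : nat -> R) (z k : C) (n : nat) : (forall j, 0 <= x j)%R ->
  (Cmod (lin_prod x (z + k) n - lin_prod x z n) <=
    Cmod k * rsum x n * exp ((Cmod z + Cmod k) * rsum x n))%R.
Proof.
  intro H. induction n.
  - unfold lin_prod. simpl. replace (1 - 1) with (RtoC 0) by ring. rewrite Cmod_0. lra.
  - rewrite !lin_prod_S. cbn [rsum].
    replace (lin_prod x (z + k) n * (1 - (z + k) * RtoC (x n)) -
      lin_prod x z n * (1 - z * RtoC (x n))) with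
      ((lin_prod x (z + k) n - lin_prod x z n) * (1 - (z + k) * RtoC (x n))
       - k * RtoC (x n) * lin_prod x z n) by ring.
    eapply Rle_trans; [apply Cmod_minus_le|].
    rewrite !Cmod_mult, (Cmod_RtoC_nonneg (x n)) by auto.
    pose proof (Cmod_ge_0 z) as Hz. pose proof (Cmod_ge_0 k) as Hk.
    pose proof (rsum_nonneg x n H) as Hs. pose proof (H n) as Hn.
    set (R0 := (Cmod z + Cmod k)%R) in *.
    rewrite (Rmult_plus_distr_l R0), exp_plus.
    assert (HX : (Cmod (1 - (z + k) * RtoC (x n)) <= exp (R0 * x n))%R).
    { eapply Rle_trans; [now apply Cmod_factor_le|]. apply exp_mono.
      apply Rmult_le_compat_r; auto. apply Cmod_triangle. }
    assert (HP : (Cmod (lin_prod x z n) <= exp (R0 * rsum x n) * exp (R0 * x n))%R).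
    { rewrite <- exp_plus. eapply Rle_trans; [now apply lin_prod_Cmod_le|].
      apply exp_mono. unfold R0. nra. }
    set (e := exp (R0 * rsum x n)) in *. set (e' := exp (R0 * x n)) in *.
    assert (He : (0 < e)%R) by apply exp_pos. assert (He' : (0 < e')%R) by apply exp_pos.
    apply Rle_trans with (Cmod k * rsum x n * e * e' + Cmod k * x n * (e * e'))%R; [|lra].
    apply Rplus_le_compat.
    + apply Rmult_le_compat; auto using Cmod_ge_0.
    + apply Rmult_le_compat_l; auto. now apply Rmult_le_pos.
Qed.

(** Second order Taylor estimate by the product rule. The bound depends on [n] only through the
    partial sum of [x], so it survives the limit and yields the derivative of the infinite
    product. *)
Lemma lin_prod_remainder_le (x : nat -> R) (z k : C) (n : nat) : (forall j, 0 <= x j)%R ->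
  (Cmod (lin_prod x (z + k) n - lin_prod x z n - k * lin_prod_deriv x z n) <=
    Cmod k ^ 2 * rsum x n ^ 2 * exp ((Cmod z + Cmod k) * rsum x n))%R.
Proof.
  intro H. induction n.
  - unfold lin_prod. simpl. replace (1 - 1 - k * 0) with (RtoC 0) by ring. rewrite Cmod_0. lra.
  - rewrite !lin_prod_S. cbn [rsum lin_prod_deriv].
    set (P := lin_prod x (z + k) n) in *. set (Q := lin_prod x z n) in *.
    set (Q' := lin_prod_deriv x z n) in *.
    replace (P * (1 - (z + k) * RtoC (x n)) - Q * (1 - z * RtoC (x n)) -
      k * (Q' * (1 - z * RtoC (x n)) - RtoC (x n) * Q)) with
      ((P - Q - k * Q') * (1 - z * RtoC (x n)) - k * RtoC (x n) * (P - Q)) by ring.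
    eapply Rle_trans; [apply Cmod_minus_le|].
    rewrite !Cmod_mult, (Cmod_RtoC_nonneg (x n)) by auto.
    pose proof (Cmod_ge_0 z) as Hz. pose proof (Cmod_ge_0 k) as Hk.
    pose proof (rsum_nonneg x n H) as Hs. pose proof (H n) as Hn.
    pose proof (lin_prod_increment_le x z k n H) as HD. fold P Q in HD.
    set (R0 := (Cmod z + Cmod k)%R) in *.
    rewrite (Rmult_plus_distr_l R0), exp_plus.
    assert (HX : (Cmod (1 - z * RtoC (x n)) <= exp (R0 * x n))%R).
    { eapply Rle_trans; [now apply Cmod_factor_le|]. apply exp_mono.
      apply Rmult_le_compat_r; auto. unfold R0. lra. }
    assert (He' : (1 <= exp (R0 * x n))%R).
    { eapply Rle_trans; [|apply exp_ge]. assert (0 <= R0 * x n)%R; [|lra].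
      apply Rmult_le_pos; unfold R0; lra. }
    set (e := exp (R0 * rsum x n)) in *. set (e' := exp (R0 * x n)) in *.
    assert (He : (0 < e)%R) by apply exp_pos.
    assert (T1 : (Cmod (P - Q - k * Q') * Cmod (1 - z * RtoC (x n)) <=
      Cmod k ^ 2 * rsum x n ^ 2 * e * e')%R) by (apply Rmult_le_compat; auto using Cmod_ge_0).
    assert (T2 : (Cmod k * x n * Cmod (P - Q) <= Cmod k * x n * (Cmod k * rsum x n * e))%R).
    { apply Rmult_le_compat_l; auto. now apply Rmult_le_pos. }
    assert (T3 : (0 <= Cmod k ^ 2 * (x n * rsum x n) * e)%R).
    { apply Rmult_le_pos; [|lra]. apply Rmult_le_pos; [apply pow2_ge_0 | now apply Rmult_le_pos]. }
    assert (T4 : (Cmod k ^ 2 * (x n * rsum x n) * e <= Cmod k ^ 2 * (x n * rsum x n) * e * e')%R).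
    { rewrite <- (Rmult_1_r (Cmod k ^ 2 * (x n * rsum x n) * e)) at 1.
      now apply Rmult_le_compat_l. }
    assert (T5 : (0 <= Cmod k ^ 2 * (x n ^ 2) * e * e')%R).
    { apply Rmult_le_pos; [|lra]. apply Rmult_le_pos; [|lra].
      apply Rmult_le_pos; apply pow2_ge_0. }
    assert (T6 : (0 <= Cmod k ^ 2 * (x n * rsum x n) * e * e')%R) by lra.
    replace (Cmod k ^ 2 * (rsum x n + x n) ^ 2 * (e * e'))%R with
      (Cmod k ^ 2 * rsum x n ^ 2 * e * e' + 2 * (Cmod k ^ 2 * (x n * rsum x n) * e * e')
       + Cmod k ^ 2 * (x n ^ 2) * e * e')%R by ring.
    replace (Cmod k * x n * (Cmod k * rsum x n * e))%R with
      (Cmod k ^ 2 * (x n * rsum x n) * e)%R in T2 by ring.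
    lra.
Qed.

Lemma lin_prod_deriv_le (x : nat -> R) (z : C) (n : nat) : (forall j, 0 <= x j)%R ->
  (Cmod (lin_prod_deriv x z n) <= rsum x n * exp (Cmod z * rsum x n))%R.
Proof.
  intro H. induction n; cbn [lin_prod_deriv rsum].
  - rewrite Cmod_0. lra.
  - eapply Rle_trans; [apply Cmod_minus_le|].
    rewrite !Cmod_mult, (Cmod_RtoC_nonneg (x n)) by auto.
    pose proof (Cmod_ge_0 z) as Hz. pose proof (rsum_nonneg x n H) as Hs. pose proof (H n) as Hn.
    rewrite (Rmult_plus_distr_l (Cmod z)), exp_plus.
    pose proof (Cmod_factor_le z (x n) Hn) as HX.
    pose proof (lin_prod_Cmod_le x z n H) as HP.
    assert (He' : (1 <= exp (Cmod z * x n))%R).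
    { eapply Rle_trans; [|apply exp_ge]. assert (0 <= Cmod z * x n)%R; [|lra].
      now apply Rmult_le_pos. }
    set (e := exp (Cmod z * rsum x n)) in *. set (e' := exp (Cmod z * x n)) in *.
    assert (He : (0 < e)%R) by apply exp_pos.
    assert (T1 : (Cmod (lin_prod_deriv x z n) * Cmod (1 - z * RtoC (x n)) <=
      rsum x n * e * e')%R) by (apply Rmult_le_compat; auto using Cmod_ge_0).
    assert (T2 : (x n * Cmod (lin_prod x z n) <= x n * (e * e'))%R).
    { apply Rmult_le_compat_l; auto. eapply Rle_trans; [apply HP|].
      rewrite <- (Rmult_1_r e) at 1. apply Rmult_le_compat_l; lra. }
    lra.
Qed.

Lemma inf_prod_taylor (x : nat -> R) (z : C) : summable x ->
  exists L, forall k,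
    (Cmod (inf_prod x (z + k) - inf_prod x z - k * L) <=
     Cmod k ^ 2 * Series x ^ 2 * exp ((Cmod z + Cmod k) * Series x))%R.
Proof.
  intros H. pose proof H as [Hx Hs].
  assert (Hle : forall n, (0 <= rsum x n <= Series x)%R).
  { intro n. split; [now apply rsum_nonneg | now apply rsum_le_Series]. }
  destruct (clim_of_summable_steps (lin_prod_deriv x z)) as [L HL].
  - set (K := exp (Cmod z * Series x)).
    apply abs_summable_le with (fun n => ((Cmod z * (Series x * K) + K) * x n)%R).
    + intro n. cbn [lin_prod_deriv].
      replace (lin_prod_deriv x z n * (1 - z * RtoC (x n)) - RtoC (x n) * lin_prod x z n -
        lin_prod_deriv x z n) with
        (- ((z * lin_prod_deriv x z n + lin_prod x z n) * RtoC (x n))) by ring.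
      rewrite Cmod_opp, Cmod_mult, (Cmod_RtoC_nonneg (x n)) by auto.
      apply Rmult_le_compat_r; auto.
      eapply Rle_trans; [apply Cmod_triangle|]. apply Rplus_le_compat; [|now apply lin_prod_bounded].
      rewrite Cmod_mult. apply Rmult_le_compat_l; [apply Cmod_ge_0|].
      eapply Rle_trans; [now apply lin_prod_deriv_le|].
      apply Rmult_le_compat; [apply Hle | left; apply exp_pos | apply Hle |].
      apply exp_mono, Rmult_le_compat_l; [apply Cmod_ge_0 | apply Hle].
    + now apply ex_series_Rscal.
  - exists L. intro k.
    apply (clim_Cmod_le (fun n => lin_prod x (z + k) n - lin_prod x z n
      - k * lin_prod_deriv x z n)).
    + apply clim_minus; [apply clim_minus; now apply inf_prod_clim | now apply clim_scal].
    + intro n. eapply Rle_trans; [now apply lin_prod_remainder_le|].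
      apply Rmult_le_compat.
      * apply Rmult_le_pos; apply pow2_ge_0.
      * left. apply exp_pos.
      * apply Rmult_le_compat_l; [apply pow2_ge_0|]. apply pow_incr. apply Hle.
      * apply exp_mono, Rmult_le_compat_l; [|apply Hle].
        pose proof (Cmod_ge_0 z). pose proof (Cmod_ge_0 k). lra.
Qed.

(** * Complex differentiability *)

Lemma is_derive_C_intro (f : C -> C) (z L : C) :
  (forall e, (0 < e)%R -> exists d, (0 < d)%R /\ forall k, (Cmod k < d)%R ->
    (Cmod (f (z + k)%C - f z - k * L) <= e * Cmod k)%R) ->
  is_derive f z L.
Proof.
  intro H. split.
  - apply is_linear_scal_l.
  - intros y Hy e.
    assert (E : z = y) by exact (is_filter_lim_locally_unique (V := AbsRing_NormedModule C_AbsRing) z y Hy).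
    rewrite <- E. destruct (H e (cond_pos e)) as (d & Hd & K).
    exists (mkposreal d Hd). intros w Hw.
    change (Cmod (w - z) < d)%R in Hw.
    specialize (K (w - z) Hw).
    assert (Ew : forall v : C, z + (v - z) = v) by (intro; ring).
    rewrite (Ew w) in K. exact K.
Qed.

Lemma is_derive_C_elim (f : C -> C) (z L : C) : is_derive f z L ->
  (forall e, (0 < e)%R -> exists d, (0 < d)%R /\ forall k, (Cmod k < d)%R ->
    (Cmod (f (z + k)%C - f z - k * L) <= e * Cmod k)%R).
Proof.
  intros [_ H] e He.
  destruct (H z (fun P K => K) (mkposreal e He)) as [d Hd].
  exists d. split; [apply cond_pos|]. intros k Hk.
  specialize (Hd (z + k)).
  assert (Hb : (Cmod (z + k - z) < d)%R) by (replace (z + k - z) with k by ring; auto).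
  specialize (Hd Hb).
  change (Cmod (f (z + k)%C - f z - (z + k - z) * L) <= e * Cmod (z + k - z))%R in Hd.
  now replace (z + k - z) with k in Hd by ring.
Qed.

Lemma locally_C_Cmod (z : C) (P : C -> Prop) :
  locally z P <-> exists d, (0 < d)%R /\ forall w, (Cmod (w - z) < d)%R -> P w.
Proof.
  rewrite (locally_C z P). split.
  - intros [d Hd]. exists d. split; [apply cond_pos|]. intros w Hw. now apply Hd.
  - intros (d & Hd & H). exists (mkposreal d Hd). intros w Hw. now apply H.
Qed.

Lemma locally'_C_Cmod (z : C) (P : C -> Prop) :
  locally' z P <-> exists d, (0 < d)%R /\ forall w, (Cmod (w - z) < d)%R -> w <> z -> P w.
Proof. unfold locally', within. apply (locally_C_Cmod z (fun w => w <> z -> P w)). Qed.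

Lemma inf_prod_ex_derive (x : nat -> R) (z : C) : summable x -> ex_derive (inf_prod x) z.
Proof.
  intros H. destruct (inf_prod_taylor x z H) as [L HL]. exists L.
  apply is_derive_C_intro. intros e He.
  set (K := (Series x ^ 2 * exp ((Cmod z + 1) * Series x) + 1)%R).
  assert (H0 : (0 <= Series x)%R) by (apply Series_nonneg; apply H).
  assert (HK : (0 < K)%R).
  { pose proof (pow2_ge_0 (Series x)). pose proof (exp_pos ((Cmod z + 1) * Series x)).
    unfold K. assert (0 <= Series x ^ 2 * exp ((Cmod z + 1) * Series x))%R; [|lra].
    apply Rmult_le_pos; lra. }
  exists (Rmin 1 (e / K)). split.
  - apply Rmin_pos; [lra | now apply Rdiv_lt_0_compat].
  - intros k Hk. pose proof (Rmin_l 1 (e / K)). pose proof (Rmin_r 1 (e / K)).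
    eapply Rle_trans; [apply HL|]. pose proof (Cmod_ge_0 k) as Hk0.
    assert (E1 : (exp ((Cmod z + Cmod k) * Series x) <= exp ((Cmod z + 1) * Series x))%R).
    { apply exp_mono, Rmult_le_compat_r; lra. }
    apply Rle_trans with (Cmod k * (Cmod k * K))%R.
    + replace (Cmod k ^ 2 * Series x ^ 2 * exp ((Cmod z + Cmod k) * Series x))%R with
       (Cmod k * (Cmod k * (Series x ^ 2 * exp ((Cmod z + Cmod k) * Series x))))%R by ring.
      apply Rmult_le_compat_l; auto. apply Rmult_le_compat_l; auto.
      unfold K. assert (Series x ^ 2 * exp ((Cmod z + Cmod k) * Series x) <=
        Series x ^ 2 * exp ((Cmod z + 1) * Series x))%R; [|lra].
      apply Rmult_le_compat_l; auto. apply pow2_ge_0.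
    + rewrite (Rmult_comm e). apply Rmult_le_compat_l; auto.
      apply Rmult_le_reg_r with (/ K)%R; [now apply Rinv_0_lt_compat|].
      rewrite Rmult_assoc, Rinv_r, Rmult_1_r by lra. unfold Rdiv in *. lra.
Qed.

Lemma ex_derive_C_continuous (f : C -> C) (z : C) : ex_derive f z ->
  forall e, (0 < e)%R -> exists d, (0 < d)%R /\
    forall w, (Cmod (w - z) < d)%R -> (Cmod (f w - f z) < e)%R.
Proof.
  intros [L HL] e He.
  destruct (is_derive_C_elim f z L HL 1 Rlt_0_1) as (d & Hd & K).
  pose proof (Cmod_ge_0 L) as HL0.
  exists (Rmin d (e / (Cmod L + 1))). split.
  - apply Rmin_pos; auto. apply Rdiv_lt_0_compat; lra.
  - intros w Hw. pose proof (Rmin_l d (e / (Cmod L + 1))).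
    pose proof (Rmin_r d (e / (Cmod L + 1))).
    specialize (K (w - z) ltac:(lra)). replace (z + (w - z)) with w in K by ring.
    replace (f w - f z) with ((f w - f z - (w - z) * L) + (w - z) * L) by ring.
    eapply Rle_lt_trans; [apply Cmod_triangle|]. rewrite Cmod_mult.
    apply Rle_lt_trans with (Cmod (w - z) * (Cmod L + 1))%R; [lra|].
    apply Rmult_lt_reg_r with (/ (Cmod L + 1))%R; [apply Rinv_0_lt_compat; lra|].
    rewrite Rmult_assoc, Rinv_r, Rmult_1_r by lra. unfold Rdiv in *. lra.
Qed.

Lemma ex_derive_C_neq_0 (f : C -> C) (z : C) : ex_derive f z -> f z <> 0 ->
  exists d, (0 < d)%R /\ forall w, (Cmod (w - z) < d)%R -> f w <> 0.
Proof.
  intros Hf H0. apply Cmod_gt_0 in H0.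
  destruct (ex_derive_C_continuous f z Hf (Cmod (f z)) H0) as (d & Hd & K).
  exists d. split; auto. intros w Hw E. specialize (K w Hw). rewrite E in K.
  rewrite Cmod_sym in K. replace (f z - 0) with (f z) in K by ring. lra.
Qed.

Lemma ex_derive_C_mult (f g : C -> C) (z : C) :
  ex_derive f z -> ex_derive g z -> ex_derive (fun w => f w * g w) z.
Proof.
  intros [l [_ Hl]] [m [_ Hm]].
  (* The product rule is applied with codomain [AbsRing_NormedModule C_AbsRing]. The error estimates
     for the two structures are convertible; only linearity is proved afresh. *)
  assert (Hl' : is_derive (K := C_AbsRing) (V := AbsRing_NormedModule C_AbsRing) f z l)
    by (split; [apply (is_linear_scal_l (V := AbsRing_NormedModule C_AbsRing)) | exact Hl]).
  assert (Hm' : is_derive (K := C_AbsRing) (V := AbsRing_NormedModule C_AbsRing) g z m)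
    by (split; [apply (is_linear_scal_l (V := AbsRing_NormedModule C_AbsRing)) | exact Hm]).
  destruct (is_derive_mult f g z l m Hl' Hm' Cmult_comm) as [_ K].
  exists (l * g z + f z * m). split; [apply is_linear_scal_l | exact K].
Qed.

Lemma ex_derive_C_inv (f : C -> C) (z : C) :
  ex_derive f z -> f z <> 0 -> ex_derive (fun w => / f w) z.
Proof.
  intros [L HL] H0. exists (- L / (f z * f z)).
  assert (Hf : ex_derive f z) by now exists L.
  pose proof (proj1 (Cmod_gt_0 (f z)) H0) as Hm. set (m := Cmod (f z)) in *.
  pose proof (Cmod_ge_0 L) as HL0.
  apply is_derive_C_intro. intros e He.
  (* [1/f(z+k) - 1/f(z) + k L/f(z)^2 =
      (- (f(z+k) - f(z) - k L) + k L (f(z+k) - f(z)) / f(z)) / (f(z+k) f(z))] *)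
  set (e1 := (e * m ^ 2 / 4)%R). set (e2 := (e * m ^ 3 / (4 * (Cmod L + 1)))%R).
  assert (He1 : (0 < e1)%R).
  { unfold e1. apply Rdiv_lt_0_compat; [|lra]. apply Rmult_lt_0_compat; auto. now apply pow_lt. }
  assert (He2 : (0 < e2)%R).
  { unfold e2. apply Rdiv_lt_0_compat; [|lra]. apply Rmult_lt_0_compat; auto. now apply pow_lt. }
  destruct (is_derive_C_elim f z L HL e1 He1) as (d1 & Hd1 & K1).
  destruct (ex_derive_C_continuous f z Hf (Rmin e2 (m / 2))) as (d2 & Hd2 & K2).
  { apply Rmin_pos; lra. }
  exists (Rmin d1 d2). split; [now apply Rmin_pos|]. intros k Hk.
  pose proof (Rmin_l d1 d2). pose proof (Rmin_r d1 d2).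
  specialize (K1 k ltac:(lra)). specialize (K2 (z + k)).
  replace (z + k - z) with k in K2 by ring. specialize (K2 ltac:(lra)).
  pose proof (Rmin_l e2 (m / 2)). pose proof (Rmin_r e2 (m / 2)).
  assert (Hfk : (m / 2 < Cmod (f (z + k)%C))%R).
  { pose proof (Cmod_triangle_inv (f (z + k)) (f z)) as T. apply Rabs_le_between in T.
    fold m in T. lra. }
  assert (H0k : f (z + k) <> 0) by (apply Cmod_gt_0; lra).
  replace (/ f (z + k) - / f z - k * (- L / (f z * f z))) with
    ((k * L * (f (z + k) - f z) / f z - (f (z + k) - f z - k * L)) / (f (z + k) * f z))
    by (field; auto).
  rewrite Cmod_div by (intro E; apply Cmult_neq_0_or in E; tauto).
  rewrite Cmod_mult. fold m.
  apply Rmult_le_reg_r with (Cmod (f (z + k)%C) * m)%R; [apply Rmult_lt_0_compat; lra|].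
  unfold Rdiv. rewrite Rmult_assoc, Rinv_l, Rmult_1_r.
  2: { apply Rgt_not_eq, Rlt_gt, Rmult_lt_0_compat; lra. }
  eapply Rle_trans; [apply Cmod_minus_le|]. rewrite Cmod_div, !Cmod_mult by auto. fold m.
  pose proof (Cmod_ge_0 k) as Hk0.
  assert (T1 : (Cmod k * Cmod L * Cmod (f (z + k)%C - f z) / m <= Cmod k * (e * m ^ 2 / 4))%R).
  { apply Rmult_le_reg_r with m; auto. unfold Rdiv at 1.
    rewrite Rmult_assoc, Rinv_l, Rmult_1_r by lra.
    rewrite !Rmult_assoc. apply Rmult_le_compat_l; auto.
    apply Rle_trans with ((Cmod L + 1) * e2)%R.
    - apply Rmult_le_compat; try lra. apply Cmod_ge_0.
    - unfold e2. right. field. lra. }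
  assert (T2 : (e * Cmod k * (m / 2 * m) <= e * Cmod k * (Cmod (f (z + k)%C) * m))%R).
  { apply Rmult_le_compat_l; [apply Rmult_le_pos; lra|]. apply Rmult_le_compat_r; lra. }
  unfold e1 in K1. lra.
Qed.

(** * The limit of the normalized determinants *)

(* Growth of the vibrating string with masses [m k] and gaps [th k - th (k + 1)] at the spectral
   parameter [-x]. *)
Lemma string_growth (pi V m th : nat -> R) (x : R) :
  (0 <= x)%R -> (forall n, 0 <= m n)%R -> (forall n, 0 <= th n)%R ->
  (forall n, th (S n) <= th n)%R ->
  pi 0%nat = 1%R -> V 0%nat = (x * m 0%nat)%R ->
  (forall n, V (S n) = V n + x * (m (S n) * pi (S n)))%R ->
  (forall n, pi (S n) = pi n + (th n - th (S n)) * V n)%R ->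
  forall n, (pi n <= exp (x * rsum (fun k => m k * th k) n))%R.
Proof.
  intros Hx Hm Hth Hdec Hpi0 HV0 HVS HpiS n.
  (* With [M] the partial sums of the masses, the bound on [V n] shows that a step multiplies [pi]
     by at most [1 + x (th n - th (n+1)) M_(n+1)]. The exponent is the sum of the terms
     [(th k - th (k+1)) M_(k+1)], rearranged by Abel summation. *)
  assert (K : (1 <= pi n /\ 0 <= V n <= x * pi n * rsum m (S n) /\
    pi n <= exp (x * (rsum (fun k => m k * th k) n - th n * rsum m n)))%R).
  { induction n as [|n (I1 & [I2 I3] & I4)].
    - rewrite Hpi0, HV0. simpl rsum.
      replace (x * (0 - th 0%nat * 0))%R with 0%R by ring. rewrite exp_0.
      specialize (Hm 0%nat). assert (0 <= x * m 0%nat)%R by now apply Rmult_le_pos.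
      repeat split; lra.
    - specialize (Hdec n). specialize (HVS n). specialize (HpiS n). pose proof (Hm (S n)) as Hm'.
      assert (Hinc : (pi n <= pi (S n))%R).
      { rewrite HpiS. assert (0 <= (th n - th (S n)) * V n)%R; [apply Rmult_le_pos; lra | lra]. }
      pose proof (rsum_nonneg m (S n) Hm) as HM.
      repeat split.
      + lra.
      + rewrite HVS. assert (0 <= x * (m (S n) * pi (S n)))%R; [|lra].
        repeat apply Rmult_le_pos; lra.
      + rewrite HVS.
        change (rsum m (S (S n))) with (rsum m (S n) + m (S n))%R.
        assert (x * pi n * rsum m (S n) <= x * pi (S n) * rsum m (S n))%R.
        { apply Rmult_le_compat_r; auto. now apply Rmult_le_compat_l. }
        lra.
      + set (c := (th n - th (S n))%R) in *.
        apply Rle_trans with (pi n * (1 + x * (c * rsum m (S n))))%R.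
        { rewrite HpiS. assert (c * V n <= c * (x * pi n * rsum m (S n)))%R; [|lra].
          apply Rmult_le_compat_l; unfold c; lra. }
        replace (x * (rsum (fun k => m k * th k) (S n) - th (S n) * rsum m (S n)))%R with
          (x * (rsum (fun k => m k * th k) n - th n * rsum m n) + x * (c * rsum m (S n)))%R
          by (unfold c; simpl; ring).
        rewrite exp_plus. apply Rmult_le_compat; auto; [lra | | apply exp_ge].
        assert (0 <= x * (c * rsum m (S n)))%R; [|lra].
        repeat apply Rmult_le_pos; auto. unfold c; lra. }
  destruct K as (_ & _ & K). eapply Rle_trans; [apply K|]. apply exp_mono.
  apply Rmult_le_compat_l; auto.
  assert (0 <= th n * rsum m n)%R; [|lra].
  apply Rmult_le_pos; auto. now apply rsum_nonneg.
Qed.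

Lemma green_diag_summable (a b h : nat -> R) : green_data a b h -> summable (green_diag a b h).
Proof.
  intro G. split; [intro j; left; now apply green_diag_pos | apply G].
Qed.

(** Dividing by the solution at [z = 0] turns the three-term recurrence into a string equation: the
    masses are the squares of the first kind solution, the [th] are the Green ratios, and mass times
    [th] is [green_diag]. *)
Lemma rdet_growth (a b h : nat -> R) (x : R) (n : nat) : green_data a b h -> (0 <= x)%R ->
  (jacobi_rdet a b (- x) n <= jacobi_rdet a b 0 n * exp (x * Series (green_diag a b h)))%R.
Proof.
  intros G Hx. pose proof (green_data_rdet_pos a b h G) as Hd.
  assert (HA : forall n, (0 < aprod a n)%R) by (intro; apply aprod_pos, G).
  set (d := jacobi_rdet a b 0) in *. set (D := jacobi_rdet a b (- x)).
  assert (K : (D n / d n <= exp (x * rsum (fun k => (d k / aprod a k) ^ 2 * green_ratio a b h k) n))%R).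
  { apply (string_growth (fun n => D n / d n)%R
      (fun n => (D (S n) * d n - D n * d (S n)) / aprod a n ^ 2)%R); auto.
    - intro k. apply pow2_ge_0.
    - intro k. left. apply green_ratio_pos; apply G.
    - intro k. pose proof (green_ratio_decr a b h (gd_a _ _ _ G) (gd_h _ _ _ G) (gd_h_0 _ _ _ G)
        (gd_h_S _ _ _ G) k) as E.
      assert (0 <= aprod a k ^ 2 / (jacobi_rdet a b 0 k * jacobi_rdet a b 0 (S k)))%R; [|lra].
      apply Rdiv_le_0_compat; [apply pow2_ge_0 | apply Rmult_lt_0_compat; apply Hd].
    - unfold D, d. simpl. field.
    - unfold D, d. simpl. field.
    - intro k. change (aprod a (S k)) with (aprod a k * a k)%R.
      assert (E1 : D (S (S k)) = ((b (S k) + x) * D (S k) - a k ^ 2 * D k)%R).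
      { unfold D. simpl. ring. }
      assert (E2 : d (S (S k)) = (b (S k) * d (S k) - a k ^ 2 * d k)%R).
      { unfold d. simpl. ring. }
      rewrite E1, E2. specialize (HA k). pose proof (gd_a _ _ _ G k).
      pose proof (Hd (S k)). field. repeat split; lra.
    - intro k.
      rewrite (green_ratio_decr a b h (gd_a _ _ _ G) (gd_h _ _ _ G) (gd_h_0 _ _ _ G)
        (gd_h_S _ _ _ G) k).
      fold d. specialize (HA k). pose proof (Hd (S k)). pose proof (Hd k). field.
      repeat split; lra. }
  assert (E : rsum (fun k => (d k / aprod a k) ^ 2 * green_ratio a b h k)%R n =
    rsum (green_diag a b h) n).
  { apply rsum_ext. intro k. unfold green_ratio, green_diag. fold d.
    specialize (HA k). specialize (Hd k). field. lra. }
  rewrite E in K. specialize (Hd n).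
  apply Rmult_le_reg_r with (/ d n)%R; [now apply Rinv_0_lt_compat|].
  replace (d n * exp (x * Series (green_diag a b h)) * / d n)%R with
    (exp (x * Series (green_diag a b h))) by (field; lra).
  eapply Rle_trans; [apply K|]. apply exp_mono, Rmult_le_compat_l; auto.
  destruct (green_diag_summable a b h G). now apply rsum_le_Series.
Qed.

Lemma rsum_mono (x : nat -> R) (n m : nat) : (forall j, 0 <= x j)%R -> (n <= m)%nat ->
  (rsum x n <= rsum x m)%R.
Proof.
  intros H Hnm. induction Hnm as [|m Hnm IH]; [lra|]. simpl. specialize (H m). lra.
Qed.

(** Let [T] be the trace and evaluate at [z = - 1 / T]. One plus the sum of the reciprocal roots
    over [T] is at most the normalized determinant, and this is at most [e <= 3] by the growth
    estimate. *)
Lemma inv_roots_rsum_le (a b h : nat -> R) (n N : nat) : green_data a b h ->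
  (rsum (inv_roots a b n) N <= 2 * Series (green_diag a b h))%R.
Proof.
  intro G. set (T := Series (green_diag a b h)).
  assert (HT : (0 < T)%R).
  { eapply Rlt_le_trans; [apply (green_diag_pos a b h G 0)|].
    apply term_le_Series; apply (green_diag_summable a b h G). }
  assert (Hnn := fun j => inv_roots_nonneg a b h n j G).
  eapply Rle_trans; [apply (rsum_mono _ N (N + n)); auto; lia|].
  assert (K : forall t M, (0 <= t)%R -> exists P,
     Cprod (fun j => 1 - RtoC (- t) * RtoC (inv_roots a b n j)) M = RtoC P /\
     (1 + t * rsum (inv_roots a b n) M <= P)%R).
  { intros t M Ht. induction M as [|M (P & P1 & P2)]; cbn [Cprod rsum].
    - exists 1%R. split; auto. lra.
    - exists (P * (1 + t * inv_roots a b n M))%R. split.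
      + rewrite P1, RtoC_mult, RtoC_plus, RtoC_opp, RtoC_mult. ring.
      + specialize (Hnn M). assert (0 <= t * inv_roots a b n M)%R by now apply Rmult_le_pos.
        assert (0 <= t * rsum (inv_roots a b n) M)%R
          by (apply Rmult_le_pos; auto; apply rsum_nonneg; intro; now apply (inv_roots_nonneg a b h)).
        apply Rle_trans with ((1 + t * rsum (inv_roots a b n) M) * (1 + t * inv_roots a b n M))%R.
        * nra.
        * apply Rmult_le_compat_r; lra. }
  destruct (K (/ T)%R (N + n)%nat) as (P & P1 & P2).
  { left. now apply Rinv_0_lt_compat. }
  pose proof (jacobi_det_inv_roots a b h n (N + n) (RtoC (- / T)) G ltac:(lia)) as E.
  rewrite P1, (jacobi_det_R a b), <- RtoC_mult in E. apply RtoC_inj in E.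
  pose proof (rdet_growth a b h (/ T) n G) as Hg. fold T in Hg.
  rewrite E, Rinv_l in Hg by lra.
  assert (HP : (P <= exp 1)%R).
  { apply Rmult_le_reg_l with (jacobi_rdet a b 0 n); [now apply (green_data_rdet_pos a b h)|].
    apply Hg. left. now apply Rinv_0_lt_compat. }
  pose proof exp_le_3.
  apply Rmult_le_reg_l with (/ T)%R; [now apply Rinv_0_lt_compat|].
  replace (/ T * (2 * T))%R with 2%R by (field; lra). lra.
Qed.

(** * Limits of the reciprocal roots and their canonical product *)

Definition inv_eigenvalue (a b : nat -> R) (j : nat) : R :=
  real (Lim_seq (fun n => inv_roots a b n j)).

Definition char_fun (a b : nat -> R) (z : C) : C := inf_prod (inv_eigenvalue a b) z.

Lemma inv_roots_le_bound (a b h : nat -> R) (n j : nat) : green_data a b h ->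
  (inv_roots a b n j <= 2 * Series (green_diag a b h))%R.
Proof.
  intro G. eapply Rle_trans; [|apply (inv_roots_rsum_le a b h n (S j) G)].
  simpl. pose proof (rsum_nonneg (inv_roots a b n) j (fun i => inv_roots_nonneg a b h n i G)). lra.
Qed.

Lemma inv_eigenvalue_lim (a b h : nat -> R) (j : nat) : green_data a b h ->
  is_lim_seq (fun n => inv_roots a b n j) (inv_eigenvalue a b j).
Proof.
  intro G. destruct (ex_finite_lim_seq_incr (fun n => inv_roots a b n j)
    (2 * Series (green_diag a b h))) as [l Hl].
  - intro n. now apply (inv_roots_bottom a b h).
  - intro n. now apply inv_roots_le_bound.
  - unfold inv_eigenvalue. now rewrite (is_lim_seq_unique _ _ Hl).
Qed.

Lemma inv_roots_le_eigenvalue (a b h : nat -> R) (n j : nat) : green_data a b h ->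
  (0 <= inv_roots a b n j <= inv_eigenvalue a b j)%R.
Proof.
  intro G. split; [now apply (inv_roots_nonneg a b h)|].
  apply (is_lim_seq_incr_compare (fun n => inv_roots a b n j)).
  - now apply (inv_eigenvalue_lim a b h).
  - intro k. now apply (inv_roots_bottom a b h).
Qed.

Lemma inv_eigenvalue_pos (a b h : nat -> R) (j : nat) : green_data a b h ->
  (0 < inv_eigenvalue a b j)%R.
Proof.
  intro G. eapply Rlt_le_trans; [|apply (inv_roots_le_eigenvalue a b h (S j) j G)].
  unfold inv_roots. destruct (Nat.ltb_spec j (S j)); [|lia].
  apply Rinv_0_lt_compat, (jacobi_roots_spec a b h (S j) G). auto.
Qed.

Lemma is_lim_seq_rsum_pointwise (x : nat -> nat -> R) (y : nat -> R) (N : nat) :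
  (forall j, is_lim_seq (fun n => x n j) (y j)) ->
  is_lim_seq (fun n => rsum (x n) N) (rsum y N).
Proof.
  intro H. induction N; simpl; [apply is_lim_seq_const|]. now apply is_lim_seq_plus'.
Qed.

Lemma inv_eigenvalue_summable (a b h : nat -> R) : green_data a b h ->
  summable (inv_eigenvalue a b) /\
  (Series (inv_eigenvalue a b) <= 2 * Series (green_diag a b h))%R.
Proof.
  intro G.
  assert (Hnn : forall j, (0 <= inv_eigenvalue a b j)%R).
  { intro j. left. now apply (inv_eigenvalue_pos a b h). }
  destruct (ex_series_rsum_bounded (inv_eigenvalue a b) (2 * Series (green_diag a b h))) as [K1 K2];
    auto.
  - intro N. apply (is_lim_seq_le (fun n => rsum (inv_roots a b n) N)
      (fun _ => 2 * Series (green_diag a b h))%R (rsum (inv_eigenvalue a b) N)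
      (2 * Series (green_diag a b h))%R).
    + intro n. now apply inv_roots_rsum_le.
    + apply is_lim_seq_rsum_pointwise. intro j. now apply (inv_eigenvalue_lim a b h).
    + apply is_lim_seq_const.
  - split; auto. split; auto.
Qed.

Lemma Series_monotone_convergence (x : nat -> nat -> R) (y : nat -> R) : summable y ->
  (forall n j, 0 <= x n j <= y j)%R -> (forall n j, x n j <= x (S n) j)%R ->
  (forall j, is_lim_seq (fun n => x n j) (y j)) ->
  is_lim_seq (fun n => Series (x n)) (Series y).
Proof.
  intros [Hy Hys] Hxy Hinc Hlim.
  assert (Hxs : forall n, ex_series (x n)) by (intro n; now apply ex_series_le_R with y).
  assert (Hle : forall n, (Series (x n) <= Series y)%R).
  { intro n. now apply Series_le. }
  assert (HincS : forall n, (Series (x n) <= Series (x (S n)))%R).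
  { intro n. apply Series_le; auto. intro j. split; [apply Hxy | apply Hinc]. }
  destruct (ex_finite_lim_seq_incr (fun n => Series (x n)) (Series y)) as [L HL]; auto.
  replace (Series y) with L; auto.
  apply Rle_antisym.
  - apply (is_lim_seq_le (fun n => Series (x n)) (fun _ => Series y) L (Series y)); auto.
    apply is_lim_seq_const.
  - apply (is_lim_seq_le (rsum y) (fun _ => L) (Series y) L).
    + intro N. apply (is_lim_seq_le (fun n => rsum (x n) N) (fun _ => L) (rsum y N) L).
      * intro n. eapply Rle_trans; [apply rsum_le_Series; auto; intro; apply Hxy|].
        now apply (is_lim_seq_incr_compare (fun n => Series (x n))).
      * now apply is_lim_seq_rsum_pointwise.
      * apply is_lim_seq_const.
    + now apply is_lim_seq_rsum.
    + apply is_lim_seq_const.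
Qed.

(** The reciprocal roots increase to their limits, so the l^1 distance between the two lists is a
    difference of sums and tends to 0 by monotone convergence; it controls the distance between the
    products. *)
Lemma jacobi_det_lim (a b h : nat -> R) (z : C) : green_data a b h ->
  clim (fun n => jacobi_det a b z n / RtoC (jacobi_rdet a b 0 n)) (char_fun a b z).
Proof.
  intro G. destruct (inv_eigenvalue_summable a b h G) as [Hs _].
  set (nu := inv_eigenvalue a b) in *.
  assert (Hms : forall n, ex_series (inv_roots a b n)).
  { intro n. apply ex_series_le_R with nu; [|apply Hs]. intro j.
    now apply (inv_roots_le_eigenvalue a b h). }
  set (e := exp (Cmod z * Series nu)).
  apply clim_le with (fun n => (Cmod z * e * (Series nu - Series (inv_roots a b n)))%R).
  - intro n. set (q := jacobi_det a b z n / RtoC (jacobi_rdet a b 0 n)).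
    assert (Hq : forall M, (n <= M)%nat -> lin_prod (inv_roots a b n) z M = q).
    { intros M HM. unfold q. rewrite (jacobi_det_inv_roots a b h n M z G HM).
      unfold lin_prod. field. apply RtoC_neq_0.
      pose proof (green_data_rdet_pos a b h G n). lra. }
    apply (clim_Cmod_le (fun M => lin_prod (inv_roots a b n) z (M + n) - lin_prod nu z (M + n))).
    + apply clim_minus.
      * apply clim_ext with (fun _ => q); [|apply clim_const]. intro M. symmetry. apply Hq. lia.
      * apply (clim_incr_n (lin_prod nu z)). now apply inf_prod_clim.
    + intro M.
      eapply Rle_trans; [apply (lin_prod_diff_le (inv_roots a b n) nu nu)|].
      { intro j. now apply (inv_roots_le_eigenvalue a b h). }
      { intro j. split; [apply Hs | lra]. }
      pose proof (Cmod_ge_0 z) as Hz.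
      rewrite (Rmult_assoc _ e), (Rmult_comm e), <- Rmult_assoc.
      assert (Hd : forall j, (0 <= nu j - inv_roots a b n j)%R).
      { intro j. pose proof (inv_roots_le_eigenvalue a b h n j G). unfold nu. lra. }
      apply Rmult_le_compat.
      * apply Rmult_le_pos; auto. apply rsum_nonneg. intro. apply Rabs_pos.
      * left. apply exp_pos.
      * apply Rmult_le_compat_l; auto.
        rewrite (rsum_ext _ (fun j => nu j - inv_roots a b n j)%R).
        2: { intro j. rewrite Rabs_minus_sym, Rabs_pos_eq; auto. }
        rewrite <- Series_minus by (auto; apply Hs).
        apply rsum_le_Series; auto. apply (ex_series_minus (V := R_NormedModule)); auto. apply Hs.
      * apply exp_mono, Rmult_le_compat_l; auto. apply rsum_le_Series; apply Hs.
  - replace (Finite 0%R) with (Finite (Cmod z * e * (Series nu - Series nu))%R) by (f_equal; ring).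
    apply is_lim_seq_mult'; [apply is_lim_seq_const|].
    apply is_lim_seq_minus'; [apply is_lim_seq_const|].
    apply Series_monotone_convergence; auto.
    + intros n j. now apply (inv_roots_le_eigenvalue a b h).
    + intros n j. now apply (inv_roots_bottom a b h).
    + intro j. now apply (inv_eigenvalue_lim a b h).
Qed.

(** Divide the first row expansion by [D_(n+2)(0)]. The determinants of [J^[1]] and [J^[2]] carry
    their own normalizations, and the successive quotients of these tend to [h_0] and to its
    analogue [h_1 / (a_0 h_0)] for [J^[1]]. *)
Lemma char_fun_top (a b h : nat -> R) (z : C) : green_data a b h ->
  char_fun a b z = (RtoC (b 0%nat) - z) * RtoC (h 0%nat) * char_fun (shift a) (shift b) z
    - RtoC (a 0%nat) * RtoC (h 1%nat) * char_fun (shift (shift a)) (shift (shift b)) z.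
Proof.
  intro G. pose proof (green_data_shift a b h G) as G1.
  pose proof (green_data_shift _ _ _ G1) as G2.
  pose proof (green_data_rdet_pos a b h G) as Hd.
  pose proof (green_data_rdet_pos _ _ _ G1) as Hd1.
  pose proof (green_data_rdet_pos _ _ _ G2) as Hd2.
  assert (Hr : forall a b h, green_data a b h ->
    is_lim_seq (fun n => jacobi_rdet (shift a) (shift b) 0 n / jacobi_rdet a b 0 (S n))%R
      (h 0%nat)).
  { clear. intros a b h G.
    apply is_lim_seq_ext with (fun n => (h 0%nat - green_ratio a b h (S n))%R).
    - intro n. rewrite (rdet_shift a b h) by apply G. unfold green_ratio.
      field. pose proof (green_data_rdet_pos a b h G (S n)). lra.
    - replace (Finite (h 0%nat)) with (Finite (h 0%nat - 0)%R) by (f_equal; ring).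
      apply is_lim_seq_minus'; [apply is_lim_seq_const|].
      apply (is_lim_seq_incr_1 (green_ratio a b h)), G. }
  pose proof (Hr a b h G) as L0. apply is_lim_seq_incr_1, clim_RtoC in L0.
  pose proof (Hr _ _ _ G1) as L1. apply clim_RtoC in L1.
  pose proof (jacobi_det_lim _ _ _ z G) as C0.
  pose proof (jacobi_det_lim _ _ _ z G1) as C1.
  pose proof (jacobi_det_lim _ _ _ z G2) as C2.
  apply (clim_incr_n _ _ 2) in C0. apply (clim_incr_n _ _ 1) in C1.
  assert (Ha : RtoC (a 0%nat) <> 0).
  { apply RtoC_neq_0. pose proof (gd_a _ _ _ G 0%nat). lra. }
  assert (Hh : RtoC (h 0%nat) <> 0).
  { apply RtoC_neq_0. pose proof (gd_h _ _ _ G 0%nat). lra. }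
  replace (RtoC (a 0%nat) * RtoC (h 1%nat)) with
    (RtoC (a 0%nat ^ 2) * (RtoC (shift_h a h 0%nat) * RtoC (h 0%nat))).
  2: { unfold shift_h. rewrite RtoC_div, RtoC_mult.
       - rewrite RtoC_pow. field. auto.
       - pose proof (gd_a _ _ _ G 0%nat). pose proof (gd_h _ _ _ G 0%nat).
         apply Rgt_not_eq, Rlt_gt. now apply Rmult_lt_0_compat. }
  apply clim_unique with (1 := C0).
  eapply clim_ext.
  2: { apply clim_minus.
       - apply clim_mult; [apply clim_scal, L0 | apply C1].
       - apply clim_mult; [apply clim_scal, clim_mult; [apply L1 | apply L0] | apply C2]. }
  intro n. cbv beta. rewrite Nat.add_1_r. replace (n + 2)%nat with (S (S n)) by lia.
  rewrite (jacobi_det_top a b z n).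
  assert (E : forall t, (0 < t)%R -> RtoC t <> 0) by (intros; apply RtoC_neq_0; lra).
  pose proof (Hd (S (S n))). pose proof (Hd1 (S n)). pose proof (Hd2 n).
  rewrite !RtoC_div by lra. field. repeat split; auto.
Qed.

(** * Iterated shifts and the decaying solution *)

(** Convertible with the sequences in [jacobi_operator_from]. *)
Definition shifts {T : Type} (m : nat) (u : nat -> T) : nat -> T := fun n => u (m + n)%nat.

Fixpoint shifts_h (m : nat) (a h : nat -> R) : nat -> R :=
  match m with O => h | S k => shifts_h k (shift a) (shift_h a h) end.

Lemma shift_shifts {T : Type} (m : nat) (u : nat -> T) : shift (shifts m u) = shifts (S m) u.
Proof.
  apply functional_extensionality. intro n. unfold shift, shifts. f_equal. lia.
Qed.

Lemma green_data_shifts (m : nat) : forall a b h, green_data a b h ->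
  green_data (shifts m a) (shifts m b) (shifts_h m a h).
Proof.
  induction m; intros a b h G; [exact G|].
  exact (IHm _ _ _ (green_data_shift a b h G)).
Qed.

(** Each removal divides by the current [a_0 h_0]; these factors telescope and only the last
    normalization remains. *)
Lemma shifts_h_S (m : nat) : forall a b h k, green_data a b h ->
  (shifts_h (S m) a h k = h (S m + k)%nat / (a m * h m))%R.
Proof.
  induction m; intros a b h k G; [reflexivity|].
  change (shifts_h (S (S m)) a h k) with (shifts_h (S m) (shift a) (shift_h a h) k).
  rewrite (IHm _ _ _ k (green_data_shift a b h G)). unfold shift, shift_h.
  change (S (S m + k))%nat with (S (S m) + k)%nat.
  pose proof (gd_a _ _ _ G 0%nat). pose proof (gd_a _ _ _ G (S m)).
  pose proof (gd_h _ _ _ G 0%nat). pose proof (gd_h _ _ _ G (S m)).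
  field. repeat split; lra.
Qed.

Lemma green_diag_shifts_le (m : nat) : forall a b h j, green_data a b h ->
  (0 <= green_diag (shifts m a) (shifts m b) (shifts_h m a h) j
     <= green_diag a b h (m + j)%nat)%R.
Proof.
  induction m; intros a b h j G.
  - split; [left; now apply green_diag_pos | apply Rle_refl].
  - destruct (IHm _ _ _ j (green_data_shift a b h G)) as [K1 K2]. split; [exact K1|].
    eapply Rle_trans; [exact K2|]. now apply green_diag_shift_le.
Qed.

Lemma green_trace_shifts_le (m : nat) (a b h : nat -> R) : green_data a b h ->
  (Series (green_diag (shifts m a) (shifts m b) (shifts_h m a h))
    <= Series (fun j => green_diag a b h (m + j)%nat))%R.
Proof.
  intro G. apply Series_le.
  - intro j. now apply green_diag_shifts_le.
  - apply (summable_tail _ m), green_diag_summable, G.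
Qed.

Lemma Series_tail_le (x : nat -> R) (m : nat) : summable x ->
  (Series (fun j => x (m + j)%nat) <= Series x)%R.
Proof.
  intros [H Hx]. destruct m; [apply Rle_refl|].
  rewrite (Series_incr_n x (S m)); [|lia|auto]. simpl pred.
  rewrite <- sum_n_Reals, <- rsum_S. pose proof (rsum_nonneg x (S m) H). lra.
Qed.

Lemma char_fun_shifts_bounded (m : nat) (a b h : nat -> R) (z : C) : green_data a b h ->
  (Cmod (char_fun (shifts m a) (shifts m b) z) <=
    exp (Cmod z * (2 * Series (green_diag a b h))))%R.
Proof.
  intro G. pose proof (green_data_shifts m a b h G) as Gm.
  destruct (inv_eigenvalue_summable _ _ _ Gm) as [K1 K2].
  eapply Rle_trans; [apply inf_prod_bounded, K1|].
  apply exp_mono, Rmult_le_compat_l; [apply Cmod_ge_0|].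
  eapply Rle_trans; [apply K2|]. apply Rmult_le_compat_l; [lra|].
  eapply Rle_trans; [now apply green_trace_shifts_le|].
  apply Series_tail_le, green_diag_summable, G.
Qed.

(** The trace attached to [J^[n]] is at most a tail of the trace of [J], so for large [n] the
    product is close to 1. *)
Lemma char_fun_shifts_neq_0 (a b h : nat -> R) (z : C) : green_data a b h ->
  exists m, forall n, (m <= n)%nat -> char_fun (shifts n a) (shifts n b) z <> 0.
Proof.
  intro G. destruct (inf_prod_near_1 z 1) as (s & Hs & Hy); [lra|].
  destruct (Series_tail_small (green_diag a b h) (s / 2) (green_diag_summable a b h G))
    as [m Hm]; [lra|].
  exists m. intros n Hn E.
  pose proof (green_data_shifts n a b h G) as Gn.
  destruct (inv_eigenvalue_summable _ _ _ Gn) as [K1 K2].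
  specialize (Hy _ K1). specialize (Hm n Hn). pose proof (green_trace_shifts_le n a b h G).
  unfold char_fun in E. rewrite E in Hy.
  replace (0 - 1) with (- (1)) in Hy by ring. rewrite Cmod_m1 in Hy. lra.
Qed.

Definition decaying (a b h : nat -> R) (z : C) : vec :=
  fun k => RtoC (sgn k * h k) * char_fun (shifts (S k) a) (shifts (S k) b) z.

(** Row 0 is [char_fun_top] itself; row [m + 1] is its instance for [J^[m+1]], whose normalization
    [a_m h_m] cancels. *)
Lemma jacobi_action_decaying (a b h : nat -> R) (z : C) (n : nat) : green_data a b h ->
  jacobi_action a b (decaying a b h z) n =
  z * decaying a b h z n + char_fun a b z * basis 0 n.
Proof.
  intro G. destruct n as [|m]; unfold decaying, basis.
  - rewrite (char_fun_top a b h z G).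
    change (shift a) with (shifts 1 a). change (shift b) with (shifts 1 b).
    change (shift (shifts 1 a)) with (shifts 2 a). change (shift (shifts 1 b)) with (shifts 2 b).
    simpl jacobi_action. simpl Nat.eqb. rewrite sgn_S. unfold sgn.
    simpl pow. rewrite !RtoC_mult, RtoC_opp. ring.
  - pose proof (green_data_shifts (S m) a b h G) as Gm.
    pose proof (char_fun_top _ _ _ z Gm) as E. rewrite !shift_shifts in E.
    rewrite !(shifts_h_S m a b h _ G) in E.
    replace (shifts (S m) b 0%nat) with (b (S m)) in E by (unfold shifts; f_equal; lia).
    replace (shifts (S m) a 0%nat) with (a (S m)) in E by (unfold shifts; f_equal; lia).
    replace (S m + 0)%nat with (S m) in E by lia.
    replace (S m + 1)%nat with (S (S m)) in E by lia.
    assert (Ha : RtoC (a m) <> 0).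
    { apply RtoC_neq_0. pose proof (gd_a _ _ _ G m). lra. }
    assert (Hh : RtoC (h m) <> 0).
    { apply RtoC_neq_0. pose proof (gd_h _ _ _ G m). lra. }
    assert (Hah : (a m * h m <> 0)%R).
    { apply Rgt_not_eq, Rlt_gt, Rmult_lt_0_compat; apply G. }
    rewrite !RtoC_div, RtoC_mult in E by auto.
    simpl jacobi_action. simpl Nat.eqb. rewrite E, !sgn_S.
    rewrite !RtoC_mult, !RtoC_opp. field. auto.
Qed.

Lemma green_ratio_le (a b h : nat -> R) (n m : nat) : green_data a b h -> (n <= m)%nat ->
  (green_ratio a b h m <= green_ratio a b h n)%R.
Proof.
  intros G Hnm. induction Hnm as [|m Hnm IH]; [lra|]. eapply Rle_trans; [|apply IH].
  pose proof (green_ratio_decr a b h (gd_a _ _ _ G) (gd_h _ _ _ G) (gd_h_0 _ _ _ G)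
    (gd_h_S _ _ _ G) m) as E.
  pose proof (green_data_rdet_pos a b h G).
  assert (0 <= aprod a m ^ 2 / (jacobi_rdet a b 0 m * jacobi_rdet a b 0 (S m)))%R; [|lra].
  apply Rdiv_le_0_compat; [apply pow2_ge_0 | now apply Rmult_lt_0_compat].
Qed.

(** [h_n^2] is the Green ratio times the Green diagonal; the first factor is bounded by its initial
    value and the second is summable. *)
Lemma ell2_alternating (a b h : nat -> R) : green_data a b h -> ell2 (alternating h).
Proof.
  intro G. apply ex_series_le_R with (fun n => green_ratio a b h 0 * green_diag a b h n)%R.
  - intro n. split; [apply pow2_ge_0|]. unfold alternating.
    rewrite Cmod_R, Rabs_mult, Rabs_sgn, Rmult_1_l, Rabs_pos_eq by (left; apply G).
    apply Rle_trans with (green_ratio a b h n * green_diag a b h n)%R.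
    + right. unfold green_ratio, green_diag.
      pose proof (green_data_rdet_pos a b h G n). pose proof (aprod_pos a n (gd_a _ _ _ G)).
      field. lra.
    + apply Rmult_le_compat_r; [left; now apply green_diag_pos|].
      apply green_ratio_le; auto. lia.
  - apply ex_series_Rscal, G.
Qed.

Lemma decaying_Cmod_le (a b h : nat -> R) (z : C) (k : nat) : green_data a b h ->
  (Cmod (decaying a b h z k) <= exp (Cmod z * (2 * Series (green_diag a b h))) * h k)%R.
Proof.
  intro G. unfold decaying.
  rewrite Cmod_mult, Cmod_R, Rabs_mult, Rabs_sgn, Rmult_1_l, Rabs_pos_eq by (left; apply G).
  rewrite Rmult_comm. apply Rmult_le_compat_r; [left; apply G|].
  now apply char_fun_shifts_bounded.
Qed.

Lemma ell2_decaying (a b h : nat -> R) (z : C) : green_data a b h -> ell2 (decaying a b h z).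
Proof.
  intro G.
  apply ell2_le_ell2 with (alternating h) (exp (Cmod z * (2 * Series (green_diag a b h)))).
  - intro n. unfold alternating.
    rewrite Cmod_R, Rabs_mult, Rabs_sgn, Rmult_1_l, Rabs_pos_eq by (left; apply G).
    now apply decaying_Cmod_le.
  - now apply (ell2_alternating a b).
Qed.

Lemma decaying_neq_vzero (a b h : nat -> R) (z : C) : green_data a b h ->
  decaying a b h z <> vzero.
Proof.
  intros G E. destruct (char_fun_shifts_neq_0 a b h z G) as [m Hm].
  assert (K : decaying a b h z m = 0) by (rewrite E; reflexivity).
  unfold decaying in K. apply Cmult_neq_0_or in K. destruct K as [K|K].
  - apply RtoC_inj in K. apply Rmult_integral in K. pose proof (sgn_sq m) as K2.
    pose proof (gd_h _ _ _ G m). destruct K as [K|K]; [rewrite K in K2|]; lra.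
  - apply (Hm (S m)); auto.
Qed.

(** Since no [a_n] vanishes, the recurrence determines a solution by its entry at index 0. *)
Lemma eigenvector_eq_vzero (a b : nat -> R) (z : C) (u : vec) : (forall n, 0 < a n)%R ->
  (forall n, jacobi_action a b u n = z * u n) -> u 0%nat = 0 -> u = vzero.
Proof.
  intros Ha H H0. apply functional_extensionality.
  assert (Hne : forall n, RtoC (a n) <> 0).
  { intro n. apply RtoC_neq_0. specialize (Ha n). lra. }
  intro n. unfold vzero. induction n as [| |n IH1 IH2] using two_step_ind; auto.
  - specialize (H 0%nat). simpl in H. rewrite H0 in H.
    replace (u 1%nat) with (/ RtoC (a 0%nat) * (RtoC (b 0%nat) * 0 + RtoC (a 0%nat) * u 1%nat))
      by (field; auto).
    rewrite H. ring.
  - specialize (H (S n)). simpl in H. rewrite IH1, IH2 in H.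
    replace (u (S (S n))) with (/ RtoC (a (S n)) * (RtoC (a n) * 0 + RtoC (b (S n)) * 0
      + RtoC (a (S n)) * u (S (S n)))) by (field; auto).
    rewrite H. ring.
Qed.

(** Interlacing with [J^[1]] gives in the limit only weak inequalities; strictness amounts to
    simplicity of the eigenvalues. *)
Lemma inv_eigenvalue_strict (a b h : nat -> R) (j : nat) : green_data a b h ->
  (inv_eigenvalue a b (S j) < inv_eigenvalue a b j)%R.
Proof.
  intro G. pose proof (green_data_shift a b h G) as G1.
  pose proof (inv_eigenvalue_lim a b h j G) as L0.
  pose proof (inv_eigenvalue_lim a b h (S j) G) as LS.
  pose proof (inv_eigenvalue_lim _ _ _ j G1) as L1.
  apply is_lim_seq_incr_1 in L0. apply is_lim_seq_incr_1 in LS.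
  assert (I0 : (inv_eigenvalue (shift a) (shift b) j <= inv_eigenvalue a b j)%R).
  { apply (is_lim_seq_le _ _ (inv_eigenvalue (shift a) (shift b) j) (inv_eigenvalue a b j)
      (fun n => proj2 (inv_roots_top a b h n j G)) L1 L0). }
  assert (I1 : (inv_eigenvalue a b (S j) <= inv_eigenvalue (shift a) (shift b) j)%R).
  { apply (is_lim_seq_le _ _ (inv_eigenvalue a b (S j)) (inv_eigenvalue (shift a) (shift b) j)
      (fun n => proj1 (inv_roots_top a b h n j G)) LS L1). }
  destruct (Rle_lt_or_eq_dec _ _ (Rle_trans _ _ _ I1 I0)) as [|E]; auto. exfalso.
  (* otherwise the solution [decaying] at [z] vanishes at index 0 *)
  set (z := RtoC (/ inv_eigenvalue a b j)%R).
  pose proof (inv_eigenvalue_pos a b h j G) as Hp.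
  assert (Z : forall t, t = inv_eigenvalue a b j -> 1 - z * RtoC t = 0).
  { intros t ->. unfold z. rewrite <- RtoC_mult, Rinv_l by lra. ring. }
  assert (Z0 : char_fun a b z = 0).
  { apply inf_prod_eq_0; [now apply (inv_eigenvalue_summable a b h)|]. exists j. now apply Z. }
  assert (Z1 : char_fun (shift a) (shift b) z = 0).
  { apply inf_prod_eq_0; [now apply (inv_eigenvalue_summable _ _ _ G1)|]. exists j.
    apply Z. lra. }
  apply (decaying_neq_vzero a b h z G). apply (eigenvector_eq_vzero a b z).
  - apply G.
  - intro n. rewrite (jacobi_action_decaying a b h z n G), Z0. ring.
  - unfold decaying. change (shifts 1 a) with (shift a). change (shifts 1 b) with (shift b).
    rewrite Z1. ring.
Qed.

(** * Eigenvalues and resolvent *)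

Lemma jacobi_action_decaying_vec (a b h : nat -> R) (z : C) : green_data a b h ->
  jacobi_action a b (decaying a b h z) =
  vadd (vscal z (decaying a b h z)) (vscal (char_fun a b z) (basis 0)).
Proof.
  intro G. apply functional_extensionality. intro n. now apply jacobi_action_decaying.
Qed.

(** At a zero of [char_fun], [decaying] is an eigenvector. Conversely, pairing an eigenvector [u]
    with [decaying] by Green's formula gives [char_fun a b l * u_0 = 0], and [u_0] cannot vanish. *)
Lemma is_eigenvalue_char_fun (a b h : nat -> R) (l : C) : green_data a b h ->
  is_eigenvalue (jacobi_operator a b) l <-> char_fun a b l = 0.
Proof.
  intro G. set (psi := decaying a b h l).
  assert (Hpsi : ell2 psi) by now apply ell2_decaying.
  pose proof (jacobi_action_decaying_vec a b h l G) as Hj. fold psi in Hj.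
  assert (Hjpsi : ell2 (jacobi_action a b psi)).
  { rewrite Hj. apply ell2_vadd; auto using ell2_vscal, ell2_basis. }
  split.
  - intros (u & Hu0 & Hu).
    pose proof (jacobi_operator_symmetric a b psi u _ Hpsi Hjpsi Hu) as E.
    assert (Hu2 : ell2 u) by apply Hu.
    rewrite Hj, (bil_sym _ u), bil_vadd_r, !bil_vscal_r, (bil_sym u), (bil_sym u (basis 0)),
      bil_basis_l in E by auto using ell2_vscal, ell2_basis.
    assert (E' : char_fun a b l * u 0%nat = 0).
    { replace (char_fun a b l * u 0%nat) with
       ((l * bil psi u + char_fun a b l * u 0%nat) - l * bil psi u) by ring.
      rewrite <- E. ring. }
    apply Cmult_neq_0_or in E'. destruct E' as [|E']; auto. exfalso. apply Hu0.
    apply (eigenvector_eq_vzero a b l); auto; [apply G|].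
    intro n. now rewrite <- (jacobi_operator_action a b u _ Hu).
  - intro H0. exists psi. split; [now apply decaying_neq_vzero|].
    replace (vscal l psi) with (jacobi_action a b psi); [now apply G|].
    rewrite Hj, H0. apply functional_extensionality. intro n. unfold vadd, vscal. ring.
Qed.

Lemma is_eigenvalue_sequence_inv (a b h : nat -> R) : green_data a b h ->
  is_eigenvalue_sequence (jacobi_operator a b) (fun n => / inv_eigenvalue a b n)%R.
Proof.
  intro G. split.
  - intro n. apply Rinv_lt_contravar; [|now apply (inv_eigenvalue_strict a b h)].
    apply Rmult_lt_0_compat; now apply (inv_eigenvalue_pos a b h).
  - intro l. rewrite (is_eigenvalue_char_fun a b h l G). unfold char_fun.
    rewrite inf_prod_eq_0 by now apply (inv_eigenvalue_summable a b h).
    split; intros (j & E); exists j; pose proof (inv_eigenvalue_pos a b h j G) as Hp;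
      assert (Hc : RtoC (inv_eigenvalue a b j) <> 0) by (apply RtoC_neq_0; lra).
    + rewrite RtoC_inv by lra.
      replace l with (/ RtoC (inv_eigenvalue a b j) *
        (1 - (1 - l * RtoC (inv_eigenvalue a b j)))) by (field; auto).
      rewrite E. ring.
    + rewrite E, RtoC_inv by lra. field. auto.
Qed.

(** The [epsilon] choice is pinned down by uniqueness of increasing enumerations. *)
Lemma eigenvalue_sequence_inv (a b h : nat -> R) (n : nat) : green_data a b h ->
  (eigenvalue_sequence (jacobi_operator a b) n = / inv_eigenvalue a b n)%R.
Proof.
  intro G. pose proof (is_eigenvalue_sequence_inv a b h G) as [S1 S2].
  assert (H : is_eigenvalue_sequence (jacobi_operator a b)
    (eigenvalue_sequence (jacobi_operator a b))).
  { unfold eigenvalue_sequence. apply epsilon_spec.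
    eexists. now apply (is_eigenvalue_sequence_inv a b h). }
  destruct H as [H1 H2].
  assert (Inc : forall r : nat -> R, (forall n, r n < r (S n))%R ->
    forall i j, (i < j)%nat -> (r i < r j)%R).
  { intros r Hr i j Hij. induction Hij; auto. eapply Rlt_trans; eauto. }
  apply (increasing_enumeration_unique (fun _ => True) _ (fun n => / inv_eigenvalue a b n)%R);
    auto.
  - intros i j _ _. now apply (Inc (fun n => / inv_eigenvalue a b n)%R).
  - intros i _. destruct (proj1 (S2 (RtoC (eigenvalue_sequence (jacobi_operator a b) i))))
      as [j Hj]; [apply H2; now exists i|]. exists j. split; auto. now apply RtoC_inj.
  - intros i _. destruct (proj1 (H2 (RtoC (/ inv_eigenvalue a b i)%R)))
      as [j Hj]; [apply S2; now exists i|]. exists j. split; auto. now apply RtoC_inj.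
Qed.

Lemma characteristic_function_char_fun (a b h : nat -> R) (z : C) : green_data a b h ->
  characteristic_function (jacobi_operator a b) z = char_fun a b z.
Proof.
  intro G. apply clim_Clim_seq.
  apply clim_ext with (lin_prod (inv_eigenvalue a b) z).
  - intro n. unfold lin_prod. induction n; cbn [Cprod]; auto. rewrite IHn.
    rewrite (eigenvalue_sequence_inv a b h n G). f_equal.
    pose proof (inv_eigenvalue_pos a b h n G) as Hp.
    rewrite RtoC_inv by lra. field. apply RtoC_neq_0. lra.
  - now apply inf_prod_clim, (inv_eigenvalue_summable a b h).
Qed.

(** * Operators given by a kernel, and the resolvent *)

Definition kernel_operator (K : nat -> vec) (v : vec) : vec :=
  fun m => csum (fun n => K n m * v n).

Lemma kernel_column_ell2 (K : nat -> vec) (B : R) (s : nat -> R) (m : nat) :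
  (forall n m, Cmod (K n m) <= B * (s n * s m))%R -> ex_series (fun n => s n ^ 2)%R ->
  ell2 (fun n => K n m).
Proof.
  intros HK Hs. apply ell2_le with s (B * s m)%R; auto.
  intro n. specialize (HK n m). lra.
Qed.

(** The kernel is dominated by the rank one kernel [s_n s_m], so Cauchy-Schwarz in [n] bounds entry
    [m] of the image by a multiple of [s_m]. *)
Lemma kernel_operator_bounded (K : nat -> vec) (B : R) (s : nat -> R) :
  (0 <= B)%R -> (forall n, 0 <= s n)%R ->
  (forall n m, Cmod (K n m) <= B * (s n * s m))%R -> ex_series (fun n => s n ^ 2)%R ->
  bounded_operator (kernel_operator K).
Proof.
  intros HB Hs0 HK Hs.
  assert (HC : forall m, ell2 (fun n => K n m))
    by (intro m; now apply kernel_column_ell2 with B s).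
  set (sv := (fun n => RtoC (s n)) : vec).
  assert (Hsv : forall n, Cmod (sv n) = s n) by (intro n; now apply Cmod_RtoC_nonneg).
  assert (Hsv2 : ell2 sv).
  { apply ell2_le with s 1%R; auto. intro n. rewrite Hsv. lra. }
  assert (Hb : forall v, ell2 v -> forall m,
    (Cmod (kernel_operator K v m) <= B * norm2 sv * norm2 v * Cmod (sv m))%R).
  { intros v Hv m. rewrite Hsv.
    eapply Rle_trans; [apply (Cmod_bil_le (fun n => K n m) v); auto|].
    assert (norm2 (fun n => K n m) <= B * s m * norm2 sv)%R.
    { apply norm2_le; auto; [now apply Rmult_le_pos|]. intro n. rewrite Hsv.
      specialize (HK n m). lra. }
    pose proof (norm2_ge_0 v).
    apply Rle_trans with (B * s m * norm2 sv * norm2 v)%R; [now apply Rmult_le_compat_r | lra]. }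
  repeat split.
  - intros v Hv. now apply ell2_le_ell2 with (1 := Hb v Hv).
  - intros u v Hu Hv. apply functional_extensionality. intro m.
    apply (bil_vadd_r (fun n => K n m) u v); auto.
  - intros c u Hu. apply functional_extensionality. intro m.
    apply (bil_vscal_r c (fun n => K n m) u); auto.
  - exists (B * norm2 sv * norm2 sv)%R. intros v Hv.
    eapply Rle_trans; [apply norm2_le with (3 := Hb v Hv); auto|].
    + repeat apply Rmult_le_pos; auto using norm2_ge_0.
    + lra.
Qed.

Lemma jacobi_action_kernel_operator (a b : nat -> R) (K : nat -> vec) (v : vec) :
  (forall m, ell2 (fun n => K n m)) -> ell2 v ->
  forall m, jacobi_action a b (kernel_operator K v) m =
    csum (fun n => jacobi_action a b (K n) m * v n).
Proof.
  intros HK Hv m. unfold kernel_operator.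
  assert (Hs : forall m, abs_summable (fun n => K n m * v n)).
  { intro k. now apply (abs_summable_mult (fun n => K n k) v). }
  destruct m as [|m]; simpl jacobi_action.
  - rewrite <- !csum_scal, <- csum_plus by auto using abs_summable_scal.
    apply csum_ext. intro n. ring.
  - rewrite <- !csum_scal, <- !csum_plus
      by auto using abs_summable_scal, abs_summable_plus.
    apply csum_ext. intro n. ring.
Qed.

(** The reciprocal roots have sums bounded in [n], so moving from 0 to [z] costs only a factor
    independent of [n]. *)
Lemma first_kind_Cmod_le (a b h : nat -> R) (z : C) (n : nat) : green_data a b h ->
  (Cmod (first_kind a b z n) <=
    exp (Cmod z * (2 * Series (green_diag a b h))) * (jacobi_rdet a b 0 n / aprod a n))%R.
Proof.
  intro G. unfold first_kind.
  pose proof (green_data_rdet_pos a b h G n) as Hd.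
  pose proof (aprod_pos a n (gd_a _ _ _ G)) as HA.
  rewrite Cmod_mult, Cmod_R. unfold Rdiv at 1.
  rewrite Rabs_mult, Rabs_sgn, Rmult_1_l, Rabs_pos_eq by (left; now apply Rinv_0_lt_compat).
  rewrite (jacobi_det_inv_roots a b h n n z G (le_n n)), Cmod_mult, Cmod_R, Rabs_pos_eq by lra.
  fold (lin_prod (inv_roots a b n) z n).
  assert (E : (Cmod (lin_prod (inv_roots a b n) z n) <=
    exp (Cmod z * (2 * Series (green_diag a b h))))%R).
  { eapply Rle_trans; [apply lin_prod_Cmod_le; intro; now apply (inv_roots_nonneg a b h)|].
    apply exp_mono, Rmult_le_compat_l; [apply Cmod_ge_0 | now apply inv_roots_rsum_le]. }
  apply Rle_trans with (/ aprod a n * (jacobi_rdet a b 0 n *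
    exp (Cmod z * (2 * Series (green_diag a b h)))))%R.
  - apply Rmult_le_compat_l; [left; now apply Rinv_0_lt_compat|].
    apply Rmult_le_compat_l; lra.
  - right. unfold Rdiv. ring.
Qed.

(** The inequality [|G_(n,k)|^2 <= G_(n,n) G_(k,k)] for the entries of [J^{-1}]; here it follows
    from the monotonicity of the ratio of the two solutions. *)
Lemma green_offdiag_le (a b h : nat -> R) (n k : nat) : green_data a b h -> (n <= k)%nat ->
  (jacobi_rdet a b 0 n / aprod a n * h k <=
    sqrt (green_diag a b h n) * sqrt (green_diag a b h k))%R.
Proof.
  intros G Hnk. pose proof (green_ratio_le a b h n k G Hnk) as Hr.
  pose proof (green_diag_pos a b h G) as Hg.
  pose proof (green_data_rdet_pos a b h G) as Hd.
  pose proof (fun i => aprod_pos a i (gd_a _ _ _ G)) as HA.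
  pose proof (gd_h _ _ _ G) as Hh.
  set (q := fun i => (jacobi_rdet a b 0 i / aprod a i)%R).
  assert (Hq : forall i, (0 < q i)%R) by (intro i; now apply Rdiv_lt_0_compat).
  assert (E : forall i, h i = (green_ratio a b h i * q i)%R).
  { intro i. unfold green_ratio, q. specialize (Hd i). specialize (HA i). field. lra. }
  assert (Eg : forall i, green_diag a b h i = (q i ^ 2 * green_ratio a b h i)%R).
  { intro i. unfold green_diag. fold (q i). rewrite (E i) at 1. ring. }
  fold (q n). rewrite <- sqrt_mult by (left; auto).
  apply Rsqr_incr_0_var; [|apply sqrt_pos].
  rewrite Rsqr_sqrt by (left; now apply Rmult_lt_0_compat). unfold Rsqr.
  rewrite !Eg, (E k).
  assert (Hk : (0 <= green_ratio a b h k)%R) by (left; apply green_ratio_pos; apply G).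
  replace (q n * (green_ratio a b h k * q k) * (q n * (green_ratio a b h k * q k)))%R with
    (q n ^ 2 * q k ^ 2 * green_ratio a b h k * green_ratio a b h k)%R by ring.
  replace (q n ^ 2 * green_ratio a b h n * (q k ^ 2 * green_ratio a b h k))%R with
    (q n ^ 2 * q k ^ 2 * green_ratio a b h k * green_ratio a b h n)%R by ring.
  apply Rmult_le_compat_l; auto.
  apply Rmult_le_pos; auto. apply Rmult_le_pos; apply pow2_ge_0.
Qed.

(** The kernel is [p_min psi_max / W]. Both solutions are bounded by constant multiples of those at
    0, so its entries are dominated by [s_n s_m], with [s^2] the summable Green diagonal. The kernel
    equation makes it a right inverse, and it is the only solution because [z] is not an
    eigenvalue. *)
Lemma jacobi_resolvent_exists (a b h : nat -> R) (z : C) : green_data a b h ->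
  char_fun a b z <> 0 -> exists R, inverse_of (op_shift (jacobi_operator a b) z) R.
Proof.
  intros G HW. set (W := char_fun a b z) in *.
  set (p := first_kind a b z). set (psi := decaying a b h z).
  set (K := (fun k => vscal (/ W) (green_kernel p psi k)) : nat -> vec).
  set (e := exp (Cmod z * (2 * Series (green_diag a b h)))).
  set (s := fun n => sqrt (green_diag a b h n)).
  assert (Hs0 : forall n, (0 <= s n)%R) by (intro; apply sqrt_pos).
  assert (He : (0 < e)%R) by apply exp_pos.
  assert (Hs : ex_series (fun n => s n ^ 2)%R).
  { apply ex_series_ext with (green_diag a b h); [|apply G]. intro n. unfold s.
    rewrite <- Rsqr_pow2, Rsqr_sqrt; auto. left. now apply green_diag_pos. }
  assert (Hps : forall n k, (n <= k)%nat -> (Cmod (p n * psi k) <= e * e * (s n * s k))%R).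
  { intros n k Hnk. rewrite Cmod_mult.
    pose proof (first_kind_Cmod_le a b h z n G) as K1. fold p e in K1.
    pose proof (decaying_Cmod_le a b h z k G) as K2. fold psi e in K2.
    pose proof (green_offdiag_le a b h n k G Hnk) as K3. fold (s n) (s k) in K3.
    apply Rle_trans with
      ((e * (jacobi_rdet a b 0 n / aprod a n)) * (e * h k))%R.
    - apply Rmult_le_compat; auto using Cmod_ge_0.
    - replace (e * (jacobi_rdet a b 0 n / aprod a n) * (e * h k))%R with
        (e * e * (jacobi_rdet a b 0 n / aprod a n * h k))%R by ring.
      apply Rmult_le_compat_l; auto. apply Rmult_le_pos; lra. }
  pose proof (proj1 (Cmod_gt_0 W) HW) as HWp.
  assert (HB0 : (0 <= / Cmod W * (e * e))%R).
  { apply Rmult_le_pos; [left; now apply Rinv_0_lt_compat | apply Rmult_le_pos; lra]. }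
  assert (HK : forall n m, (Cmod (K n m) <= / Cmod W * (e * e) * (s n * s m))%R).
  { intros n m. unfold K, vscal. rewrite Cmod_mult, Cmod_inv by auto.
    rewrite Rmult_assoc. apply Rmult_le_compat_l; [left; now apply Rinv_0_lt_compat|].
    unfold green_kernel. destruct (Nat.leb_spec m n).
    - rewrite (Rmult_comm (s n)). now apply Hps.
    - apply Hps. lia. }
  pose proof (kernel_operator_bounded K _ s HB0 Hs0 HK Hs) as HR.
  assert (HC : forall m, ell2 (fun n => K n m))
    by (intro m; now apply kernel_column_ell2 with (2 := Hs) (1 := HK)).
  set (T := kernel_operator K) in *.
  assert (T1 : forall v, ell2 v -> ell2 (T v)) by apply HR.
  assert (HT : forall v, ell2 v -> jacobi_action a b (T v) = vadd v (vscal z (T v))).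
  { intros v Hv. apply functional_extensionality. intro m. unfold T at 1.
    rewrite jacobi_action_kernel_operator by auto.
    rewrite (csum_ext _ (fun n => z * (K n m * v n) + basis m n * v n)).
    - rewrite csum_plus, csum_scal.
      + fold (bil (basis m) v). rewrite bil_basis_l. unfold vadd, vscal.
        change (csum (fun n => K n m * v n)) with (T v m). ring.
      + now apply (abs_summable_mult (fun n => K n m) v).
      + apply abs_summable_scal. now apply (abs_summable_mult (fun n => K n m) v).
      + apply abs_summable_mult; auto using ell2_basis.
    - intro n.
      assert (E : jacobi_action a b (K n) m = / W * jacobi_action a b (green_kernel p psi n) m).
      { unfold K, vscal. destruct m; simpl jacobi_action; ring. }
      rewrite E, (jacobi_action_green_kernel a b z W).
      + unfold K, vscal. replace (basis m n) with (basis n m).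
        * field. auto.
        * unfold basis. now rewrite Nat.eqb_sym.
      + intro i. unfold p. rewrite jacobi_action_first_kind by apply G. reflexivity.
      + apply first_kind_0.
      + intro i. now apply jacobi_action_decaying. }
  exists T. split; auto. intros u v Hv. unfold op_shift.
  assert (HJT : jacobi_operator a b (T v) (vadd v (vscal z (T v)))).
  { rewrite <- HT by auto. apply G; auto. rewrite HT by auto.
    apply ell2_vadd; auto using ell2_vscal. }
  split; [|now intros ->].
  intro Hu. assert (Hu2 : ell2 u) by apply Hu.
  destruct (classic (vsub u (T v) = vzero)) as [E|E]; [now apply vsub_eq_vzero|].
  exfalso. apply HW. apply (is_eigenvalue_char_fun a b h z G).
  exists (vsub u (T v)). split; auto.
  assert (Ej : jacobi_action a b (vsub u (T v)) = vscal z (vsub u (T v))).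
  { rewrite jacobi_action_vsub, <- (jacobi_operator_action _ _ _ _ Hu), HT by auto.
    apply functional_extensionality. intro n. unfold vsub, vadd, vscal. ring. }
  rewrite <- Ej. apply G; [now auto using ell2_vsub|]. rewrite Ej.
  auto using ell2_vscal, ell2_vsub.
Qed.

Lemma second_kind_decaying (a b h : nat -> R) (k : nat) (z : C) : green_data a b h ->
  char_fun a b z <> 0 ->
  second_kind (jacobi_operator a b) k z = decaying a b h z k / char_fun a b z.
Proof.
  intros G HW. unfold second_kind. rewrite inner_basis_l.
  assert (HR : inverse_of (op_shift (jacobi_operator a b) z) (resolvent (jacobi_operator a b) z)).
  { unfold resolvent. apply epsilon_spec. now apply (jacobi_resolvent_exists a b h). }
  destruct HR as [_ HR].
  set (W := char_fun a b z) in *. set (psi := decaying a b h z).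
  assert (Hpsi : ell2 psi) by now apply ell2_decaying.
  rewrite <- (proj1 (HR (vscal (/ W) psi) (basis 0) (ell2_basis 0))).
  - unfold vscal, Cdiv. ring.
  - unfold op_shift.
    assert (E : jacobi_action a b (vscal (/ W) psi) =
      vadd (basis 0) (vscal z (vscal (/ W) psi))).
    { apply functional_extensionality. intro n.
      transitivity (/ W * jacobi_action a b psi n).
      - unfold vscal. destruct n; simpl jacobi_action; ring.
      - unfold psi. rewrite jacobi_action_decaying by auto. fold W psi.
        unfold vadd, vscal. field. auto. }
    rewrite <- E. apply G; [now apply ell2_vscal|]. rewrite E.
    apply ell2_vadd; auto using ell2_vscal, ell2_basis.
Qed.

(** * Meromorphy *)

Lemma char_fun_ex_derive (a b h : nat -> R) (z : C) : green_data a b h ->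
  ex_derive (char_fun a b) z.
Proof. intro G. now apply inf_prod_ex_derive, (inv_eigenvalue_summable a b h). Qed.

Lemma inv_eigenvalue_inj (a b h : nat -> R) (i j : nat) : green_data a b h ->
  inv_eigenvalue a b i = inv_eigenvalue a b j -> i = j.
Proof.
  intro G.
  assert (K : forall i j, (i < j)%nat -> (inv_eigenvalue a b j < inv_eigenvalue a b i)%R).
  { intros p q Hpq. induction Hpq; [now apply (inv_eigenvalue_strict a b h)|].
    eapply Rlt_trans; [now apply (inv_eigenvalue_strict a b h) | exact IHHpq]. }
  intro E. destruct (lt_eq_lt_dec i j) as [[H|H]|H]; auto; apply K in H; lra.
Qed.

(** The order is 0 or 1: the reciprocal eigenvalues are distinct, so at a zero exactly one factor
    vanishes, and the product of the others is nonzero there. *)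
Lemma char_fun_factor (a b h : nat -> R) (z0 : C) : green_data a b h ->
  exists (n : nat) (g : C -> C), (forall z, ex_derive g z) /\ g z0 <> 0 /\
    forall z, char_fun a b z = Cpow (z - z0) n * g z.
Proof.
  intro G. destruct (inv_eigenvalue_summable a b h G) as [Hs _].
  destruct (classic (char_fun a b z0 = 0)) as [H0|H0].
  - apply (inf_prod_eq_0 _ _ Hs) in H0. destruct H0 as [j Hj].
    set (nu := inv_eigenvalue a b) in *.
    exists 1%nat, (fun z => - RtoC (nu j) * inf_prod (omit j nu) z).
    split; [|split].
    + intro z. apply (ex_derive_C_mult (fun _ => - RtoC (nu j))).
      * apply ex_derive_const.
      * now apply inf_prod_ex_derive, summable_omit.
    + intro E. apply Cmult_neq_0_or in E. destruct E as [E|E].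
      * assert (Ej : RtoC (nu j) = 0) by (replace (RtoC (nu j)) with (- - RtoC (nu j)) by ring; rewrite E; ring).
        rewrite Ej in Hj. apply (RtoC_neq_0 1); [lra|]. rewrite <- Hj. ring.
      * apply (inf_prod_eq_0 _ _ (summable_omit j _ Hs)) in E. destruct E as [i Hi].
        unfold omit in Hi. destruct (Nat.eqb_spec i j) as [|Hij].
        -- apply (RtoC_neq_0 1); [lra|]. rewrite <- Hi. ring.
        -- apply Hij, (inv_eigenvalue_inj a b h i j G). apply RtoC_inj.
           fold nu. destruct (classic (z0 = 0)) as [Ez|Ez].
           ++ exfalso. apply (RtoC_neq_0 1); [lra|]. rewrite <- Hi, Ez. ring.
           ++ replace (RtoC (nu i)) with (/ z0 * (1 - (1 - z0 * RtoC (nu i)))) by (field; auto).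
              rewrite Hi, <- Hj. field. auto.
    + intro z. unfold char_fun. fold nu. rewrite (inf_prod_omit nu z j Hs).
      replace (1 - z * RtoC (nu j)) with
        ((1 - z0 * RtoC (nu j)) - (z - z0) * RtoC (nu j)) by ring.
      rewrite Hj. simpl Cpow. ring.
  - exists O, (char_fun a b). split; [|split]; auto.
    + intro z. now apply (char_fun_ex_derive a b h).
    + intro z. simpl. ring.
Qed.

Lemma locally'_char_fun_neq_0 (a b h : nat -> R) (z0 : C) : green_data a b h ->
  locally' z0 (fun z => char_fun a b z <> 0).
Proof.
  intro G. destruct (char_fun_factor a b h z0 G) as (n & g & Hg & Hg0 & E).
  destruct (ex_derive_C_neq_0 g z0 (Hg z0) Hg0) as (d & Hd & K).
  apply locally'_C_Cmod. exists d. split; auto. intros w Hw Hwz H0.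
  rewrite E in H0. apply Cmult_neq_0_or in H0. destruct H0 as [H0|H0]; [|now apply (K w)].
  assert (Hne : w - z0 <> 0) by (intro; now apply Hwz, Cminus_eq_0).
  revert H0. now apply Cpow_nz.
Qed.

Lemma locally'_and (z : C) (P Q : C -> Prop) :
  locally' z P -> locally' z Q -> locally' z (fun w => P w /\ Q w).
Proof. intros HP HQ. now apply filter_and. Qed.

Lemma locally'_imp (z : C) (P Q : C -> Prop) : (forall w, P w -> Q w) ->
  locally' z P -> locally' z Q.
Proof. intros H. now apply filter_imp. Qed.

(** Only punctured neighbourhoods enter, so the arbitrary values of [f] at zeros of the denominator
    are harmless; the order of such a zero serves as the exponent. *)
Lemma meromorphic_quotient (a b h : nat -> R) (N f : C -> C) : green_data a b h ->
  (forall z, ex_derive N z) ->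
  (forall z0, locally' z0 (fun z => f z = N z / char_fun a b z)) -> meromorphic f.
Proof.
  intros G HN Hf z0. destruct (char_fun_factor a b h z0 G) as (n & g & Hg & Hg0 & E).
  destruct (ex_derive_C_neq_0 g z0 (Hg z0) Hg0) as (d & Hd & K).
  exists n, (fun z => N z * / g z). split.
  - apply locally_C_Cmod. exists d. split; auto. intros w Hw.
    apply ex_derive_C_mult; auto. apply ex_derive_C_inv; auto.
  - assert (Hl : locally' z0 (fun w => g w <> 0 /\ w <> z0)).
    { apply locally'_C_Cmod. exists d. split; auto. }
    refine (locally'_imp _ _ _ _ (locally'_and _ _ _ (Hf z0) Hl)).
    intros w (H1 & H2 & H3). rewrite H1, E. field. split; auto.
    apply Cpow_nz. intro. now apply H3, Cminus_eq_0.
Qed.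

Lemma char_fun_0 (a b h : nat -> R) : green_data a b h -> char_fun a b 0 = 1.
Proof.
  intro G. destruct (inv_eigenvalue_summable a b h G) as [Hs _].
  pose proof (inf_prod_minus_1_le _ 0 Hs) as K. rewrite Cmod_0, !Rmult_0_l in K.
  apply Cminus_eq_0, Cmod_eq_0, Rle_antisym; auto. apply Cmod_ge_0.
Qed.

Lemma scaled_char_fun_ex_derive (a b h : nat -> R) (c z : C) : green_data a b h ->
  ex_derive (fun w => c * char_fun a b w) z.
Proof.
  intro G. apply (ex_derive_C_mult (fun _ => c)); [apply ex_derive_const|].
  now apply (char_fun_ex_derive a b h).
Qed.

Theorem theorem2p3 (a b : nat -> R)
  (ha : forall n : nat, (0 < a n)%R)
  (hpos : positive_definite (jacobi_operator a b))
  (htr : inverse_is_trace_class (jacobi_operator a b)) :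
  (forall k : nat,
     meromorphic_eq
       (second_kind (jacobi_operator_from 1 a b) k)
       (fun z : C =>
          (- (second_kind (jacobi_operator a b) (S k) z
              / (RtoC (a 0%nat) * weyl (jacobi_operator a b) z)))%C)) /\
  (forall k : nat,
     meromorphic_eq
       (second_kind (jacobi_operator a b) k)
       (fun z : C =>
          (second_kind (jacobi_operator a b) k (RtoC 0)
           * characteristic_function (jacobi_operator_from (k + 1) a b) z
           / characteristic_function (jacobi_operator a b) z)%C)).
Proof.
  destruct (green_data_of_trace_class a b ha hpos htr) as [h G].
  split; intro k.
  - pose proof (green_data_shift a b h G) as G1.
    change (jacobi_operator_from 1 a b) with (jacobi_operator (shift a) (shift b)).
    set (N := fun z => RtoC (sgn k * shift_h a h k) *
      char_fun (shifts (S (S k)) a) (shifts (S (S k)) b) z).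
    assert (HN : forall z, ex_derive N z).
    { intro z. eapply scaled_char_fun_ex_derive, green_data_shifts, G. }
    assert (E1 : forall z0, locally' z0 (fun z =>
      second_kind (jacobi_operator (shift a) (shift b)) k z = N z / char_fun (shift a) (shift b) z)).
    { intro z0. refine (locally'_imp _ _ _ _ (locally'_char_fun_neq_0 _ _ _ z0 G1)).
      intros z Hz. now rewrite (second_kind_decaying _ _ _ k z G1 Hz). }
    (* With [F] and [F^[1]] the two characteristic functions, [weyl] is [h_0 F^[1] / F], so the
       quotient is computed off the zeros of both. There [F] cancels, and the minus sign is absorbed
       by [sgn (S k) = - sgn k]. *)
    assert (E2 : forall z0, locally' z0 (fun z =>
      - (second_kind (jacobi_operator a b) (S k) z / (RtoC (a 0%nat) * weyl (jacobi_operator a b) z))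
      = N z / char_fun (shift a) (shift b) z)).
    { intro z0. refine (locally'_imp _ _ _ _ (locally'_and _ _ _
        (locally'_char_fun_neq_0 _ _ _ z0 G) (locally'_char_fun_neq_0 _ _ _ z0 G1))).
      intros z [Hz Hz1]. unfold weyl. rewrite !(second_kind_decaying a b h _ z G Hz).
      unfold decaying, N. change (shifts 1 a) with (shift a). change (shifts 1 b) with (shift b).
      rewrite sgn_S. unfold shift_h. pose proof (ha 0%nat) as Ha. pose proof (gd_h _ _ _ G 0%nat) as Hh.
      assert (RtoC (a 0%nat) <> 0) by (apply RtoC_neq_0; lra).
      assert (RtoC (h 0%nat) <> 0) by (apply RtoC_neq_0; lra).
      rewrite !RtoC_mult, RtoC_div, RtoC_opp, RtoC_mult.
      - change (sgn 0) with 1%R. field. auto.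
      - apply Rgt_not_eq, Rlt_gt. now apply Rmult_lt_0_compat. }
    split; [|split].
    + now apply (meromorphic_quotient _ _ _ N _ G1).
    + now apply (meromorphic_quotient _ _ _ N _ G1).
    + intro z0. refine (locally'_imp _ _ _ _ (locally'_and _ _ _ (E1 z0) (E2 z0))).
      intros z [K1 K2]. now rewrite K1, K2.
  - rewrite Nat.add_1_r.
    change (jacobi_operator_from (S k) a b) with
      (jacobi_operator (shifts (S k) a) (shifts (S k) b)).
    pose proof (green_data_shifts (S k) a b h G) as Gk.
    (* Both characteristic functions are 1 at 0, which identifies the constant. *)
    assert (E0 : second_kind (jacobi_operator a b) k 0 = RtoC (sgn k * h k)).
    { rewrite (second_kind_decaying a b h k 0 G); rewrite (char_fun_0 a b h G).
      - unfold decaying. rewrite (char_fun_0 _ _ _ Gk). field.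
      - apply RtoC_neq_0. lra. }
    set (N := fun z => RtoC (sgn k * h k) * char_fun (shifts (S k) a) (shifts (S k) b) z).
    assert (HN : forall z, ex_derive N z).
    { intro z. eapply scaled_char_fun_ex_derive, Gk. }
    assert (E1 : forall z0, locally' z0 (fun z =>
      second_kind (jacobi_operator a b) k z = N z / char_fun a b z)).
    { intro z0. refine (locally'_imp _ _ _ _ (locally'_char_fun_neq_0 _ _ _ z0 G)).
      intros z Hz. now rewrite (second_kind_decaying _ _ _ k z G Hz). }
    (* An identity between total functions, true also at the zeros of the denominator, so no point
       has to be excluded. *)
    assert (E2 : forall z, second_kind (jacobi_operator a b) k 0
      * characteristic_function (jacobi_operator (shifts (S k) a) (shifts (S k) b)) z
      / characteristic_function (jacobi_operator a b) z = N z / char_fun a b z).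
    { intro z. rewrite E0, (characteristic_function_char_fun a b h z G),
        (characteristic_function_char_fun _ _ _ z Gk). reflexivity. }
    split; [|split].
    + now apply (meromorphic_quotient _ _ _ N _ G).
    + apply (meromorphic_quotient _ _ _ N _ G HN). intro z0.
      apply locally'_C_Cmod. exists 1%R. split; [lra|]. intros w _ _. apply E2.
    + intro z0. refine (locally'_imp _ _ _ _ (E1 z0)).
      intros z K1. now rewrite K1, E2.
Qed.
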